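(* Let $(X,\mu)$ be a standard atomless probability space and let $T_1,T_2\in\mathrm{Aut}(X,[\mu])$ be ergodic transformations. The following are equivalent: (1) the commensurating full groups $[T_1]_{\mathrm{com}}$ and $[T_2]_{\mathrm{com}}$ are isomorphic as abstract groups; (2) $[T_1]_{\mathrm{com}}$ and $[T_2]_{\mathrm{com}}$ are isomorphic as topological groups; (3) $T_1$ and $T_2$ are flip-conjugate.
   Context: $\mathrm{Aut}(X,[\mu])$ is the group of measurable bijections $T:X\to X$ such that $T_*\mu$ and $\mu$ have the same null sets, two such maps being identified if they agree almost everywhere. All equalities and inclusions are understood up to null sets. $T$ is ergodic if every $T$-invariant Borel set is null or conull; $T$ is aperiodic if almost every $T$-orbit is infinite (ergodic transformations are aperiodic since $\mu$ is atomless). $T_1,T_2$ are flip-conjugate if $T_1$ is conjugate, in $\mathrm{Aut}(X,[\mu])$, to $T_2$ or to $T_2^{-1}$. Let $T\in\mathrm{Aut}(X,[\mu])$ be aperiodic. The full group $[T]$ is the group of $S\in\mathrm{Aut}(X,[\mu])$ such that for a.e. $x$, $S(x)=T^{c_S(x)}(x)$ for some integer $c_S(x)$; the a.e. uniquely defined measurable map $c_S:X\to\mathbb Z$ is the cocycle of $S$. Let $\mathrm{Sym}(\mathbb Z,\mathbb N)$ be the group of permutations $\sigma$ of $\mathbb Z$ with $|\sigma(\mathbb N)\triangle\mathbb N|<\infty$, with the group topology for which a basis of neighborhoods of the identity is given by the pointwise stabilizers of finite subsets of $\mathrm{Comm}(\mathbb N)=\{M\subset\mathbb Z: |M\triangle\mathbb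 N|<\infty\}$. For $S\in[T]$, $x\in X$, define the permutation $\Phi(S)(x)$ of $\mathbb Z$ by $\Phi(S)(x)(n)=n+c_S(T^n(x))$. The commensurating full group is $$[T]_{\mathrm{com}}=\{S\in[T]:\ \Phi(S)(x)\in\mathrm{Sym}(\mathbb Z,\mathbb N)\text{ for a.e. }x\},$$ endowed with the topology pulled back by $\Phi$ from $\mathrm L^0(X,\mu,\mathrm{Sym}(\mathbb Z,\mathbb N))$, the group (under pointwise multiplication) of measurable maps $X\to\mathrm{Sym}(\mathbb Z,\mathbb N)$ modulo a.e. equality, with the topology of convergence in measure. *)

(* Defs.v *)
From HB Require Import structures.
From mathcomp Require Import all_boot all_order all_algebra.
From mathcomp Require Import all_classical all_reals all_analysis.
From mathcomp Require Import zify.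

Set Implicit Arguments.
Unset Strict Implicit.
Unset Printing Implicit Defensive.
Import Order.TTheory GRing.Theory Num.Theory.

Local Open Scope classical_set_scope.
Local Open Scope ring_scope.
Local Open Scope quotient_scope.

(** * The Polish group Sym(Z, N) *)

Definition natZ : set int := [set n | 0 <= n].

Definition commN : set (set int) := [set M | finite_set (M `+` natZ)].

Lemma commN_image (f : int -> int) (M : set int) :
  commN (f @` natZ) -> commN M -> commN (f @` M).
Proof.
move=> fN MN; apply: (@sub_finite_set _ _
  (f @` (M `+` natZ) `|` ((f @` natZ) `+` natZ))); last first.
  by rewrite finite_setU; split => //; exact: finite_image.
rewrite !setY_def => n [[[m Mm <-] nN]|[Nn nM]] /=.
  have [mN|mN] := pselect (natZ m).
    by right; left; split => //; exists m.
  by left; exists m => //; left.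
have [[m Nm smn]|sN] := pselect ((f @` natZ) n); last by right; right.
by left; exists m => //; right; split => // Mm; apply: nM; exists m.
Qed.

(* A permutation is stored with its inverse so that no choice is needed to
   invert it; by [symZN_eqP] the element is determined by [symf]. *)
Record symZN : Type := SymZN {
  symf :> int -> int;
  symi : int -> int;
  symfK : cancel symf symi;
  symiK : cancel symi symf;
  symf_commN : finite_set ((symf @` natZ) `+` natZ) }.

HB.instance Definition _ := gen_eqMixin symZN.
HB.instance Definition _ := gen_choiceMixin symZN.

Lemma symZN_eqP (s t : symZN) : s =1 t -> s = t.
Proof.
case: s => f g fK gK fN; case: t => f' g' fK' gK' fN' /= /funext e.
subst f'.
have e : g = g' by apply/funext => n; rewrite -[in RHS](gK n) fK'.
subst g'.
by rewrite (Prop_irrelevance fK fK') (Prop_irrelevance gK gK')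
  (Prop_irrelevance fN fN').
Qed.

Lemma symZN_one_subproof : finite_set ((@id int @` natZ) `+` natZ).
Proof. by rewrite image_id setYK. Qed.

Definition symZN_one : symZN :=
  @SymZN id id (fun _ => erefl) (fun _ => erefl) symZN_one_subproof.

Lemma symZN_inv_subproof (s : symZN) :
  finite_set ((symi s @` natZ) `+` natZ).
Proof.
apply: (@sub_finite_set _ _ (symi s @` ((s @` natZ) `+` natZ))); last first.
  exact/finite_image/symf_commN.
rewrite !setY_def => n [[[m Nm <-] nN]|[Nn nN]].
  exists m => //; right; split => // -[k Nk km].
  by apply: nN; rewrite -km symfK.
exists (s n); last exact: symfK.
left; split; first by exists n.
by move=> sn; apply: nN; exists (s n) => //; exact: symfK.
Qed.

Definition symZN_inv (s : symZN) : symZN :=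
  SymZN (@symiK s) (@symfK s) (symZN_inv_subproof s).

Lemma symZN_mul_subproof (s t : symZN) :
  finite_set (((s \o t) @` natZ) `+` natZ).
Proof.
rewrite -image_comp; apply: commN_image; exact: symf_commN.
Qed.

Definition symZN_mul (s t : symZN) : symZN :=
  SymZN (can_comp (@symfK s) (@symfK t)) (can_comp (@symiK t) (@symiK s))
    (symZN_mul_subproof s t).

Lemma symZN_mulA : associative symZN_mul.
Proof. by move=> s t u; exact: symZN_eqP. Qed.
Lemma symZN_mul1g : left_id symZN_one symZN_mul.
Proof. by move=> s; exact: symZN_eqP. Qed.
Lemma symZN_mulg1 : right_id symZN_one symZN_mul.
Proof. by move=> s; exact: symZN_eqP. Qed.
Lemma symZN_mulVg : left_inverse symZN_one symZN_inv symZN_mul.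
Proof. by move=> s; apply: symZN_eqP => n; exact: symfK. Qed.
Lemma symZN_mulgV : right_inverse symZN_one symZN_inv symZN_mul.
Proof. by move=> s; apply: symZN_eqP => n; exact: symiK. Qed.

HB.instance Definition _ := isGroup.Build symZN symZN_mulA symZN_mul1g
  symZN_mulg1 symZN_mulVg symZN_mulgV.
HB.instance Definition _ := isPointed.Build symZN 1%g.

Definition pstab (E : set (set int)) : set symZN :=
  [set s | forall M, E M -> s @` M = M].

Definition symZN_nbhs (s : symZN) : set_system symZN :=
  filter_from [set E | finite_set E /\ E `<=` commN]
    (fun E => [set (s * t)%g | t in pstab E]).

HB.instance Definition _ := hasNbhs.Build symZN symZN_nbhs.

Lemma pstab1 E : pstab E 1%g.
Proof. by move=> M _; rewrite image_id. Qed.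

Lemma pstabM E (s t : symZN) : pstab E s -> pstab E t -> pstab E (s * t)%g.
Proof. by move=> Es Et M EM; rewrite -[LHS]image_comp Et// Es. Qed.

Lemma symZN_nbhs_filter (s : symZN) : ProperFilter (nbhs s).
Proof.
apply: filter_from_proper; last first.
  by move=> E _; exists (s * 1)%g; exists 1%g => //; exact: pstab1.
apply: filter_from_filter; first by exists set0; split.
move=> E F [fE EN] [fF FN]; exists (E `|` F).
  by split; [rewrite finite_setU|move=> M [/EN|/FN]].
move=> _ [t tEF <-]; split; exists t => // M EM; apply: tEF; first by left.
by right.
Qed.

Lemma symZN_nbhs_singleton (s : symZN) (A : set symZN) : nbhs s A -> A s.
Proof.
case=> E _; apply; exists 1%g; first exact: pstab1.
by rewrite mulg1.
Qed.

Lemma symZN_nbhs_nbhs (s : symZN) (A : set symZN) :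
  nbhs s A -> nbhs s (nbhs^~ A).
Proof.
case=> E DE EA; exists E => // _ [t Et <-]; exists E => // _ [u Eu <-].
by apply: EA; exists (t * u)%g; [exact: pstabM|rewrite mulgA].
Qed.

HB.instance Definition _ := Nbhs_isNbhsTopological.Build symZN
  symZN_nbhs_filter symZN_nbhs_singleton symZN_nbhs_nbhs.

(* Sym(Z, N) with its Borel sigma-algebra *)
Notation symZN_borel := (g_sigma_algebraType (@open symZN)).

(* Countable codes for Comm(N) and for a countable base of Sym(Z, N). *)
Definition natM (a : seq int) : set int := [set` a] `+` natZ.

Lemma natM_commN a : commN (natM a).
Proof. by rewrite /commN /natM /= -setYA setYK setY0; exact: finite_seq. Qed.

Lemma commN_natM M : commN M -> exists a, M = natM a.
Proof.
by move=> /finite_seqP[a Ma]; exists a; rewrite /natM -Ma -setYA setYK setY0.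
Qed.

Definition cyl (l : seq (seq int * seq int)) : set symZN :=
  [set s | forall p, p \in l -> s @` natM p.1 = natM p.2].

Lemma cyl_pstab (s : symZN) E : finite_set E -> E `<=` commN ->
  exists l, cyl l s /\ cyl l `<=` [set (s * t)%g | t in pstab E].
Proof.
move=> /finite_seqP[e Ee] EN.
pose code (M : set int) := xget [::] [set a | M = natM a].
have codeE M : commN M -> natM (code M) = M.
  by move=> /commN_natM[a Ma]; rewrite {}Ma /code; case: xgetP => [b ->/= <-//|/(_ a)/(_ erefl)].
have eN M : M \in e -> commN M by move=> Me; apply: EN; rewrite Ee.
have seN M : M \in e -> commN (s @` M).
  by move=> Me; apply: commN_image (eN _ Me); exact: symf_commN.
exists [seq (code M, code (s @` M)) | M <- e]; split.
  by move=> _ /mapP[M Me ->] /=; rewrite !codeE//; [exact: seN|exact: eN].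
move=> t tl; exists (s^-1 * t)%g; last by rewrite mulVKg.
move=> M; rewrite Ee /= => Me.
have /= := tl _ (map_f (fun M => (code M, code (s @` M))) Me).
rewrite !codeE//; [|exact: seN|exact: eN].
move=> tM; rewrite -[LHS](image_comp t (s^-1)%g M) tM image_comp.
by rewrite -[RHS]image_id; congr image; apply/funext => n; exact: symfK.
Qed.

Lemma open_cyl (U : set symZN) : open U ->
  U = \bigcup_(l in [set l | cyl l `<=` U]) cyl l.
Proof.
rewrite openE => oU; apply/seteqP; split => s; last by case=> l; exact.
move=> /oU[E [fE EN] EU]; have [l [ls lE]] := cyl_pstab s fE EN.
by exists l => //=; apply: subset_trans lE EU.
Qed.

Lemma open_symZN_image (M M' : set int) : commN M ->
  open [set s : symZN | s @` M = M'].
Proof.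
move=> MN; rewrite openE => s /= sM; exists [set M].
  by split => [|_ ->//]; exact: finite_set1.
move=> _ [t tM <-] /=; rewrite -[LHS](image_comp t s M).
by rewrite tM.
Qed.

Section symZN_borel_measurable.
Context d (X : measurableType d).
Implicit Types F G : X -> symZN.

Lemma measurable_symZN F :
  (forall a b, measurable [set x | F x @` natM a = natM b]) ->
  measurable_fun setT (F : X -> symZN_borel).
Proof.
move=> mF; apply: (@measurability _ _ X symZN_borel setT F (@open symZN) erefl).
move=> _ [U oU <-]; rewrite setTI (open_cyl oU) preimage_bigcup.
rewrite bigcup_mkcond; apply: countable_bigcupT_measurable; first exact: countableP.
move=> l; case: ifPn => // _.
rewrite (_ : _ @^-1` _ = \bigcap_(p in [set` l])
    [set x | F x @` natM p.1 = natM p.2]); last first.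
  by apply/seteqP; split => x.
by apply: fin_bigcap_measurable => // p _; exact: mF.
Qed.

Lemma measurable_symZN_image F M M' :
  measurable_fun setT (F : X -> symZN_borel) -> commN M ->
  measurable [set x | F x @` M = M'].
Proof.
move=> mF MN; rewrite -[X in measurable X]setTI.
rewrite -[X in _ `&` X]/(F @^-1` [set s : symZN | s @` M = M']).
by apply: mF => //; apply: sub_sigma_algebra; exact: open_symZN_image.
Qed.

Lemma measurable_symZN_divl F G :
  measurable_fun setT (F : X -> symZN_borel) ->
  measurable_fun setT (G : X -> symZN_borel) ->
  measurable_fun setT ((fun x => (F x)^-1 * G x)%g : X -> symZN_borel).
Proof.
move=> mF mG; apply: measurable_symZN => a b.
rewrite (_ : [set x | _] = \bigcup_c
    ([set x | G x @` natM a = natM c] `&` [set x | F x @` natM b = natM c])).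
  apply: countable_bigcupT_measurable; first exact: countableP.
  by move=> c; apply: measurableI; apply: measurable_symZN_image => //;
    exact: natM_commN.
have iK (s : symZN) (A : set int) : s @` ((s^-1)%g @` A) = A.
  by rewrite image_comp -[RHS]image_id; congr image; apply/funext => n;
    exact: symiK.
have Ki (s : symZN) (A : set int) : (s^-1)%g @` (s @` A) = A.
  by rewrite image_comp -[RHS]image_id; congr image; apply/funext => n;
    exact: symfK.
apply/seteqP; split => x /=.
  rewrite -[X in X = _ -> _](image_comp (G x) ((F x)^-1)%g) => ab.
  have [c Gc] : exists c, G x @` natM a = natM c.
    by apply: commN_natM; apply: commN_image; [exact: symf_commN|exact: natM_commN].
  by exists c => //; split => //=; rewrite -ab iK.
move=> [c _ [/= Gc Fc]].
by rewrite -[LHS](image_comp (G x) ((F x)^-1)%g) Gc -Fc Ki.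
Qed.

End symZN_borel_measurable.

(** * L^0(X, mu, Sym(Z, N)) with the topology of convergence in measure *)

Section L0.
Context d (X : measurableType d) (R : realType) (mu : probability X R).

Definition L0 : Type := {mfun_ mu, X >-> symZN_borel}.
HB.instance Definition _ := Choice.on L0.

Definition L0_val (F : L0) (x : X) : symZN :=
  (F : {mfun_ mu, X >-> symZN_borel}) x.

(* The neighbourhoods of F for convergence in measure are the left translates
   F * {H : mu {x | H x \notin U} < e}. *)
Definition L0_ball (F : L0) (U : set symZN) (e : R) : set L0 :=
  [set G | (mu [set x | ~ U ((L0_val F x)^-1 * L0_val G x)%g] < e%:E)%E].

Definition L0_nbhs (F : L0) : set_system L0 :=
  [set A | exists U e, [/\ open_nbhs (1%g : symZN) U, 0 < e & L0_ball F U e `<=` A]].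

HB.instance Definition _ := hasNbhs.Build L0 L0_nbhs.

Lemma L0_val_measurable (F : L0) :
  measurable_fun setT (L0_val F : X -> symZN_borel).
Proof. exact: measurable_funPT. Qed.

Lemma L0_bad_measurable (F G : L0) (U : set symZN) : open U ->
  measurable [set x | ~ U ((L0_val F x)^-1 * L0_val G x)%g].
Proof.
move=> oU; apply: measurableC; rewrite -[X in measurable X]setTI.
apply: (measurable_symZN_divl (L0_val_measurable F) (L0_val_measurable G)) => //.
exact: sub_sigma_algebra.
Qed.

Lemma L0_ball_center (F : L0) (U : set symZN) (e : R) :
  U 1%g -> 0 < e -> L0_ball F U e F.
Proof.
move=> U1 e0; rewrite /L0_ball /= (_ : [set x | _] = set0) ?measure0 ?lte_fin//.
by apply/seteqP; split => // x /=; rewrite mulVg.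
Qed.

Lemma L0_ballS (F : L0) (U V : set symZN) (e e' : R) :
  open U -> open V -> U `<=` V -> e <= e' -> L0_ball F U e `<=` L0_ball F V e'.
Proof.
move=> oU oV UV ee G FG; apply: (@le_lt_trans _ _ _ _ _ _ (lt_le_trans FG _)).
  by apply: le_measure; rewrite ?inE; [exact: L0_bad_measurable..|move=> x /= nV /UV].
by rewrite lee_fin.
Qed.

Lemma L0_nbhs_filter (F : L0) : ProperFilter (nbhs F).
Proof.
split.
  by case=> U [e [[_ U1] e0 /(_ F)]]; apply; exact: L0_ball_center.
split.
- exists setT, 1; split => //; split; [exact: openT|exact: I].
- move=> A B [U [e [[oU U1] e0 UA]]] [V [e' [[oV V1] e0' VB]]].
  exists (U `&` V), (Num.min e e'); split.
  + by split => //; exact: openI.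
  + by rewrite lt_min e0.
  + move=> G FG; split; [apply: UA|apply: VB]; apply: L0_ballS FG => //.
    * exact: openI.
    * by rewrite ge_min lexx.
    * exact: openI.
    * by rewrite ge_min lexx orbT.
- move=> A B AB [U [e [oU e0 UA]]]; exists U, e; split => //.
  exact: subset_trans UA AB.
Qed.

Lemma L0_nbhs_singleton (F : L0) (A : set L0) : nbhs F A -> A F.
Proof. by case=> U [e [[_ U1] e0]]; apply; exact: L0_ball_center. Qed.

Lemma open_pstab (E : set (set int)) : finite_set E -> E `<=` commN ->
  open (pstab E).
Proof.
move=> fE EN; rewrite openE => s sE; exists E => //.
by move=> _ [t tE <-]; exact: pstabM.
Qed.

Lemma L0_nbhs_nbhs (F : L0) (A : set L0) : nbhs F A -> nbhs F (nbhs^~ A).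
Proof.
case=> U [e [[oU U1] e0 UA]].
have [E [fE EN] EU] : nbhs (1%g : symZN) U by exact: open_nbhs_nbhs.
have {}EU : pstab E `<=` U.
  by move=> t tE; apply: EU; exists t => //; rewrite mul1g.
have oE := open_pstab fE EN.
exists (pstab E), e; split => //; first by split => //; exact: pstab1.
move=> G FG.
have mFG : mu [set x | ~ pstab E ((L0_val F x)^-1 * L0_val G x)%g] \is a fin_num.
  by apply: fin_num_measure; exact: L0_bad_measurable.
exists (pstab E), (e - fine (mu [set x | ~ pstab E ((L0_val F x)^-1 * L0_val G x)%g])).
split; first by split => //; exact: pstab1.
  by rewrite subr_gt0 -lte_fin fineK.
move=> H GH; apply: UA; rewrite /L0_ball /=.
apply: (@le_lt_trans _ _
  (mu ([set x | ~ pstab E ((L0_val F x)^-1 * L0_val G x)%g] `|`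
       [set x | ~ pstab E ((L0_val G x)^-1 * L0_val H x)%g]))).
  apply: le_measure; rewrite ?inE.
  - exact: L0_bad_measurable.
  - by apply: measurableU; exact: L0_bad_measurable.
  - move=> x /= nU; apply/not_andP => -[Ex Ex']; apply: nU; apply: EU.
    rewrite (_ : _ * _ = ((L0_val F x)^-1 * L0_val G x) *
      ((L0_val G x)^-1 * L0_val H x))%g; first exact: pstabM.
    by rewrite -mulgA mulVKg.
apply: (le_lt_trans (measureU2 _ _ _)); [exact: L0_bad_measurable..|].
move: GH; rewrite /L0_ball /= EFinB fineK// => GH.
by rewrite addeC -lteBrDr.
Qed.

HB.instance Definition _ := Nbhs_isNbhsTopological.Build L0
  L0_nbhs_filter L0_nbhs_singleton L0_nbhs_nbhs.

End L0.

(** * The group Aut(X, [mu]) *)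

Section nonsingular.
Context d (X : measurableType d) (R : realType) (mu : probability X R).

(* Bimeasurable bijections f such that f_* mu and mu have the same null sets;
   on a standard Borel space the measurability of the inverse is automatic. *)
Record nsbij : Type := NsBij {
  nsfun :> X -> X;
  nsinv : X -> X;
  nsfunK : cancel nsfun nsinv;
  nsinvK : cancel nsinv nsfun;
  measurable_nsfun : measurable_fun setT nsfun;
  measurable_nsinv : measurable_fun setT nsinv;
  nsfun_null : forall A, measurable A ->
    pushforward mu nsfun A = 0%E <-> mu A = 0%E }.

HB.instance Definition _ := gen_eqMixin nsbij.
HB.instance Definition _ := gen_choiceMixin nsbij.

Lemma nsbij_one_subproof A : measurable A ->
  pushforward mu (@id X) A = 0%E <-> mu A = 0%E.
Proof. by []. Qed.

Definition nsbij_one : nsbij :=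
  @NsBij id id (fun _ => erefl) (fun _ => erefl)
    (@measurable_id _ _ _) (@measurable_id _ _ _) nsbij_one_subproof.

Lemma nsbij_inv_subproof (f : nsbij) A : measurable A ->
  pushforward mu (nsinv f) A = 0%E <-> mu A = 0%E.
Proof.
move=> mA; have mfA : measurable (nsinv f @^-1` A).
  by rewrite -[X in measurable X]setTI; exact: measurable_nsinv.
rewrite /pushforward -(nsfun_null f mfA) /pushforward -comp_preimage.
by rewrite (_ : nsinv f \o f = id)//; apply/funext => x; exact: nsfunK.
Qed.

Definition nsbij_inv (f : nsbij) : nsbij :=
  NsBij (@nsinvK f) (@nsfunK f) (@measurable_nsinv f) (@measurable_nsfun f)
    (nsbij_inv_subproof f).

Lemma nsbij_mul_subproof (f g : nsbij) A : measurable A ->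
  pushforward mu (f \o g) A = 0%E <-> mu A = 0%E.
Proof.
move=> mA; have mfA : measurable (f @^-1` A).
  by rewrite -[X in measurable X]setTI; exact: measurable_nsfun.
rewrite /pushforward comp_preimage.
by rewrite -(nsfun_null f mA) -(nsfun_null g mfA).
Qed.

Definition nsbij_mul (f g : nsbij) : nsbij :=
  NsBij (can_comp (@nsfunK f) (@nsfunK g)) (can_comp (@nsinvK g) (@nsinvK f))
    (measurableT_comp (@measurable_nsfun f) (@measurable_nsfun g))
    (measurableT_comp (@measurable_nsinv g) (@measurable_nsinv f))
    (nsbij_mul_subproof f g).

Definition ns_eq (f g : nsbij) : bool := `[< {ae mu, forall x, f x = g x} >].

Lemma ae_nsfun (f : nsbij) (P : X -> Prop) :
  {ae mu, forall x, P x} -> {ae mu, forall x, P (f x)}.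
Proof.
move=> [A [mA A0 PA]]; exists (f @^-1` A); split.
- by rewrite -[X in measurable X]setTI; exact: measurable_nsfun.
- by apply/(nsfun_null f mA).
- by move=> x /PA.
Qed.

Lemma ns_eq_refl : reflexive ns_eq.
Proof. by move=> f; apply/asboolP; apply: aeW. Qed.

Lemma ns_eq_sym : symmetric ns_eq.
Proof.
by move=> f g; apply/asboolP/asboolP; apply: filterS => x ->.
Qed.

Lemma ns_eq_trans : transitive ns_eq.
Proof.
move=> g f h /asboolP fg /asboolP gh; apply/asboolP.
by apply: filterS2 fg gh => x -> ->.
Qed.

Canonical ns_eq_equiv := EquivRel ns_eq ns_eq_refl ns_eq_sym ns_eq_trans.

Definition nsAut : Type := {eq_quot ns_eq}.
HB.instance Definition _ := Choice.on nsAut.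
HB.instance Definition _ := EqQuotient.on nsAut.

(* A class acts through a representative; everything stated below about this
   function is invariant under modification on a null set. *)
Definition nsrep (S : nsAut) : nsbij := repr S.
Coercion nsrep : nsAut >-> nsbij.

Lemma nsAut_eqP (S T : nsAut) : {ae mu, forall x, S x = T x} <-> S = T.
Proof.
split=> [ST|->]; last exact: aeW.
rewrite -[S]reprK -[T]reprK; apply/eqP; rewrite eqmodE.
exact/asboolP.
Qed.

Lemma nsrep_pi (f : nsbij) : {ae mu, forall x, (\pi_nsAut f : nsAut) x = f x}.
Proof.
have /eqP : \pi_nsAut (repr (\pi_nsAut f)) = \pi_nsAut f by rewrite reprK.
by rewrite eqmodE => /asboolP.
Qed.

Definition nsAut_one : nsAut := \pi_nsAut nsbij_one.
Definition nsAut_inv (S : nsAut) : nsAut := \pi_nsAut (nsbij_inv S).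
Definition nsAut_mul (S T : nsAut) : nsAut := \pi_nsAut (nsbij_mul S T).

Lemma nsAut_oneE : {ae mu, forall x, nsAut_one x = x}.
Proof. exact: nsrep_pi. Qed.
Lemma nsAut_invE (S : nsAut) : {ae mu, forall x, nsAut_inv S x = nsinv S x}.
Proof. exact: nsrep_pi. Qed.
Lemma nsAut_mulE (S T : nsAut) : {ae mu, forall x, nsAut_mul S T x = S (T x)}.
Proof. exact: nsrep_pi. Qed.

Lemma nsAut_mulA : associative nsAut_mul.
Proof.
move=> S T U; apply/nsAut_eqP.
apply: filterS2 (filterI (nsAut_mulE S (nsAut_mul T U)) (nsAut_mulE T U))
  (filterI (ae_nsfun U (nsAut_mulE S T)) (nsAut_mulE (nsAut_mul S T) U)).
by move=> x [-> ->] [e ->]; rewrite e.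
Qed.

Lemma nsAut_mul1g : left_id nsAut_one nsAut_mul.
Proof.
move=> S; apply/nsAut_eqP.
apply: filterS2 (nsAut_mulE nsAut_one S) (ae_nsfun S nsAut_oneE) => x -> ->.
by [].
Qed.

Lemma nsAut_mulg1 : right_id nsAut_one nsAut_mul.
Proof.
move=> S; apply/nsAut_eqP.
by apply: filterS2 (nsAut_mulE S nsAut_one) nsAut_oneE => x -> ->.
Qed.

Lemma nsAut_mulVg : left_inverse nsAut_one nsAut_inv nsAut_mul.
Proof.
move=> S; apply/nsAut_eqP.
apply: filterS3 (nsAut_mulE (nsAut_inv S) S) (ae_nsfun S (nsAut_invE S))
  nsAut_oneE => x -> -> ->.
exact: nsfunK.
Qed.

Lemma nsAut_mulgV : right_inverse nsAut_one nsAut_inv nsAut_mul.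
Proof.
move=> S; apply/nsAut_eqP.
apply: filterS3 (nsAut_mulE S (nsAut_inv S)) (nsAut_invE S)
  nsAut_oneE => x -> -> ->.
exact: nsinvK.
Qed.

HB.instance Definition _ := isGroup.Build nsAut nsAut_mulA nsAut_mul1g
  nsAut_mulg1 nsAut_mulVg nsAut_mulgV.

Definition iterz (f : nsbij) (n : int) (x : X) : X :=
  match n with
  | Posz k => iter k f x
  | Negz k => iter k.+1 (nsinv f) x
  end.

(* Invariance of A is understood up to null sets. *)
Definition ergodic (T : nsAut) := forall A, measurable A ->
  {ae mu, forall x, A (T x) <-> A x} -> mu A = 0%E \/ mu (~` A) = 0%E.

Definition flip_conjugate (T1 T2 : nsAut) := exists S : nsAut,
  (S * T1 * S^-1 = T2 \/ S * T1 * S^-1 = T2^-1)%g.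

(** * The commensurating full group *)

Definition full_group (T : nsAut) : set nsAut :=
  [set S | {ae mu, forall x, exists n, S x = iterz T n x}].

Definition is_cocycle (T S : nsAut) (c : X -> int) :=
  (forall n, measurable (c @^-1` [set n])) /\
  {ae mu, forall x, S x = iterz T (c x) x}.

Definition orbit_map (T : nsAut) (c : X -> int) (x : X) : int -> int :=
  fun n => n + c (iterz T n x).

Definition in_symZN (f : int -> int) := exists s : symZN, f = s.

(* When T is aperiodic the cocycle of S in [T] is unique up to null sets, so
   "some cocycle" below is "the cocycle"; this form makes sense for every T. *)
Definition com_full_group (T : nsAut) : set nsAut :=
  [set S | full_group T S /\ exists2 c, is_cocycle T S c &
    {ae mu, forall x, in_symZN (orbit_map T c x)}].

Lemma iterzS (f : nsbij) n x : iterz f (n + 1) x = f (iterz f n x).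
Proof.
case: n => [k|[|k]].
- by rewrite (_ : Posz k + 1 = Posz k.+1)//; lia.
- by rewrite /= nsinvK.
- rewrite (_ : Negz k.+1 + 1 = Negz k) /= ?nsinvK//.
  lia.
Qed.

Lemma iterzP (f : nsbij) n x : iterz f (n - 1) x = nsinv f (iterz f n x).
Proof. by apply: (can_inj (nsfunK f)); rewrite nsinvK -iterzS subrK. Qed.

Let posS (m : nat) : Posz m.+1 = Posz m + 1. Proof. lia. Qed.
Let negS (m : nat) : - Posz m.+1 = - Posz m - 1. Proof. lia. Qed.

Lemma iterzD (f : nsbij) m n x : iterz f (m + n) x = iterz f m (iterz f n x).
Proof.
elim/int_rect: m => [|m IH|m IH]; first by rewrite add0r.
- by rewrite posS addrAC !iterzS IH.
- by rewrite negS addrAC !iterzP IH.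
Qed.

Lemma ae_iterz (f : nsbij) (P : X -> Prop) n :
  {ae mu, forall x, P x} -> {ae mu, forall x, P (iterz f n x)}.
Proof.
move=> PP; elim/int_rect: n => [//|m IH|m IH].
- have := ae_nsfun f IH; apply: filterS => x.
  by rewrite posS iterzD.
- have := ae_nsfun (nsbij_inv f) IH; apply: filterS => x.
  by rewrite negS iterzD.
Qed.

Lemma ae_forallz (P : int -> X -> Prop) :
  (forall n, {ae mu, forall x, P n x}) -> {ae mu, forall x, forall n, P n x}.
Proof.
move=> PP; have : {ae mu, forall x, forall k : nat, P k%:Z x /\ P (Negz k) x}.
  by apply/ae_foralln => k; apply: filterS2 (PP k%:Z) (PP (Negz k)).
by apply: filterS => x Px [k|k]; have [] := Px k.
Qed.

Lemma measurable_iterz (f : nsbij) n : measurable_fun setT (iterz f n).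
Proof.
elim/int_rect: n => [|m IH|m IH]; first exact: measurable_id.
- rewrite (_ : iterz f _ = f \o iterz f m).
    by apply: measurableT_comp IH; exact: measurable_nsfun.
  by apply/funext => x; rewrite posS iterzS.
- rewrite (_ : iterz f _ = nsinv f \o iterz f (- m%:Z)).
    by apply: measurableT_comp IH; exact: measurable_nsinv.
  by apply/funext => x; rewrite negS iterzP.
Qed.

Lemma measurable_fibre (c : X -> int) (f : X -> X) :
  (forall n, measurable (c @^-1` [set n])) -> measurable_fun setT f ->
  forall n, measurable ((c \o f) @^-1` [set n]).
Proof.
by move=> mc mf n; rewrite comp_preimage -[X in measurable X]setTI; exact: mf.
Qed.

Lemma com_full_group1 T : com_full_group T 1%g.
Proof.
have c0 : is_cocycle T 1%g (fun=> 0).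
  split; last by apply: filterS nsAut_oneE.
  by move=> n; rewrite preimage_cst; case: ifP.
split; first by apply: filterS c0.2 => x ->; exists 0.
exists (fun=> 0) => //; apply: aeW => x; exists 1%g.
by apply/funext => n; rewrite /orbit_map addr0.
Qed.

Lemma com_full_groupM T S1 S2 :
  com_full_group T S1 -> com_full_group T S2 -> com_full_group T (S1 * S2)%g.
Proof.
move=> [_ [c1 [mc1 c1S] c1N]] [_ [c2 [mc2 c2S] c2N]].
pose c x := c2 x + c1 (S2 x).
have cS : {ae mu, forall x, nsrep (S1 * S2)%g x = iterz T (c x) x}.
  apply: filterS3 (nsAut_mulE S1 S2) (ae_nsfun S2 c1S) c2S => x -> -> e.
  by rewrite {2}e -iterzD addrC.
split; first by apply: filterS cS => x ->; exists (c x).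
exists c.
  split=> // n; rewrite (_ : _ @^-1` _ = \bigcup_m
      (c2 @^-1` [set m] `&` (c1 \o S2) @^-1` [set n - m])).
    apply: countable_bigcupT_measurable; first exact: countableP.
    move=> m; apply: measurableI => //; apply: measurable_fibre => //.
    exact: measurable_nsfun.
  apply/seteqP; split => x /=.
    by move=> <-; exists (c2 x) => //; split => //=; rewrite /c addrAC subrr add0r.
  by rewrite /c => -[m _ [/= <- ->]]; rewrite addrC subrK.
have c2T : {ae mu, forall x, forall n, S2 (iterz T n x) =
    iterz T (c2 (iterz T n x)) (iterz T n x)}.
  by apply: ae_forallz => n; exact: ae_iterz c2S.
apply: filterS3 c2T c1N c2N => x e [s1 s1E] [s2 s2E].
exists (s1 * s2)%g; apply/funext => n; rewrite [RHS]/= -s1E -s2E.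
by rewrite /orbit_map /c addrA e -iterzD [_ + n]addrC.
Qed.

Lemma com_full_groupV T S : com_full_group T S -> com_full_group T S^-1%g.
Proof.
move=> [_ [c [mc cS] cN]].
pose c' x := - c (nsinv S x).
have cS' : {ae mu, forall x, nsrep (S^-1)%g x = iterz T (c' x) x}.
  apply: filterS2 (nsAut_invE S) (ae_nsfun (nsbij_inv S) cS) => x -> /= e.
  rewrite /c' -[in RHS](nsinvK S x) {2}e nsfunK.
  by rewrite -iterzD addNr.
split; first by apply: filterS cS' => x ->; exists (c' x).
exists c'.
  split=> // n.
  rewrite (_ : _ @^-1` _ = (c \o nsinv S) @^-1` [set - n]).
    by apply: measurable_fibre => //; exact: measurable_nsinv.
  by apply/seteqP; split => x; rewrite /c' /=; [move=> <-|move=> ->]; rewrite opprK.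
have cT : {ae mu, forall x, forall n, S (iterz T n x) =
    iterz T (c (iterz T n x)) (iterz T n x)}.
  by apply: ae_forallz => n; exact: ae_iterz cS.
apply: filterS2 cT cN => x e [s sE]; exists (s^-1)%g; apply/funext => n.
have -> : orbit_map T c' x n = n + c' (iterz T n x) by [].
have [m <-] : exists m, s m = n by exists (symi s n); exact: symiK.
rewrite [RHS](symfK s m) -sE /orbit_map.
have -> : iterz T (m + c (iterz T m x)) x = S (iterz T m x).
  by rewrite addrC iterzD -e.
by rewrite /c' nsfunK addrK.
Qed.

Section comfg.
Variable T : nsAut.

Definition comfg : Type := {S : nsAut | S \in com_full_group T}.

HB.instance Definition _ := SubChoice.on comfg.

Lemma com_full_group_closed : group_closed (mem (com_full_group T)).
Proof.
split; first by apply: mem_set; exact: com_full_group1.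
move=> S U /set_mem TS /set_mem TU; apply: mem_set.
by apply: com_full_groupM => //; exact: com_full_groupV.
Qed.

HB.instance Definition _ := SubChoice_isSubGroup.Build _ _ comfg
  com_full_group_closed.

Definition is_Phi (S : nsAut) (F : L0 mu) := exists2 c, is_cocycle T S c &
  {ae mu, forall x, L0_val F x = orbit_map T c x :> (int -> int)}.

Lemma L0_val_pi (F : X -> symZN)
    (mF : measurable_fun setT (F : X -> symZN_borel)) :
  exists G : L0 mu, {ae mu, forall x, L0_val G x = F x}.
Proof.
pose f : {mfun X >-> symZN_borel} := mfun_Sub (mem_set mF).
exists (\pi_({mfun_ mu, X >-> symZN_borel}) f).
have /eqP : \pi_({mfun_ mu, X >-> symZN_borel})
    (repr (\pi_({mfun_ mu, X >-> symZN_borel}) f))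
  = \pi_({mfun_ mu, X >-> symZN_borel}) f by rewrite reprK.
by rewrite eqmodE => /asboolP; apply: filterS => x /(_ I).
Qed.

Lemma Phi_exists (S : nsAut) : com_full_group T S -> exists F, is_Phi S F.
Proof.
move=> [_ [c [mc cS] [A [mA A0 cA]]]].
pose F x : symZN := if x \in A then 1%g
  else xget 1%g [set s : symZN | orbit_map T c x = s].
have FE x : ~ A x -> F x = orbit_map T c x :> (int -> int).
  move=> nAx; rewrite /F memNset//; case: xgetP => [s -> <- //|nex].
  have [[s /nex []]|nN] := pselect (in_symZN (orbit_map T c x)).
  by exfalso; apply: nAx; exact: cA.
have mB n (B : set int) : measurable ((c \o iterz T n) @^-1` B).
  rewrite (_ : _ @^-1` _ = \bigcup_(m in B) ((c \o iterz T n) @^-1` [set m])).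
    rewrite bigcup_mkcond; apply: countable_bigcupT_measurable.
      exact: countableP.
    move=> m; case: ifP => // _; apply: measurable_fibre => //.
    exact: measurable_iterz.
  apply/seteqP; split => x /=; first by exists (c (iterz T n x)).
  by move=> [m Bm /= ->].
have mF : measurable_fun setT (F : X -> symZN_borel).
  apply: measurable_symZN => a b.
  set M := natM a; set M' := natM b.
  rewrite (_ : [set x | _] = (A `&` [set _ | M = M']) `|`
    (~` A `&` \bigcap_n' [set x | M n' <-> M' (n' + c (iterz T n' x))])).
    apply: measurableU; apply: measurableI => //; [|exact: measurableC|].
      have [MM|MM] := pselect (M = M').
        by rewrite (_ : [set _ | _] = setT)//; apply/seteqP; split.
      by rewrite (_ : [set _ | _] = set0)//; apply/seteqP; split.
    rewrite -[X in measurable X]setCK setC_bigcap; apply: measurableC.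
    apply: countable_bigcupT_measurable; first exact: countableP.
    move=> n; apply: measurableC.
    exact: (mB n [set m | M n <-> M' (n + m)]).
  have FM x : ~ A x ->
      (F x @` M = M') <-> (forall n, M n <-> M' (n + c (iterz T n x))).
    move=> /FE FxE; rewrite -[X in _ <-> (forall n, _ <-> M' (X n))]/(orbit_map T c x).
    rewrite -FxE; split => [<- n|MM].
      split=> [Mn|[m Mm /(can_inj (symfK (F x))) <-//]].
      by exists n.
    apply/seteqP; split => n; first by move=> [m /MM + <-].
    by move=> M'n; exists (symi (F x) n); rewrite ?MM symiK.
  apply/seteqP; split => x /=.
    have [Ax|nAx] := pselect (A x).
      by rewrite /F mem_set// image_id => MM; left.
    by move=> /(FM _ nAx) MM; right; split => // n _; exact: MM.
  move=> [[Ax MM]|[nAx MM]]; first by rewrite /F mem_set// image_id.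
  by apply/(FM _ nAx) => n; exact: MM.
have [G GF] := L0_val_pi mF; exists G, c => //.
have nA : {ae mu, forall x, ~ A x}.
  by exists A; split => // x /= /contrapT.
by apply: filterS2 GF nA => x ->; exact: FE.
Qed.

Definition aperiodic :=
  {ae mu, forall x, forall n : int, n != 0 -> iterz T n x <> x}.

Lemma is_Phi_unique (S : nsAut) (F G : L0 mu) :
  aperiodic -> is_Phi S F -> is_Phi S G -> F = G.
Proof.
move=> aT [c [_ cS] Fc] [c' [_ cS'] Gc'].
have cc' : {ae mu, forall x, c x = c' x}.
  apply: filterS3 aT cS cS' => x ax -> e.
  apply/eqP; rewrite -subr_eq0; apply/negPn/negP => /ax; apply.
  by rewrite addrC iterzD e -iterzD addNr.
have cc'T : {ae mu, forall x, forall n, c (iterz T n x) = c' (iterz T n x)}.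
  by apply: ae_forallz => n; exact: ae_iterz cc'.
rewrite -[F]reprK -[G]reprK; apply/eqP; rewrite eqmodE; apply/asboolP.
apply: filterS3 Fc Gc' cc'T => x xF xG xc _; apply: symZN_eqP => n.
by rewrite -[LHS]/(L0_val F x n) -[RHS]/(L0_val G x n) xF xG /orbit_map xc.
Qed.

(* By [is_Phi_unique] the choice made here is irrelevant for aperiodic T. *)
Definition Phi (S : comfg) : L0 mu := projT1 (cid (Phi_exists (set_mem (valP S)))).

HB.instance Definition _ := Topological.copy comfg (initial_topology Phi).

End comfg.
End nonsingular.

(** * Standard atomless probability spaces *)

Definition standard_borel (R : realType) d (X : measurableType d) :=
  exists (P : completePseudoMetricType R) (f : X -> P),
    [/\ hausdorff_space P, @second_countable P, bijective f &
        forall A : set X, measurable A <-> <<s @open P >> (f @` A)].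

Definition atomless d (X : measurableType d) (R : realType)
    (mu : probability X R) :=
  forall A, measurable A -> (0 < mu A)%E ->
    exists B, [/\ measurable B, B `<=` A & (0 < mu B < mu A)%E].

Definition group_isomorphic (G H : groupType) :=
  exists f : {multiplicative G -> H}, bijective f.

Definition comfg_top_isomorphic d (X : measurableType d) (R : realType)
    (mu : probability X R) (T1 T2 : nsAut mu) :=
  exists (f : {multiplicative comfg T1 -> comfg T2}) (g : comfg T2 -> comfg T1),
    [/\ cancel f g, cancel g f, continuous f & continuous g].

(* Main.v *)
Require Import Defs.
From HB Require Import structures.
From mathcomp Require Import all_boot all_order all_algebra.
From mathcomp Require Import all_classical all_reals all_analysis.
From mathcomp Require Import zify.

Set Implicit Arguments.
Unset Strict Implicit.
Unset Printing Implicit Defensive.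
Import Order.TTheory GRing.Theory Num.Theory.

Local Open Scope classical_set_scope.
Local Open Scope ring_scope.
Local Open Scope quotient_scope.

(** That flip-conjugate transformations have isomorphic topological groups is
    formal. If S carries the T1-orbits to the T2-orbits and preserves or
    reverses their order, conjugation by S maps one commensurating full group
    onto the other, and Phi changes by composition with S^-1 and by conjugation
    with n |-> - n. A nonsingular map preserves convergence in measure, so the
    isomorphism is a homeomorphism ([comfg_conj_continuous]).

    The substance is that an abstract isomorphism q gives a flip-conjugacy.
    There are three ingredients.

    Reconstruction, in the spirit of Dye. Ergodicity and atomlessness provide
    an involution in the group supported in any given nonnull set
    ([many_involutions]). For an involution p, the elements supported in the
    support of p are described by the group law alone: they form an iterated
    centraliser of p ([localiser_supp]). Hence q respects inclusion and
    disjointness of supports of involutions. Sending A to the essential union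
    of the supports of q p, for the involutions p supported in A, defines an
    automorphism of the measure algebra that intertwines g and q g
    ([transport_exists], [spatial_iso]).

    Point realisation. An automorphism of the measure algebra of a standard
    Borel space comes from a nonsingular bijection ([iso_realization]). A
    standard Borel space is presented by a countable list of rules on a
    generating sequence of sets ([coding]); the image sets obey these rules
    almost everywhere and thus code a point. This gives an isomorphism between
    conull subsets. It is completed to a bijection of the whole space by a
    Hilbert hotel argument, for which a null copy of the space is built inside
    any conull set by a Cantor scheme ([null_embedding], [hotel_shift]).

    Katznelson's argument. The preimage U of T2 under q is conjugate to T2,
    belongs to the group of T1 and has the same orbits as T1. On each orbit,
    counted in steps of U, the map U is a shift that commensurates the forward
    half of the T1-orbit; a subset of the integers that is infinite,
    co-infinite and almost invariant under the shift is a half-line up to a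
    finite set ([eventually_ray]). So the forward T1-orbit is commensurate to
    the forward orbit of U or of its inverse, always for the same one by
    ergodicity. In the first case let i x be the index of the forward T1-orbit
    of x relative to its forward U-orbit. From x to T1 x the index changes by
    the number of U-steps from x to T1 x minus one ([shift_index_step]), which
    says that S x = U^(- i x) x satisfies S T1 = U S ([forward_conjugate],
    [katznelson]). *)

(** * Standard Borel spaces as countable theories *)

Lemma countable_setU T (A B : set T) :
  countable A -> countable B -> countable (A `|` B).
Proof.
move=> cA cB; rewrite -bigcup2E; apply: bigcup_countable => //.
by move=> [|[|k]] _ //=; exact: countable0.
Qed.

Section coding.
Context {X : Type}.
Implicit Types (C J : set (set X)) (r : seq (set X) * set (set X)).

(** A rule (F, J) reads: a point that lies in all the sets of the list F lies
    in some set of J. The assignment C lists the sets that are declared to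
    contain a point. *)
Definition obeys C r :=
  (forall B, B \in r.1 -> C B) -> exists2 B, r.2 B & C B.

(** A coding presents X as the space of models of a countable propositional
    theory whose atoms are the sets in BB: an assignment that obeys the rules
    in RR is the membership table of a unique point. For a Polish space this
    encodes completeness. Standardness is used through codings only, because
    their countably many rules can be checked up to null sets and because any
    measurable set can be added as a new atom. *)
Record coding (BB : set (set X)) (RR : set (seq (set X) * set (set X))) : Prop
    := Coding {
  coding_countable : countable BB;
  coding_rules : countable RR;
  coding_head : forall r, RR r -> forall B, B \in r.1 -> BB B;
  coding_body : forall r, RR r -> r.2 `<=` BB;
  coding_valid : forall r x, RR r -> obeys [set B | B x] r;
  coding_sep : forall x y, (forall B, BB B -> B x <-> B y) -> x = y;
  coding_point : forall C, (forall r, RR r -> obeys C r) ->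
    exists x, forall B, BB B -> (C B <-> B x) }.

End coding.

Lemma coding_preimage (X Y : Type) (f : X -> Y) BB RR :
  bijective f -> coding BB RR ->
  coding [set f @^-1` B | B in BB]
    [set ([seq f @^-1` B | B <- r.1], [set f @^-1` B | B in r.2]) | r in RR].
Proof.
move=> [g fK gK] [cB cR hd bd val sep pt]; split.
- exact: sub_countable (card_image_le _ _) cB.
- exact: sub_countable (card_image_le _ _) cR.
- by move=> _ [r Rr <-] B /= /mapP[D Dr ->]; exists D => //; exact: hd Dr.
- by move=> _ [r Rr <-] _ /= [D Dr <-]; exists D => //; exact: bd Dr.
- move=> _ x [r Rr <-] xr /=; have [|B rB Bx] := val r (f x) Rr.
    by move=> B Br; apply: (xr (f @^-1` B)); exact: map_f.
  by exists (f @^-1` B) => //; exists B.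
- move=> x y xy; apply: (can_inj fK); apply: sep => B BB_B.
  by apply: (xy (f @^-1` B)); exists B.
- move=> C Cr; have [|y yC] := pt [set B | C (f @^-1` B)].
    move=> r Rr rC; have [||_ [B rB <-] CB] :=
        Cr ([seq f @^-1` B | B <- r.1], [set f @^-1` B | B in r.2]).
    + by exists r.
    + by move=> _ /= /mapP[B Br ->]; exact: rC.
    + by exists B.
  exists (g y) => _ [B BB_B <-]; rewrite [f @^-1` B](_ : _ = B \o f)//= gK.
  exact: yC.
Qed.

(** Four kinds of rules suffice on a complete metric space: the point lies in
    a basic set contained in a ball of given radius; if it lies in two basic
    sets, it lies in a third one whose closure is contained in both; a basic
    set implies the larger ones; the empty set never holds. The basic sets of
    an assignment that obeys these rules generate a Cauchy filter, whose
    limit is the coded point. *)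
Lemma coding_complete (R : realType) (P : completePseudoMetricType R)
    (BB : set (set P)) : hausdorff_space P -> countable BB -> basis BB ->
  exists RR, coding BB RR.
Proof.
move=> hP cB [oB bB].
have base (x : P) (U : set P) : nbhs x U -> exists B, [/\ BB B, B x & B `<=` U].
  by move=> /bB [B [BB_B Bx] BU]; exists B.
have BBo B x : BB B -> B x -> nbhs x B.
  by move=> /oB Bo Bx; apply: open_nbhs_nbhs.
have shrink (x : P) (U : set P) : nbhs x U ->
    exists B, [/\ BB B, B x & closure B `<=` U].
  move=> /nbhs_ballP[e /= e0 eU].
  have e20 : 0 < e / 2 by rewrite divr_gt0.
  have [B [BB_B Bx Be]] := base x _ (nbhsx_ballx x (e / 2) e20).
  exists B; split=> // y cBy; apply: eU.
  have [z [Bz yz]] := cBy _ (nbhsx_ballx y (e / 2) e20).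
  rewrite [e]splitr; apply: ball_triangle (Be _ Bz) _; exact: ball_sym.
pose small k : set (set P) :=
  [set B | BB B /\ exists x, B `<=` ball x k.+1%:R^-1].
pose Ra : set (seq (set P) * set (set P)) := [set ([::], small k) | k in setT].
pose Rb : set (seq (set P) * set (set P)) :=
  [set ([:: BC.1; BC.2], [set D | BB D /\ closure D `<=` BC.1 `&` BC.2])
    | BC in BB `*` BB].
pose Rc : set (seq (set P) * set (set P)) :=
  [set ([:: BC.1], [set BC.2]) | BC in [set BC | BB BC.1 /\ BB BC.2 /\ BC.1
      `<=` BC.2]].
pose Rd : set (seq (set P) * set (set P)) :=
  [set ([:: B], set0) | B in [set B | BB B /\ B = set0]].
have cBB : countable (BB `*` BB) by exact: countableX.
exists (Ra `|` Rb `|` Rc `|` Rd); split => //.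
- apply: countable_setU; first apply: countable_setU;
      first apply: countable_setU.
  + exact: sub_countable (card_image_le _ _) (countableP _).
  + exact: sub_countable (card_image_le _ _) cBB.
  + apply: sub_countable (card_image_le _ _) _.
    by apply: sub_countable cBB; apply: subset_card_le => -[B C] /= [? []].
  + apply: sub_countable (card_image_le _ _) _.
    by apply: sub_countable cB; apply: subset_card_le => B [].
- move=> r [[[|]|]|].
  + by move=> [k _ <-].
  + by move=> [[B C] [/= ? ?] <-] D; rewrite /= !inE => /orP[]/eqP ->.
  + by move=> [[B C] [/= ? [? ?]] <-] D; rewrite /= !inE => ->.
  + by move=> [B [? ?] <-] D; rewrite /= !inE => ->.
- move=> r [[[|]|]|].
  + by move=> [k _ <-] D [].
  + by move=> [[B C] [/= ? ?] <-] D [].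
  + by move=> [[B C] [/= ? [? ?]] <-] D ->.
  + by move=> [B [? ?] <-] D.
- move=> r x [[[|]|]|].
  + move=> [k _ <-] _.
    have [|B [BB_B Bx Bk]] := base x (ball x k.+1%:R^-1).
      by apply: nbhsx_ballx; rewrite invr_gt0.
    by exists B => //; split => //; exists x.
  + move=> [[B C] [/= BB_B BB_C] <-] /= xBC.
    have Bx : B x by apply: xBC; rewrite inE eqxx.
    have Cx : C x by apply: xBC; rewrite !inE eqxx orbT.
    have [|D [BB_D Dx DBC]] := shrink x (B `&` C); last by exists D.
    by apply: filterI; exact: BBo.
  + move=> [[B C] [/= ? [? BC]] <-] /= xB.
    by exists C => //; apply: BC; apply: xB; rewrite inE.
  + by move=> [B [? B0] <-] /= /(_ B); rewrite inE eqxx B0 => /(_ erefl).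
- move=> x y xy; apply: hP => A B xA yB.
  have [D [BB_D Dx DA]] := base _ _ xA.
  exists y; split; last exact: nbhs_singleton.
  by apply: DA; apply/(xy _ BB_D).
- move=> C Cr.
  have Ca k : exists2 B, small k B & C B.
    by apply: (Cr ([::], small k)) => //; do 3 left; exists k.
  have Cb B B' : BB B -> BB B' -> C B -> C B' ->
      exists2 D, BB D /\ closure D `<=` B `&` B' & C D.
    move=> BB_B BB_B' CB CB'.
    apply: (Cr ([:: B; B'], [set D | BB D /\ closure D `<=` B `&` B'])).
      by left; left; right; exists (B, B').
    by move=> D; rewrite !inE => /orP[]/eqP ->.
  have Cc B B' : BB B -> BB B' -> B `<=` B' -> C B -> C B'.
    move=> BB_B BB_B' BB' CB; have [||D /= ->//] := Cr ([:: B], [set B']).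
      by left; right; exists (B, B').
    by move=> D; rewrite !inE => ->.
  have Cd B : BB B -> C B -> B !=set0.
    move=> BB_B CB; apply/set0P/negP => /eqP B0.
    have [||D]// := Cr ([:: B], set0); first by right; exists B.
    by move=> D; rewrite !inE => ->.
  pose F : set_system P := filter_from [set B | BB B /\ C B] id.
  have FF : ProperFilter F.
    apply: filter_from_proper; last by move=> B [/Cd]; apply.
    apply: filter_from_filter.
      by have [B [BB_B _] CB] := Ca 0%N; exists B.
    move=> B B' [BB_B CB] [BB_B' CB']; have [D [BB_D DBB] CD] :=
        Cb _ _ BB_B BB_B' CB CB'.
    by exists D => // x Dx; apply: DBB; exact: subset_closure.
  have /cauchy_exP/cauchy_cvg Fc : cauchy_ex F.
    move=> e e0; have [k ke] : exists k, k.+1%:R^-1 < e :> R.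
      exists (Num.bound e^-1); rewrite invf_plt ?posrE//.
      apply: lt_le_trans (archi_boundP _) _; first by rewrite invr_ge0 ltW.
      by rewrite ler_nat.
    have [B [BB_B [x Bx]] CB] := Ca k; exists x; exists B => //.
    by apply: subset_trans Bx _; apply: le_ball; exact: ltW.
  have {Fc}/cvg_ex[x Fx] := Fc.
  have xcl B : BB B -> C B -> closure B x.
    move=> BB_B CB U /Fx[D [BB_D CD] DU].
    have [E [BB_E EBD] CE] := Cb _ _ BB_B BB_D CB CD.
    have [z Ez] := Cd _ BB_E CE; have [Bz Dz] := EBD _ (subset_closure Ez).
    by exists z; split => //; exact: DU.
  exists x => B BB_B; split => [CB|Bx].
    have [D [BB_D DBB] CD] := Cb _ _ BB_B BB_B CB CB.
    by have [] := DBB _ (xcl _ BB_D CD).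
  have [D [BB_D CD] DB] := Fx _ (BBo _ _ BB_B Bx).
  exact: Cc CD.
Qed.

Lemma countable_enum T (A : set T) (a : T) : countable A -> A a ->
  exists e : nat -> T, (forall n, A (e n)) /\ (forall x, A x ->
      exists n, e n = x).
Proof.
move=> /countable_injP[f finj] Aa.
pose P n x := A x /\ f x = n.
exists (fun n => if pselect (exists x, P n x) is left h then projT1 (cid h)
    else a).
split=> [n|x Ax]; first by case: pselect => // h; case: cid => x [].
exists (f x); case: pselect => [h|[]]; last by exists x.
by case: cid => y [Ay fy] /=; apply: finj fy; rewrite inE.
Qed.

(** The points that the codings BB i attach to one assignment agree, because
    they all extend the separating family BB0. *)
Lemma coding_bigcup (X : Type) (BB0 : set (set X))
    (BB : nat -> set (set X)) (RR : nat -> set (seq (set X) * set (set X))) :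
  (forall x y, (forall B, BB0 B -> B x <-> B y) -> x = y) ->
  (forall i, BB0 `<=` BB i) -> (forall i, coding (BB i) (RR i)) ->
  coding (\bigcup_i BB i) (\bigcup_i RR i).
Proof.
move=> sep0 BB0i cBR; split.
- by apply: bigcup_countable => // i _; exact: coding_countable (cBR i).
- by apply: bigcup_countable => // i _; exact: coding_rules (cBR i).
- by move=> r [i _ ir] B Br; exists i => //;
      exact: coding_head (cBR i) _ ir _ Br.
- by move=> r [i _ ir] B Br; exists i => //;
      exact: coding_body (cBR i) _ ir _ Br.
- by move=> r x [i _ ir]; exact: (coding_valid (cBR i)).
- by move=> x y xy; apply: sep0 => B B0; apply: xy; exists 0%N => //;
      exact: BB0i.
- move=> C Cr; have CP i : exists x, forall B, BB i B -> C B <-> B x.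
    by apply: (coding_point (cBR i)) => r ir; apply: Cr; exists i.
  have [x xC] := CP 0%N; exists x => B [i _ iB].
  have [y yC] := CP i; rewrite (yC _ iB) (_ : y = x)//.
  apply: sep0 => D D0.
  by rewrite -(yC _ (BB0i i _ D0)) (xC _ (BB0i 0%N _ D0)).
Qed.

(** The last hypothesis says that the new rules force the truth value of M at
    the point coded by the old atoms. *)
Lemma coding_add (X : Type) (BB : set (set X)) RR M RR' :
  coding BB RR -> countable RR' ->
  (forall r, RR' r -> forall B, B \in r.1 -> (BB `|` [set M]) B) ->
  (forall r, RR' r -> r.2 `<=` BB `|` [set M]) ->
  (forall r x, RR' r -> obeys [set B | B x] r) ->
  (forall C x, (forall r, RR' r -> obeys C r) ->
    (forall B, BB B -> C B <-> B x) -> C M <-> M x) ->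
  coding (BB `|` [set M]) (RR `|` RR').
Proof.
move=> [cB cR hd bd val sep pt] cR' hd' bd' val' pt'; split.
- exact: countable_setU (countable1 _).
- exact: countable_setU.
- by move=> r [Rr|/hd'//] B Br; left; exact: hd Br.
- by move=> r [Rr|/bd'//] B Br; left; exact: bd Br.
- by move=> r x [|]; [exact: val|exact: val'].
- by move=> x y xy; apply: sep => B BB_B; apply: xy; left.
- move=> C Cr; have [x xC] := pt C (fun r Rr => Cr r (or_introl Rr)).
  exists x => B [BB_B|->]; first exact: xC.
  by apply: (pt' C x _ xC) => r Rr; apply: Cr; right.
Qed.

Section extension.
Context d (X : measurableType d) (BB0 : set (set X))
  (RR0 : set (seq (set X) * set (set X))).
Hypothesis coding0 : coding BB0 RR0.
Hypothesis measurable0 : BB0 `<=` measurable.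

(** The counterpart of refining a Polish topology so that a given Borel set
    becomes clopen. *)
Definition codable (M : set X) := exists BB RR,
  [/\ coding BB RR, BB0 `<=` BB, BB `<=` measurable & BB M].

Lemma codable_setC M : codable M -> codable (~` M).
Proof.
move=> [BB [RR [cBR BB0_B BBm BB_M]]].
exists (BB `|` [set ~` M]),
  (RR `|` [set r | r = ([:: M; ~` M], set0) \/ r = ([::], [set M; ~` M])]).
split; last by right.
- apply: coding_add => //.
  + exact: countable_setU (countable1 _) (countable1 _).
  + by move=> r [->|->] B; rewrite //= !inE => /orP[]/eqP ->; [left|right].
  + by move=> r [->|->] B; rewrite //= => -[->|->]; [left|right].
  + move=> r x [->|->] /=.
      move=> xM; have Mx : M x by apply: xM; rewrite inE eqxx.
      by have /(_ Mx) : (~` M) x := xM (~` M) (mem_last M [:: ~` M]).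
    move=> _; have [Mx|Mx] := pselect (M x); first by exists M => //; left.
    by exists (~` M) => //; right.
  + move=> C x Cr xC.
    have C1 : C M -> ~ C (~` M).
      move=> CM CM'; have [||]// := Cr ([:: M; ~` M], set0); first by left.
      by move=> B; rewrite !inE => /orP[]/eqP ->.
    have [||B] := Cr ([::], [set M; ~` M]); first by right.
      by [].
    move=> /= BM CB; split.
      by move=> CM' Mx; apply: (C1 _ CM'); apply/(xC _ BB_M).
    move=> /= nMx; case: BM CB => -> //.
    by move=> /(xC _ BB_M).
- by move=> B /BB0_B; left.
- by move=> B [/BBm//|->]; apply: measurableC; exact: BBm.
Qed.

Lemma codable_seq (M : nat -> set X) : (forall i, codable (M i)) ->
  exists BB RR, [/\ coding BB RR, BB0 `<=` BB, BB `<=` measurable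
    & forall i, BB (M i)].
Proof.
move=> /choice[BB /choice[RR BRi]].
exists (\bigcup_i BB i), (\bigcup_i RR i); split.
- apply: (coding_bigcup (BB0 := BB0)); first exact: coding_sep coding0.
    by move=> i; have [] := BRi i.
  by move=> i; have [] := BRi i.
- by move=> B B0; exists 0%N => //; have [_ + _ _] := BRi 0%N; apply.
- by move=> B [i _ iB]; have [_ _ + _] := BRi i; apply.
- by move=> i; exists i => //; have [] := BRi i.
Qed.

Lemma codable_bigcup (M : nat -> set X) :
  (forall i, codable (M i)) -> codable (\bigcup_i M i).
Proof.
move=> /codable_seq[BB [RR [cBR BB0_B BBm BB_M]]].
exists (BB `|` [set \bigcup_i M i]),
  (RR `|` ([set ([:: M i], [set \bigcup_i M i]) | i in setT] `|`
     [set ([:: \bigcup_i M i], range M)])).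
split; last by right.
- apply: coding_add => //.
  + apply: countable_setU (countable1 _).
    exact: sub_countable (card_image_le _ _) (countableP _).
  + move=> r [[i _ <-]|->] B; rewrite mem_seq1 => /eqP ->; last by right.
    by left.
  + move=> r [[i _ <-]|->] B /=; first by right.
    by move=> [i _ <-]; left.
  + move=> r x [[i _ <-]|->] /= xr.
      exists (\bigcup_i M i) => //; exists i => //; apply: xr; exact: mem_head.
    have [|i _ Mx] := xr (\bigcup_i M i); first exact: mem_head.
    by exists (M i) => //; exists i.
  + move=> C x Cr xC; split.
      move=> CU; have [||_ [i _ <-]] := Cr ([:: \bigcup_i M i], range M).
      * by right.
      * by move=> B; rewrite mem_seq1 => /eqP ->.
      * by move=> /(xC _ (BB_M i)) Mx; exists i.
    move=> [i _ /(xC _ (BB_M i)) CM].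
    have [||_ /= ->//] := Cr ([:: M i], [set \bigcup_i M i]).
      by left; exists i.
    by move=> B; rewrite mem_seq1 => /eqP ->.
- by move=> B /BB0_B; left.
- by move=> B [/BBm//|->]; apply: bigcupT_measurable => i; exact: BBm.
Qed.

Lemma codable_set0 : codable set0.
Proof.
exists (BB0 `|` [set set0]), (RR0 `|` [set ([:: set0], set0)]).
split; last by right.
- apply: coding_add => //.
  + by move=> r -> B; rewrite mem_seq1 => /eqP ->; right.
  + by move=> r ->.
  + by move=> r x -> /(_ set0) /=; rewrite inE eqxx => /(_ erefl).
  + move=> C x Cr _; split => // C0.
    by have [||B] := Cr ([:: set0], set0) => //= B; rewrite mem_seq1 => /eqP ->.
- by move=> B B0; left.
- by move=> B [/measurable0//|->].
Qed.

(** Two rules tie a complement to its set, and countably many tie a countable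
    union to its members, so the codable sets form a sigma-algebra. *)
Lemma codable_sigma_algebra (M : set X) : <<s BB0 >> M -> codable M.
Proof.
have sub : BB0 `<=` codable by move=> B B0; exists BB0, RR0; split.
apply: smallest_sub; [split|exact: sub].
- exact: codable_set0.
- by move=> A; rewrite setTD; exact: codable_setC.
- exact: codable_bigcup.
Qed.

End extension.

(** The atoms are the basic open sets; they generate the measurable sets
    because every open set is a countable union of them. *)
Lemma standard_borel_coding (R : realType) d (X : measurableType d) :
  standard_borel R X -> exists BB RR,
    [/\ coding BB RR, BB `<=` measurable & forall A : set X, measurable A ->
        <<s BB >> A].
Proof.
move=> [P [f [hP [U cU bU] bf mf]]].
have [RR cUR] := coding_complete hP cU bU.
exists [set f @^-1` B | B in U],
  [set ([seq f @^-1` B | B <- r.1], [set f @^-1` B | B in r.2]) | r in RR].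
have fK B : f @` (f @^-1` B) = B.
  by have [g _ gK] := bf; apply: image_preimage; apply/seteqP; split => // y _;
    exists (g y).
split; first exact: coding_preimage.
  move=> _ [B UB <-]; apply/mf; rewrite fK; apply: sub_sigma_algebra.
  exact: bU.1.
move=> A /mf fA.
have -> : A = f @^-1` (f @` A).
  have [g fgK _] := bf; apply/seteqP; split => x /=; first by exists x.
  by move=> [y Ay /(can_inj fgK) <-].
move: fA; move: (f @` A) => {A}.
apply: smallest_sub; first split.
- by rewrite /= preimage_set0; exact: sigma_algebra0.
- by move=> A /= sA; rewrite setTD preimage_setC; exact: sigma_algebraC.
- by move=> A /= sA; rewrite preimage_bigcup; exact: sigma_algebra_bigcup.
- move=> O oO /=.
  have -> : O = \bigcup_(B in [set B | U B /\ B `<=` O]) B.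
    apply/seteqP; split => x; last by case=> B [_]; apply.
    move=> Ox; have [|B [UB Bx] BO] := bU.2 x O; first exact: open_nbhs_nbhs.
    by exists B.
  have cO : countable [set B | U B /\ B `<=` O].
    by apply: sub_countable cU; apply: subset_card_le => B [].
  have [[B0 B0O]|nB] := pselect (exists B, U B /\ B `<=` O); last first.
    rewrite bigcup0 ?preimage_set0//; last by move=> B BO; exfalso;
        apply: nB; exists B.
    exact: sigma_algebra0.
  have [e [eO Oe]] := countable_enum cO B0O.
  rewrite (_ : \bigcup_(B in _) B = \bigcup_n e n); last first.
    apply/seteqP; split => x [n nO] Bx; last by exists (e n).
    by have [m mn] := Oe _ nO; exists m => //; rewrite mn.
  rewrite preimage_bigcup; apply: sigma_algebra_bigcup => n.
  by apply: sub_sigma_algebra; exists (e n) => //; have [] := eO n.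
Qed.

(** * The ideal of null sets *)

Section null_ideal.
Context d (X : measurableType d) (R : realType) (mu : probability X R).
Implicit Types A B : set X.

(** Phrased through almost-everywhere statements, so that it can be used for
    sets whose measurability is not known. *)
Definition nonnull A := ~ {ae mu, forall x, ~ A x}.

Lemma ae_nullP A : measurable A -> {ae mu, forall x, ~ A x} <-> mu A = 0%E.
Proof.
move=> mA; split=> [[B [mB B0 AB]]|A0]; last by exists A;
    split => // x /contrapT.
apply/(negligibleP mu mA); exists B; split => // x Ax; apply: AB => /=.
by move/(_ Ax).
Qed.

Lemma nonnullP A : measurable A -> nonnull A <-> (0 < mu A)%E.
Proof.
move=> mA; rewrite /nonnull (ae_nullP mA) lt0e measure_ge0 andbT.
by split=> [/eqP|/eqP].
Qed.

Lemma nonnullT : nonnull setT.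
Proof. by apply/nonnullP => //; rewrite probability_setT lte01. Qed.

Lemma nonnull_ae A (P : X -> Prop) :
  nonnull A -> {ae mu, forall x, P x} -> exists x, A x /\ P x.
Proof.
move=> Ann aP; apply: contrapT => nex; apply: Ann; apply: filterS aP => x Px Ax.
by apply: nex; exists x.
Qed.

Lemma nonnullS A B : {ae mu, forall x, A x -> B x} -> nonnull A -> nonnull B.
Proof. by move=> AB nA nB; apply: nA; apply: filterS2 AB nB =>
    x + nBx /[dup] Ax => /[apply]. Qed.

Lemma ae_countable T (D : set T) (P : T -> X -> Prop) : countable D ->
  (forall i, D i -> {ae mu, forall x, P i x}) ->
  {ae mu, forall x, forall i, D i -> P i x}.
Proof.
move=> /countable_injP[f finj] DP.
have : {ae mu, forall x, forall n i, D i -> f i = n -> P i x}.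
  apply/ae_foralln => n.
  have [[i [Di fi]]|nex] := pselect (exists i, D i /\ f i = n).
    apply: filterS (DP i Di) => x Pix k Dk fk.
    by rewrite (_ : k = i)//; apply: finj; rewrite ?inE// fk.
  by apply: aeW => x i Di fi; exfalso; apply: nex; exists i.
by apply: filterS => x xP i Di; exact: (xP (f i)).
Qed.

Lemma nonnull_bigcup T (D : set T) (B : T -> set X) A : countable D ->
    nonnull A ->
  {ae mu, forall x, A x -> exists2 i, D i & B i x} ->
  exists2 i, D i & nonnull (A `&` B i).
Proof.
move=> cD nA AB; apply: contrapT => nex; apply: nA.
have : {ae mu, forall x, forall i, D i -> ~ (A `&` B i) x}.
  by apply: ae_countable => // i Di; apply: contrapT => nn; apply: nex;
      exists i.
apply: filterS2 AB => x AB nAB Ax; have [i Di Bi] := AB Ax.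
by apply: (nAB i Di).
Qed.

Lemma nonnull_split A B : nonnull A ->
    nonnull (A `&` B) \/ nonnull (A `&` ~` B).
Proof.
move=> nA.
have [|b _ nb] := @nonnull_bigcup bool setT (fun b =>
    if b then B else ~` B) A (countableP _) nA.
  apply: aeW => x _; have [Bx|Bx] := pselect (B x); first by exists true.
  by exists false.
by case: b nb => nb; [left|right].
Qed.

End null_ideal.

(** * Measurable maps into a coded space *)

Section coded_space.
Context d (X : measurableType d) (BB : set (set X)) (RR : set (seq (set X) *
    set (set X))).
Hypothesis cBR : coding BB RR.
Hypothesis BBm : BB `<=` measurable.
Hypothesis BBgen : forall A, measurable A -> <<s BB >> A.

Lemma coded_measurable_fun d' (Y : measurableType d') (f : Y -> X) :
  (forall B, BB B -> measurable (f @^-1` B)) -> measurable_fun setT f.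
Proof.
move=> mf; apply: (@measurability _ _ Y X setT f BB).
  apply/seteqP; split => [A /BBgen //|A].
  by apply: smallest_sub => //; exact: sigma_algebra_measurable.
by move=> _ [B BB_B <-]; rewrite setTI; exact: mf.
Qed.

Lemma measurable_pre d' (Y : measurableType d') (f : Y -> X) A :
  measurable_fun setT f -> measurable A -> measurable (f @^-1` A).
Proof. by move=> mf mA; rewrite -[X in measurable X]setTI; exact: mf. Qed.

Lemma measurable_countableI d' (Y : measurableType d') T (D : set T) (F : T ->
    set Y) :
  countable D -> (forall i, D i -> measurable (F i)) ->
  measurable [set y | forall i, D i -> F i y].
Proof.
move=> /countable_injP[f finj] DF.
rewrite (_ : [set y | _] = \bigcap_n [set y | forall i, D i -> f i = n ->
    F i y]); last first.
  by apply/seteqP; split => y /= yF; [move=> n _ i Di _;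
      exact: yF|move=> i Di; exact: (yF (f i))].
apply: bigcapT_measurable => n.
have [[i [Di fi]]|nex] := pselect (exists i, D i /\ f i = n).
  rewrite (_ : [set y | _] = F i); first exact: DF.
  apply/seteqP; split => y /= yF; first exact: yF.
  by move=> k Dk fk; rewrite (_ : k = i)//; apply: finj; rewrite ?inE// fk.
rewrite (_ : [set y | _] = setT)//; apply/seteqP; split => // y _ i Di fi.
by exfalso; apply: nex; exists i.
Qed.

Lemma measurable_countableU d' (Y : measurableType d') T (D : set T) (F : T ->
    set Y) :
  countable D -> (forall i, D i -> measurable (F i)) ->
  measurable [set y | exists2 i, D i & F i y].
Proof.
move=> cD DF; rewrite (_ : [set y | _] = ~` [set y | forall i, D i ->
    (~` F i) y]).
  by apply/measurableC/measurable_countableI => // i Di; apply/measurableC/DF.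
apply/seteqP; split => y /=.
  by move=> [i Di Fi] /(_ i Di).
by move=> /existsNP[i /not_implyP[Di /contrapT Fi]]; exists i.
Qed.

Lemma measurable_iff d' (Y : measurableType d') (A B : set Y) :
  measurable A -> measurable B -> measurable [set y | A y <-> B y].
Proof.
move=> mA mB; rewrite (_ : [set y | _] = (~` A `|` B) `&` (~` B `|` A)).
  by apply: measurableI; apply: measurableU => //; exact: measurableC.
apply/seteqP; split => y /=.
  by move=> AB; split; [have [|] := pselect (A y)|have [|] := pselect (B y)];
    [move/AB; right|left|move/AB; right|left].
by move=> [[nA|By'] [nB|Ay]].
Qed.

Lemma coded_measurable_eq d' (Y : measurableType d') (f g : Y -> X) :
  measurable_fun setT f -> measurable_fun setT g ->
      measurable [set y | f y = g y].
Proof.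
move=> mf mg; rewrite (_ : [set y | _] = [set y | forall B, BB B ->
    [set y | (f @^-1` B) y <-> (g @^-1` B) y] y]).
  apply: measurable_countableI; first exact: coding_countable cBR.
  by move=> B BB_B; apply: measurable_iff; apply: measurable_pre => //;
      exact: BBm.
apply/seteqP; split => y /=; first by move=> ->.
exact: (coding_sep cBR).
Qed.

(** The way to define measurable maps into X: measurable sets C B attached to
    the atoms give an assignment at each y, and where the rules hold, which
    is a countable condition, the coded point depends measurably on y. *)
Lemma coded_point d' (Y : measurableType d') (x0 : X) (C : set X -> set Y) :
  (forall B, BB B -> measurable (C B)) ->
  let E := [set y | forall r, RR r -> obeys [set B | C B y] r] in
  measurable E /\ exists f : Y -> X, measurable_fun setT f /\
    (forall y, E y -> forall B, BB B -> C B y <-> B (f y)).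
Proof.
move=> mC E.
have mE : measurable E.
  apply: (measurable_countableI (F := fun r =>
      [set y | obeys [set B | C B y] r])).
    exact: coding_rules cBR.
  move=> r Rr.
  rewrite (_ : [set y | obeys _ r] = ~` [set y | forall B, B \in r.1 ->
      C B y] `|`
    [set y | exists2 B, r.2 B & C B y]); last first.
    apply/seteqP; split => y /=; last by move=> [nF /nF|[B] rB CB _]//;
        exists B.
    move=> yr; have [F|nF] := pselect (forall B, B \in r.1 -> C B y);
        [right|by left].
    by have [B rB CB] := yr F; exists B.
  apply: measurableU.
    apply/measurableC/(measurable_countableI (D := [set B | B \in r.1])).
      exact/finite_set_countable/finite_seq.
    by move=> B Br; apply: mC; exact: (coding_head cBR Rr).
  apply: measurable_countableU.
    by apply: sub_countable (coding_countable cBR); apply: subset_card_le;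
        exact: (coding_body cBR).
  by move=> B Br; apply: mC; exact: (coding_body cBR Rr).
split => //.
have /choice[f fE] : forall y, exists x, (E y -> forall B, BB B ->
    C B y <-> B x) /\ (~ E y -> x = x0).
  move=> y; have [Ey|nEy] := pselect (E y); last by exists x0.
  by have [x xC] := coding_point cBR (C := [set B | C B y]) Ey; exists x.
exists f; split => [|y Ey]; last exact: (fE y).1.
apply: coded_measurable_fun => B BB_B.
rewrite (_ : f @^-1` B = (E `&` C B) `|` (~` E `&` [set _ | B x0])).
  apply: measurableU; apply: measurableI => //; [exact: mC|exact: measurableC|].
  have [Bx0|Bx0] := pselect (B x0).
    by rewrite (_ : [set _ | _] = setT)//; apply/seteqP; split.
  by rewrite (_ : [set _ | _] = set0)//; apply/seteqP; split.
apply/seteqP; split => y /=.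
  have [Ey|nEy] := pselect (E y); first by move=> By'; left; split => //;
      apply/((fE y).1 Ey).
  by rewrite (fE y).2//; right.
by move=> [[Ey /((fE y).1 Ey _ BB_B)]|[nEy]]//; rewrite (fE y).2.
Qed.

End coded_space.

(** * A null copy of the space inside a conull set *)

Section cantor.
Context d (X : measurableType d) (R : realType) (mu : probability X R).
Context (BB : set (set X)) (RR : set (seq (set X) * set (set X))).
Hypothesis cBR : coding BB RR.
Hypothesis BBm : BB `<=` measurable.
Hypothesis BBgen : forall A, measurable A -> <<s BB >> A.
Hypothesis atomless_mu : atomless mu.

(** Cells are cut out by finitely many atoms and negated atoms, so that a
    point known through its atoms is known to lie in them. *)
Definition cell (A : set X) := nonnull mu A /\
  exists2 l : seq (set X * bool), (forall p, p \in l -> BB p.1) &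
    A = [set x | forall p, p \in l -> p.1 x <-> p.2].

Lemma cell_nonnull A : cell A -> nonnull mu A. Proof. by case. Qed.

Lemma cell_measurable A : cell A -> measurable A.
Proof.
move=> [_ [l lB ->]].
apply: (measurable_countableI (D := [set p | p \in l]) (F :=
    fun p => [set x | p.1 x <-> p.2])).
  exact/finite_set_countable/finite_seq.
move=> p /lB /BBm mp; apply: measurable_iff => //.
have [p2|p2] := pselect (p.2 : Prop).
  by rewrite (_ : (fun=> _) = setT)//; apply/seteqP; split.
by rewrite (_ : (fun=> _) = set0)//; apply/seteqP; split.
Qed.

Lemma cellI A B (b : bool) : cell A -> BB B ->
  nonnull mu (A `&` [set x | B x <-> b]) -> cell (A `&` [set x | B x <-> b]).
Proof.
move=> [_ [l lB Al]] BB_B nn; split => //; exists ((B, b) :: l).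
  by move=> p; rewrite in_cons => /orP[/eqP ->|/lB].
apply/seteqP; split => x; rewrite Al /=.
  by move=> [xl xB] p; rewrite in_cons => /orP[/eqP ->|/xl].
move=> xl; split; last by apply: (xl (B, b)); exact: mem_head.
by move=> p pl; apply: xl; rewrite in_cons pl orbT.
Qed.

Lemma cell_decide A B : cell A -> BB B ->
  exists A', [/\ cell A', A' `<=` A & A' `<=` B \/ A' `<=` ~` B].
Proof.
move=> cA BB_B; have [nB|nB] := nonnull_split B (cell_nonnull cA).
  exists (A `&` [set x | B x <-> true]); split.
  - by apply: cellI => //; apply: nonnullS nB; apply: aeW => x [Ax Bx]; split.
  - by move=> x [].
  - by left=> x [_ /= ->].
exists (A `&` [set x | B x <-> false]); split.
- by apply: cellI => //; apply: nonnullS nB; apply: aeW => x [Ax Bx]; split.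
- by move=> x [].
- by right=> x [_ /= ->].
Qed.

(** A rule can be settled on a smaller cell. If some conclusion meets A in a
    nonnull set, move there; otherwise, the rule being valid at every point,
    its premises fail almost everywhere on A. *)
Lemma cell_rule A r : cell A -> RR r ->
  exists A', [/\ cell A', A' `<=` A &
    (exists2 B, r.2 B & A' `<=` B) \/
    {ae mu, forall x, A' x -> exists2 B, B \in r.1 & ~ B x}].
Proof.
move=> cA Rr.
have [[B rB nB]|nB] := pselect (exists2 B, r.2 B & nonnull mu (A `&` B)).
  exists (A `&` [set x | B x <-> true]); split.
  - apply: cellI => //; last first.
      by apply: nonnullS nB; apply: aeW => x [Ax Bx]; split.
    exact: (coding_body cBR Rr).
  - by move=> x [].
  - by left; exists B => // x [_ /= ->].
exists A; split => //; right.
have : {ae mu, forall x, forall B, r.2 B -> ~ (A `&` B) x}.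
  apply: ae_countable.
    by apply: sub_countable (coding_countable cBR); apply: subset_card_le;
        exact: (coding_body cBR).
  by move=> B rB; apply: contrapT => nn; apply: nB; exists B.
apply: filterS => x xB Ax; apply: contrapT => nex.
have [|B rB Bx] := coding_valid cBR (r := r) (x := x) Rr; last exact: (xB B rB).
by move=> B Br /=; apply: contrapT => nBx; apply: nex; exists B.
Qed.

(** If no atom cut A into two nonnull pieces, every measurable set would be
    null or conull in A, against atomlessness. *)
Lemma cell_halve A : cell A -> exists A0 A1,
  [/\ cell A0, cell A1, A0 `<=` A, A1 `<=` A & A0 `&` A1 = set0].
Proof.
move=> cA; have mA := cell_measurable cA.
have [B BB_B [n1 n2]] : exists2 B, BB B & nonnull mu (A `&` B) /\ nonnull mu
    (A `&` ~` B).
  apply: contrapT => nex.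
  (* The sets that are null or conull in A form a sigma-algebra. *)
  have trivialA M : measurable M ->
      {ae mu, forall x, A x -> ~ M x} \/ {ae mu, forall x, A x -> M x}.
    move=> /BBgen; move: M; suff : <<s BB >> `<=`
        [set M | {ae mu, forall x, A x -> ~ M x} \/ {ae mu, forall x, A x ->
            M x}] by [].
    apply: smallest_sub; first split.
    - by rewrite /=; left; apply: aeW => x _ [].
    - move=> M [h|h]; rewrite setTD /=; [right|left];
          apply: filterS h => x h Ax.
        exact: h.
      by apply; exact: h.
    - move=> M /= hM; have [[i hi]|nM] :=
          pselect (exists i, {ae mu, forall x, A x -> M i x}).
        by right; apply: filterS hi => x xi Ax; exists i => //; exact: xi.
      left; have : {ae mu, forall x, forall i, A x -> ~ M i x}.
        by apply/ae_foralln => i; case: (hM i) => // hi; exfalso; apply: nM;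
            exists i.
      by apply: filterS => x xM Ax [i _]; exact: xM.
    - move=> B BB_B /=; have [h|h] := pselect (nonnull mu (A `&` B)).
        right; apply: contrapT => h'; apply: nex; exists B => //;
            split => // h''.
        by apply: h'; apply: filterS h'' => x h'' Ax; apply: contrapT => nBx;
            apply: h''.
      left; have {}h := contrapT h; apply: filterS h => x xAB Ax Bx.
      by apply: xAB.
  have [B [mB BA /andP[B0 BltA]]] :=
      atomless_mu mA ((nonnullP mu mA).1 (cell_nonnull cA)).
  have [h|h] := trivialA B mB.
    have := (nonnullP mu mB).2 B0; apply; apply: filterS h => x h Bx;
        exact: (h (BA _ Bx) Bx).
  move: BltA; rewrite ltNge => /negP; apply.
  apply: (@le_trans _ _ (mu B + mu (A `\` B))%E).
    rewrite -measureU//; last first.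
    - by rewrite setDIK.
    - exact: measurableD.
    by rewrite setDUK// .
  rewrite (_ : mu (A `\` B) = 0%E) ?adde0//.
  by apply/ae_nullP; [exact: measurableD|apply: filterS h => x h [Ax]; apply;
      exact: h].
exists (A `&` [set x | B x <-> true]), (A `&` [set x | B x <-> false]); split.
- by apply: cellI => //; apply: nonnullS n1; apply: aeW => x [Ax Bx]; split.
- by apply: cellI => //; apply: nonnullS n2; apply: aeW => x [Ax Bx]; split.
- by move=> x [].
- by move=> x [].
- by apply/seteqP; split => // x [[_ /= [_ /(_ erefl) Bx]] [_ /= [/(_ Bx)]]].
Qed.

Lemma cell_half_measure A : cell A ->
  exists A', [/\ cell A', A' `<=` A & (mu A' + mu A' <= mu A)%E].
Proof.
move=> cA; have [A0 [A1 [c0 c1 s0 s1 d01]]] := cell_halve cA.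
have m0 := cell_measurable c0; have m1 := cell_measurable c1.
have sum : (mu A0 + mu A1 <= mu A)%E.
  rewrite -measureU//; apply: le_measure; rewrite ?inE//;
      first exact: measurableU.
    exact: cell_measurable.
  by rewrite subUset.
have [le01|le10] := leP (mu A0) (mu A1).
  by exists A0; split => //; apply: le_trans sum; exact: leeD2l.
by exists A1; split => //; apply: le_trans sum; apply: leeD2r; exact: ltW.
Qed.

Context (kB : set X -> nat) (kR : seq (set X) * set (set X) -> nat).
Hypothesis kB_inj : {in BB &, injective kB}.
Hypothesis kR_inj : {in RR &, injective kR}.

(** Stage n of the construction settles the atom and the rule of number n. *)
Definition treats n A :=
  (forall B, BB B -> kB B = n -> A `<=` B \/ A `<=` ~` B) /\
  (forall r, RR r -> kR r = n -> (exists2 B, r.2 B & A `<=` B) \/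
    {ae mu, forall x, A x -> exists2 B, B \in r.1 & ~ B x}).

Lemma cell_treat n A : cell A ->
    exists A', [/\ cell A', A' `<=` A & treats n A'].
Proof.
move=> cA.
have [A1 [c1 s1 t1]] : exists A', [/\ cell A', A' `<=` A &
    forall B, BB B -> kB B = n -> A' `<=` B \/ A' `<=` ~` B].
  have [[B [BB_B Bn]]|nB] := pselect (exists B, BB B /\ kB B = n); last first.
    by exists A; split => // B BB_B Bn; exfalso; apply: nB; exists B.
  have [A1 [c1 s1 t1]] := cell_decide cA BB_B; exists A1; split => // D BB_D Dn.
  by rewrite (_ : D = B)//; apply: kB_inj; rewrite ?inE ?Bn.
have [[r [Rr rn]]|nr] := pselect (exists r, RR r /\ kR r = n); last first.
  exists A1; split => //; split => // r Rr rn; exfalso; apply: nr; by exists r.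
have [A2 [c2 s2 t2]] := cell_rule c1 Rr; exists A2; split => //.
  exact: subset_trans s1.
split=> [B BB_B Bn|q Rq qn].
  by have [h|h] := t1 _ BB_B Bn; [left|right]; exact: subset_trans h.
by rewrite (_ : q = r)//; apply: kR_inj; rewrite ?inE ?rn.
Qed.

(** The factor 1/2 bounds the total measure of the cells of level n by 2 ^- n
    and makes the limit set null. *)
Definition good_split n A (q : bool -> set X) :=
  [/\ forall b, cell (q b), forall b, q b `<=` A, q true `&` q false = set0,
      (mu (q true) + mu (q false) <= (2^-1)%:E * mu A)%E & forall b, treats n
          (q b)].

Lemma cell_split n A : cell A -> exists q, good_split n A q.
Proof.
move=> cA; have [A' [cA' sA' hA']] := cell_half_measure cA.
have [A0 [A1 [c0 c1 s0 s1 d01]]] := cell_halve cA'.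
have [B0 [cB0 sB0 tB0]] := cell_treat n c0.
have [B1 [cB1 sB1 tB1]] := cell_treat n c1.
exists (fun b => if b then B1 else B0); split.
- by case.
- by case; [apply: subset_trans sB1 _|apply: subset_trans sB0 _];
      apply: subset_trans sA'.
- by apply/seteqP; split => // x [/sB1 x1 /sB0 x0]; rewrite -d01.
- apply: (@le_trans _ _ (mu A')).
    have ? := cell_measurable cB0; have ? := cell_measurable cB1.
    rewrite -measureU//; last first.
      by apply/seteqP; split => // x [/sB1 x1 /sB0 x0]; rewrite -d01.
    apply: le_measure; rewrite ?inE//;
        [exact: measurableU|exact: cell_measurable|].
    by rewrite subUset; split;
        [apply: subset_trans sB1 _|apply: subset_trans sB0 _].
  rewrite lee_pdivlMl// (le_trans _ hA')//.
  by rewrite mule_natl mule2n.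
- by case.
Qed.

Context (M0 : set X) (M0_BB : BB M0) (M0_nn : nonnull mu M0).
Context (q : nat -> set X -> bool -> set X).
Hypothesis qP : forall n A, cell A -> good_split n A (q n A).

(** Words are read from right to left: the last choice is the head of the
    list. *)
Fixpoint scheme (s : seq bool) : set X :=
  if s is b :: s' then q (size s') (scheme s') b else M0.

Lemma scheme_cell s : cell (scheme s).
Proof.
elim: s => [|b s IH] /=; last by have [+ _ _ _ _] := qP (size s) IH; apply.
split => //; exists [:: (M0, true)].
  by move=> p; rewrite mem_seq1 => /eqP ->.
apply/seteqP; split => x /=.
  by move=> Mx p; rewrite mem_seq1 => /eqP ->; split.
by move=> /(_ (M0, true) (mem_head _ _))[_]; apply.
Qed.

Lemma scheme_cons b s : scheme (b :: s) `<=` scheme s.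
Proof. by have [_ + _ _ _] := qP (size s) (scheme_cell s); apply. Qed.

Lemma scheme_treats b s : treats (size s) (scheme (b :: s)).
Proof. by have [_ _ _ _ ] := qP (size s) (scheme_cell s); apply. Qed.

Lemma scheme_inj s t x : size s = size t -> scheme s x -> scheme t x -> s = t.
Proof.
elim: s t => [|b s IH] [|c t]//= [st] sx tx.
have e : s = t by apply: IH => //;
    [exact: (scheme_cons sx)|exact: (scheme_cons tx)].
subst t; congr cons.
have [_ _ dis _ _] := qP (size s) (scheme_cell s).
have dx : ~ (q (size s) (scheme s) true `&` q (size s) (scheme s) false) x by
    rewrite dis.
by case: b c sx tx => [] [] // sx tx; exfalso; apply: dx.
Qed.

Fixpoint words n : seq (seq bool) :=
  if n is m.+1 then [seq true :: s | s <- words m] ++ [seq false :: s | s <-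
      words m]
  else [:: [::]].

Lemma mem_words s : s \in words (size s).
Proof.
elim: s => [|b s IH] /=; first exact: mem_head.
by rewrite mem_cat; case: b; apply/orP; [left|right]; exact: map_f.
Qed.

Lemma measure_words n :
  (\sum_(s <- words n) mu (scheme s) <= (2 ^- n)%:E)%E.
Proof.
elim: n => [|n IH].
  by rewrite /= big_seq1 expr0 invr1; apply: probability_le1; exact: BBm.
apply: (@le_trans _ _ (\sum_(s <- words n) (2^-1)%:E * mu (scheme s))%E).
  rewrite /= big_cat !big_map.
  rewrite [leLHS](_ : _ = \sum_(s <- words n)
    (mu (scheme (true :: s)) + mu (scheme (false :: s))))%E;
        last by rewrite big_split.
  rewrite big_seq [leRHS]big_seq; apply: lee_sum => s sn.
  by have [_ _ _ + _] := qP (size s) (scheme_cell s).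
rewrite -ge0_sume_distrr //; apply: (le_trans (lee_pmul _ _ (lexx _) IH)) => //.
  exact: sume_ge0.
by rewrite -EFinM -invfM -exprS.
Qed.

Fixpoint branch_word (a : nat -> bool) n : seq bool :=
  if n is m.+1 then a m :: branch_word a m else [::].

Lemma size_branch_word a n : size (branch_word a n) = n.
Proof. by elim: n => //= n ->. Qed.

Lemma scheme_decreasing a m n : (m <= n)%N ->
  scheme (branch_word a n) `<=` scheme (branch_word a m).
Proof.
elim: n => [|n IH]; first by rewrite leqn0 => /eqP ->.
rewrite leq_eqVlt => /orP[/eqP ->//|]; rewrite ltnS => /IH.
apply: subset_trans; exact: scheme_cons.
Qed.

(** The atoms that contain the cells of a branch from some level on obey
    every rule, since each rule is settled at some stage. The point that they
    code lies in all the cells of the branch, which are determined by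
    finitely many atoms. *)
Lemma branch_point a : exists x, (forall n, scheme (branch_word a n) x) /\
  forall B, BB B -> B x <-> exists n, scheme (branch_word a n) `<=` B.
Proof.
have ne n : exists y, scheme (branch_word a n) y.
  have [y [sy _]] := nonnull_ae (cell_nonnull (scheme_cell (branch_word a n)))
    (aeW mu (fun=> I)).
  by exists y.
have treat n : treats n (scheme (branch_word a n.+1)).
  by rewrite -[n in treats n](size_branch_word a n); exact: scheme_treats.
have [|x xC] := coding_point cBR
    (C := [set B | exists n, scheme (branch_word a n) `<=` B]).
  move=> r Rr rC.
  (* The list of premises is finite, so one cell lies in all of them. *)
  have [n nr] : exists n, forall B, B \in r.1 ->
      scheme (branch_word a n) `<=` B.
    elim: r.1 rC => [|B l IH] rC; first by exists 0%N.
    have [n1 h1] : exists n, scheme (branch_word a n) `<=` B by apply: rC;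
        exact: mem_head.
    have [|n2 h2] := IH; first by move=> D Dl; apply: rC;
        rewrite in_cons Dl orbT.
    exists (maxn n1 n2) => D; rewrite in_cons => /orP[/eqP ->|Dl].
      by apply: subset_trans h1; apply: scheme_decreasing; exact: leq_maxl.
    by apply: subset_trans (h2 _ Dl); apply: scheme_decreasing; exact: leq_maxr.
  have [_ /(_ r Rr erefl)[[B rB sB]|nr']] := treat (kR r).
    by exists B => //; exists (kR r).+1.
  pose m := maxn n (kR r).+1.
  have [y [sy ry]] := nonnull_ae (cell_nonnull (scheme_cell (branch_word a
      m))) nr'.
  have [B rB nBy] := ry (scheme_decreasing (leq_maxr _ _) sy).
  by have := nr B rB _ (scheme_decreasing (leq_maxl _ _) sy).
exists x; split=> [n|B BB_B]; last by rewrite -(xC _ BB_B).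
have [_ [l lB sE]] := scheme_cell (branch_word a n).
rewrite sE => p pl; have BB_p := lB _ pl.
have sp y : scheme (branch_word a n) y -> (p.1 y <-> p.2) by rewrite sE =>
    /(_ p pl).
rewrite -(xC _ BB_p); split=> [[m mp]|p2].
  have [y sy] := ne (maxn n m).
  apply/(sp y); first exact: scheme_decreasing (leq_maxl _ _) _ sy.
  by apply: mp; exact: scheme_decreasing (leq_maxr _ _) _ sy.
by exists n => y /sp yp; apply/yp.
Qed.

(** A point is sent to the branch given by its own atoms; the left inverse
    reads the atoms back from the branch. *)
Lemma null_embedding : exists (j l : X -> X) (Z : set X),
  [/\ measurable_fun setT j, measurable_fun setT l, cancel j l,
      forall x, M0 (j x) & [/\ measurable Z, mu Z = 0%E & forall x, Z (j x)]].
Proof.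
pose code x n := `[< exists B, [/\ BB B, kB B = n & B x] >].
have mcode n : measurable [set x | code x n].
  rewrite (_ : [set x | _] = [set x | exists2 B, [set B | BB B /\ kB B = n] B
      & B x]).
    apply: measurable_countableU => [|B [BB_B _]]; last exact: BBm.
    by apply: sub_countable (coding_countable cBR);
        apply: subset_card_le => B [].
  apply/seteqP; split => x /=.
    by move=> /asboolP[B [? ? ?]]; exists B.
  by move=> [B [? ?] ?]; apply/asboolP; exists B.
have mprefix s : measurable [set x | branch_word (code x) (size s) = s].
  elim: s => [|b s IH] /=.
    by rewrite (_ : [set _ | _] = setT)//; apply/seteqP; split.
  rewrite (_ : [set x | _] = [set x | code x (size s) = b] `&`
      [set x | branch_word (code x) (size s) = s]).
    apply: measurableI IH; case: b; first exact: mcode.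
    rewrite (_ : [set x | _] = ~` [set x | code x (size s)]).
      exact: measurableC.
    by apply/seteqP; split => x /=; [move=> ->|move=> /negP/negbTE].
  by apply/seteqP; split => x /=; [case=> -> ->|case=> -> ->].
have /choice[e eP] := branch_point.
pose j x := e (code x).
have mj : measurable_fun setT j.
  apply: (coded_measurable_fun BBm BBgen) => B BB_B.
  rewrite (_ : j @^-1` B = [set x | exists2 s, [set s | scheme s `<=` B] s &
      branch_word (code x) (size s) = s]).
    by apply: measurable_countableU; [exact: countableP|move=> s _;
        exact: mprefix].
  apply/seteqP; split => x /=.
    move=> /((eP (code x)).2 B BB_B)[n nB];
        exists (branch_word (code x) n) => //.
    by rewrite size_branch_word.
  move=> [s sB sx]; apply/((eP (code x)).2 B BB_B); exists (size s).
  by rewrite sx.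
pose C B := [set y | exists2 s, size s = kB B & scheme (true :: s) y].
have mC B : measurable (C B).
  apply: measurable_countableU; first exact: countableP.
  by move=> s _; apply: cell_measurable; exact: scheme_cell.
have CP x B : BB B -> C B (j x) <-> B x.
  move=> BB_B; have sj := (eP (code x)).1 (kB B).+1; split.
    move=> [s sB sjx].
    (* Cells of the same level are disjoint, so the branch through j x is the
       code of x. *)
    have : true :: s = branch_word (code x) (kB B).+1.
      by apply: scheme_inj sjx sj; rewrite size_branch_word /= sB.
    move=> [/esym/asboolP[D [BB_D DB Dx]] _].
    by rewrite (_ : B = D)//; apply: kB_inj; rewrite ?inE.
  move=> Bx; exists (branch_word (code x) (kB B));
      first exact: size_branch_word.
  rewrite (_ : true = code x (kB B))//; apply/esym/asboolP; by exists B.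
have [mE [l [ml lP]]] := coded_point cBR BBm BBgen (e (code point)) (fun B _
    => mC B).
exists j, l, (\bigcap_n \big[setU/set0]_(s <- words n) scheme s).
split => //.
- move=> x; apply/esym/(coding_sep cBR) => B BB_B.
  rewrite -(CP x B BB_B) -lP// => r Rr rC.
  have [|D rD Dx] := coding_valid cBR (x := x) Rr.
    move=> D Dr; apply/CP; first exact: (coding_head cBR Rr Dr).
    exact: rC.
  by exists D => //; apply/CP => //; exact: (coding_body cBR Rr rD).
- by move=> x; exact: (eP (code x)).1 0%N.
have mW n : measurable (\big[setU/set0]_(s <- words n) scheme s).
  by apply: bigsetU_measurable => s _; apply: cell_measurable;
      exact: scheme_cell.
have mZ : measurable (\bigcap_n \big[setU/set0]_(s <- words n) scheme s).
  exact: bigcapT_measurable.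
split => //; last first.
  move=> x n _; rewrite -bigcup_seq; exists (branch_word (code x) n).
    by rewrite /= -[n in words n](size_branch_word (code x) n);
        exact: mem_words.
  exact: (eP (code x)).1.
have bound n : (mu (\bigcap_n \big[setU/set0]_(s <- words n) scheme s) <= (2
    ^- n)%:E)%E.
  apply: le_trans (measure_words n).
  apply: (@le_trans _ _ (mu (\big[setU/set0]_(s <- words n) scheme s))).
    by apply: le_measure; rewrite ?inE// => x; apply.
  elim: (words n) => [|s w IH]; first by rewrite !big_nil measure0.
  rewrite !big_cons; apply: le_trans (measureU2 _ _ _) _ => //.
  - by apply: cell_measurable; exact: scheme_cell.
  - by apply: bigsetU_measurable => t _; apply: cell_measurable;
        exact: scheme_cell.
  - exact: leeD2l.
apply/eqP; rewrite eq_le measure_ge0 andbT.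
apply/lee_addgt0Pr => eps eps0; rewrite add0e.
apply: (le_trans (bound (Num.bound eps^-1)));
    rewrite lee_fin invf_ple ?posrE ?exprn_gt0//.
apply: le_trans (ltW (archi_boundP _)) _; first by rewrite invr_ge0 ltW.
by rewrite -natrX ler_nat ltnW// ltn_expl.
Qed.

End cantor.

(** * Point realisation of automorphisms of the measure algebra *)

Section standard_space.
Context d (X : measurableType d) (R : realType) (mu : probability X R).
Hypothesis standardX : standard_borel R X.
Hypothesis atomless_mu : atomless mu.

Lemma measurable_eq d' (Y : measurableType d') (f g : Y -> X) :
  measurable_fun setT f -> measurable_fun setT g ->
      measurable [set y | f y = g y].
Proof.
by have [BB [RR [cBR BBm BBgen]]] := standard_borel_coding standardX;
    exact: (coded_measurable_eq cBR BBm).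
Qed.

(** Hilbert's hotel. Some j embeds X into a null set disjoint from N, so that
    N, j N, j (j N) and so on are null; applying j on their union frees N and
    moves a null set only. *)
Lemma hotel_shift (N : set X) : measurable N -> mu N = 0%E ->
  exists H K : X -> X,
    [/\ measurable_fun setT H, measurable_fun setT K, cancel H K &
     [/\ forall x, ~ N (H x), forall y, ~ N y -> H (K y) = y,
      {ae mu, forall x, H x = x} & {ae mu, forall x, K x = x}]].
Proof.
move=> mN N0.
have [BB0 [RR0 [cBR0 BBm0 BBgen0]]] := standard_borel_coding standardX.
have [BB [RR [cBR BB0B BBm BB_N]]] : codable BB0 (~` N).
  apply: (codable_sigma_algebra cBR0 BBm0); apply: BBgen0; exact: measurableC.
have BBgen A : measurable A -> <<s BB >> A.
  move=> /BBgen0; apply: smallest_sub; first exact: smallest_sigma_algebra.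
  by move=> B /BB0B; exact: sub_sigma_algebra.
have /countable_injP[kB kBi] := coding_countable cBR.
have /countable_injP[kR kRi] := coding_rules cBR.
have nnN : nonnull mu (~` N).
  apply: (@nonnullS _ _ _ mu setT); last exact: nonnullT.
  by apply: filterS ((ae_nullP mu mN).2 N0) => x nNx _.
have /choice[q qP] : forall p : nat * set X, exists q, cell mu BB p.2 ->
    good_split mu BB RR kB kR p.1 p.2 q.
  move=> [n A]; have [cA|ncA] := pselect (cell mu BB A).
    by have [q qA] := cell_split cBR BBm BBgen atomless_mu kBi kRi n cA;
        exists q.
  by exists (fun=> set0).
have [j [l [Z [mj ml jK jN [mZ Z0 jZ]]]]] := null_embedding cBR BBm BBgen kBi
  BB_N nnN (fun n A => qP (n, A)).
(* O k is the k-th image of N under j, written with the left inverse l so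
   that it is measurable by construction. *)
pose fix O k := if k is k'.+1 then [set y | j (l y) = y] `&` (l @^-1` O k')
    else N.
have mO k : measurable (O k).
  elim: k => [//|k IH] /=; apply: measurableI; last exact: measurable_pre.
  apply: measurable_eq => //; exact: measurableT_comp.
have Onull k : {ae mu, forall x, ~ O k x}.
  case: k => [|k]; first exact/ae_nullP.
  apply: filterS ((ae_nullP mu mZ).2 Z0) => x nZ [/= jx _].
  by apply: nZ; rewrite -jx.
pose U := \bigcup_k O k.
have mU : measurable U by exact: bigcupT_measurable.
have Unull : {ae mu, forall x, ~ U x}.
  by have /ae_foralln := Onull; apply: filterS => x xO [k _]; exact: xO.
have mif (f : X -> X) : measurable_fun setT f ->
    measurable_fun setT (fun x => if x \in U then f x else x).
  move=> mf; apply: measurable_fun_ifT => //; apply: (measurable_fun_bool true).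
  rewrite setTI (_ : _ @^-1` _ = U)//; apply/seteqP; split => x /=.
    by move/set_mem.
  by move/mem_set.
exists (fun x => if x \in U then j x else x), (fun x =>
    if x \in U then l x else x).
split; [exact: mif|exact: mif| |split].
- move=> x; case: (boolP (x \in U)) => [/set_mem[k _ Ok]|/negbTE -> //].
  rewrite mem_set ?jK//; exists k.+1 => //; split; rewrite /= ?jK//.
- move=> x; case: ifPn => [_|/negP nU]; first exact: jN.
  by move=> Nx; apply: nU; rewrite inE; exists 0%N.
- move=> y nNy; case: (boolP (y \in U)) =>
      [/set_mem[[|k] _ //= [jl Ol]]|/negbTE -> //].
  by rewrite mem_set//; exists k.
- by apply: filterS Unull => x nU; rewrite memNset.
- by apply: filterS Unull => x nU; rewrite memNset.
Qed.

Definition sub_ae (A B : set X) := {ae mu, forall x, A x -> B x}.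
Definition eq_ae (A B : set X) := {ae mu, forall x, A x <-> B x}.

Lemma sub_aeT A B C : sub_ae A B -> sub_ae B C -> sub_ae A C.
Proof. by rewrite /sub_ae => AB BC; apply: filterS2 AB BC =>
    x AB BC /AB /BC. Qed.

Lemma eq_aeP A B : eq_ae A B <-> sub_ae A B /\ sub_ae B A.
Proof.
rewrite /eq_ae /sub_ae; split=> [AB|[AB BA]]; first by split;
    apply: filterS AB => x [].
by apply: filterS2 AB BA => x; split.
Qed.

(** Automorphisms of the measure algebra, represented on measurable sets. The
    order determines complements and countable unions. *)
Record order_iso (F G : set X -> set X) : Prop := OrderIso {
  iso_measurable : forall A, measurable A -> measurable (F A);
  iso_measurableV : forall A, measurable A -> measurable (G A);
  iso_sub : forall A B, measurable A -> measurable B -> sub_ae A B ->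
      sub_ae (F A) (F B);
  iso_subV : forall A B, measurable A -> measurable B -> sub_ae A B ->
      sub_ae (G A) (G B);
  isoK : forall A, measurable A -> eq_ae (G (F A)) A;
  isoVK : forall A, measurable A -> eq_ae (F (G A)) A }.

Lemma order_iso_sym F G : order_iso F G -> order_iso G F.
Proof. by case=> *; split. Qed.

Section point_map.
Variables (F G : set X -> set X).
Hypothesis FG : order_iso F G.

Let mF := iso_measurable FG.
Let mG := iso_measurableV FG.

Lemma iso_galois A B : measurable A -> measurable B ->
  sub_ae (G A) B -> sub_ae A (F B).
Proof.
move=> mA mB /(iso_sub FG (mG mA) mB); apply: sub_aeT.
by have /eq_aeP[] := isoVK FG mA.
Qed.

Lemma iso_bigcup T (D : set T) (A : T -> set X) : countable D ->
  (forall i, D i -> measurable (A i)) ->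
  sub_ae (F [set x | exists2 i, D i & A i x]) [set x | exists2 i, D i & F (A
      i) x].
Proof.
move=> cD mA; set U := [set x | exists2 i, D i & F (A i) x].
have mU : measurable U by apply: measurable_countableU => // i Di; exact/mF/mA.
have mV : measurable [set x | exists2 i, D i & A i x] by exact:
    measurable_countableU.
suff : sub_ae [set x | exists2 i, D i & A i x] (G U).
  move=> /(iso_sub FG mV (mG mU)) h; apply: sub_aeT h _.
  by have /eq_aeP[] := isoVK FG mU.
have : {ae mu, forall x, forall i, D i -> A i x -> G U x}.
  apply: ae_countable => // i Di.
  have FU : sub_ae (F (A i)) U by apply: aeW => x Fx; exists i.
  have := iso_subV FG (mF (mA i Di)) mU FU; apply: sub_aeT.
  by have /eq_aeP[] := isoK FG (mA i Di).
by apply: filterS => x xA [i Di]; exact: xA.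
Qed.

(** An order isomorphism preserves infima and suprema of countable families,
    hence the validity of rules up to null sets. *)
Lemma iso_rule T T' (D : set T) (E : set T') (A : T -> set X) (B : T' ->
    set X) :
  countable D -> countable E -> (forall i, D i -> measurable (A i)) ->
  (forall i, E i -> measurable (B i)) ->
  (forall x, (forall i, D i -> A i x) -> exists2 i, E i & B i x) ->
  {ae mu, forall x, (forall i, D i -> F (A i) x) -> exists2 i, E i & F (B i) x}.
Proof.
move=> cD cE mA mB AB; pose W := [set x | forall i, D i -> F (A i) x].
have mW : measurable W by apply: measurable_countableI => // i Di; exact/mF/mA.
have mU : measurable [set x | exists2 i, E i & B i x] by exact:
    measurable_countableU.
apply: (@sub_aeT W (F [set x | exists2 i, E i & B i x]));
    last exact: iso_bigcup.
apply: iso_galois => //.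
have : {ae mu, forall x, forall i, D i -> G W x -> A i x}.
  apply: ae_countable => // i Di.
  have WF : sub_ae W (F (A i)) by apply: aeW => x; apply.
  have h := iso_subV FG mW (mF (mA i Di)) WF; apply: sub_aeT h _.
  by have /eq_aeP[] := isoK FG (mA i Di).
by apply: filterS => x xA GW; apply: AB => i Di; exact: xA.
Qed.

Lemma iso_set0 : sub_ae (F set0) set0.
Proof.
have := @iso_rule bool bool [set true] set0 (fun=> set0) (fun=> set0).
rewrite /sub_ae => h; apply: filterS (h _ _ _ _ _).
- by move=> x h' Fx; have [|//] := h' _.
- exact: countableP.
- exact: countableP.
- by [].
- by [].
- by move=> x /(_ true erefl).
Qed.

(** At almost every x the atoms B with x in F B obey the rules of the coding,
    by [iso_rule], and so code a point. *)
Lemma iso_point_map : exists f : X -> X, measurable_fun setT f /\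
  forall A, measurable A -> eq_ae (f @^-1` A) (F A).
Proof.
have [BB [RR [cBR BBm BBgen]]] := standard_borel_coding standardX.
have mFB B : BB B -> measurable (F B) by move=> /BBm; exact: mF.
have [mE [f [mf fP]]] := coded_point cBR BBm BBgen point mFB.
exists f; split => //.
have aeE : {ae mu, forall x, forall r, RR r -> obeys [set B | F B x] r}.
  apply: ae_countable; first exact: coding_rules cBR.
  move=> r Rr; apply: (iso_rule (D := [set B | B \in r.1]) (E := r.2) (A :=
      id) (B := id)).
  - exact/finite_set_countable/finite_seq.
  - by apply: sub_countable (coding_countable cBR); apply: subset_card_le;
        exact: (coding_body cBR).
  - by move=> B /(coding_head cBR Rr) /BBm.
  - by move=> B /(coding_body cBR Rr) /BBm.
  - by move=> x; apply: (coding_valid cBR).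
suff : forall A, <<s BB >> A -> measurable A /\ eq_ae (f @^-1` A) (F A).
  by move=> h A /BBgen /h[].
suff : <<s BB >> `<=` [set A | measurable A /\ eq_ae (f @^-1` A) (F A)] by [].
apply: smallest_sub; first split.
- by split => //; apply/eq_aeP; split; [apply: aeW|exact: iso_set0].
- move=> A [mA fA]; rewrite setTD; split; first exact: measurableC.
  have h1 := @iso_rule bool bool setT set0 (fun b =>
      if b then A else ~` A) (fun=> set0).
  have h2 := @iso_rule bool bool set0 setT (fun=> set0) (fun b =>
      if b then A else ~` A).
  have mAb b : measurable (if b then A else ~` A) by case: b => //;
      exact: measurableC.
  have {}h1 : {ae mu, forall x, F A x -> ~ F (~` A) x}.
    have : {ae mu, forall x, (forall b : bool, setT b ->
        F (if b then A else ~` A) x) -> exists2 b : bool, set0 b & F set0 x}.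
      apply: h1; try exact: countableP; try by [].
      by move=> x xA; have /= := xA false I; move=> /(_ (xA true I)).
    by apply: filterS => x h Fx Fnx; have [|//] := h; case.
  have {}h2 : {ae mu, forall x, ~ F A x -> F (~` A) x}.
    have : {ae mu, forall x, (forall b : bool, set0 b -> F set0 x) ->
        exists2 b : bool, setT b & F (if b then A else ~` A) x}.
      apply: h2; try exact: countableP; try by [].
      move=> x _; have [Ax|nAx] := pselect (A x);
          [by exists true|by exists false].
    by apply: filterS => x h nFx; have [|[] _ Fx //] := h.
  rewrite /eq_ae in fA *; apply: filterS3 fA h1 h2 => x /= fA h1 h2;
      split=> [nA|]; first by apply: h2 => /fA.
  by move=> Fn /fA /h1.
- move=> A hA; have mA i := (hA i).1; split; first exact: bigcupT_measurable.
  have AF : {ae mu, forall x, forall i, A i (f x) <-> F (A i) x}.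
    by apply/ae_foralln => i; exact: (hA i).2.
  have le i : sub_ae (F (A i)) (F (\bigcup_i A i)).
    apply: (iso_sub FG (mA i)); first exact: bigcupT_measurable.
    by apply: aeW => x Ax; exists i.
  have /ae_foralln {}le := le; rewrite /eq_ae.
  have ub := @iso_bigcup nat setT A (countableP _) (fun i _ => mA i).
  rewrite /sub_ae in ub; apply: filterS3 AF le ub => x AF le ub; split;
      first by case=> i _ /AF /le.
  by move=> /ub[i _ /AF Ai]; exists i.
- move=> B BB_B; split; first exact: BBm.
  by rewrite /eq_ae; apply: filterS aeE => x Ex; split => /(fP x Ex B BB_B).
Qed.

End point_map.

Lemma ae_eq_points (f g : X -> X) :
  measurable_fun setT f -> measurable_fun setT g ->
  (forall A, measurable A -> eq_ae (f @^-1` A) (g @^-1` A)) ->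
  {ae mu, forall x, f x = g x}.
Proof.
move=> mf mg fgA; have [BB [RR [cBR BBm BBgen]]] :=
    standard_borel_coding standardX.
have : {ae mu, forall x, forall B, BB B -> B (f x) <-> B (g x)}.
  by apply: ae_countable; [exact: coding_countable cBR|move=> B /BBm;
      exact: fgA].
by apply: filterS => x; exact: (coding_sep cBR).
Qed.

(** The point maps of F and of its inverse G are inverse to each other
    outside two null sets N1 and N2. Composing with the shifts of
    [hotel_shift] removes these sets and gives a bijection of X. *)
Theorem iso_realization F G : order_iso F G ->
  exists S : nsbij mu, forall A, measurable A -> eq_ae (S @^-1` A) (F A).
Proof.
move=> FG; have GF := order_iso_sym FG.
have [f [mf fF]] := iso_point_map FG; have [g [mg gG]] := iso_point_map GF.
have null_pre (F' G' : set X -> set X) (h : X -> X) : order_iso F' G' ->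
    (forall A, measurable A -> eq_ae (h @^-1` A) (F' A)) ->
    forall P : X -> Prop, {ae mu, forall x, P x} -> {ae mu, forall x, P (h x)}.
  move=> FG' hF P [N [mN N0 PN]].
  have N_0 : sub_ae N set0 by apply: filterS ((ae_nullP mu mN).2 N0).
  have F0 : sub_ae (F' set0) set0 by exact: (iso_set0 FG').
  have FN := sub_aeT (iso_sub FG' mN measurable0 N_0) F0.
  have hN := hF _ mN; rewrite /eq_ae /sub_ae in hN FN.
  apply: filterS2 hN FN => x hN FN; apply: contrapT => nP.
  by apply: FN; apply/hN; exact: PN.
have fg_id : {ae mu, forall x, g (f x) = x}.
  apply: (ae_eq_points (g := id));
      [exact: measurableT_comp|exact: measurable_id|].
  move=> A mA; rewrite comp_preimage.
  have mgA : measurable (g @^-1` A) by exact: measurable_pre.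
  have := fF _ mgA.
  have /eq_aeP[s1 s2] := gG _ mA.
  have t1 := iso_sub FG mgA (iso_measurable GF mA) s1.
  have t2 := iso_sub FG (iso_measurable GF mA) mgA s2.
  have := isoVK FG mA; rewrite /eq_ae /sub_ae in t1 t2 * => u v.
  by apply: filterS2 (filterI t1 t2) (filterI u v) => x [w1 w2] [u1 u2];
      split=> [/u2 /w1 /u1|/u1 /w2 /u2].
have gf_id : {ae mu, forall x, f (g x) = x}.
  apply: (ae_eq_points (g := id));
      [exact: measurableT_comp|exact: measurable_id|].
  move=> A mA; rewrite comp_preimage.
  have mfA : measurable (f @^-1` A) by exact: measurable_pre.
  have := gG _ mfA.
  have /eq_aeP[s1 s2] := fF _ mA.
  have t1 := iso_sub GF mfA (iso_measurable FG mA) s1.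
  have t2 := iso_sub GF (iso_measurable FG mA) mfA s2.
  have := isoVK GF mA; rewrite /eq_ae /sub_ae in t1 t2 * => u v.
  by apply: filterS2 (filterI t1 t2) (filterI u v) => x [w1 w2] [u1 u2];
      split=> [/u2 /w1 /u1|/u1 /w2 /u2].
pose N1 := ~` [set x | g (f x) = x]; pose N2 := ~` [set y | f (g y) = y].
have mN1 : measurable N1 by apply/measurableC/measurable_eq => //;
    exact: measurableT_comp.
have mN2 : measurable N2 by apply/measurableC/measurable_eq => //;
    exact: measurableT_comp.
have N10 : mu N1 = 0%E by apply/ae_nullP => //; apply: filterS fg_id =>
    x gfx; exact.
have N20 : mu N2 = 0%E by apply/ae_nullP => //; apply: filterS gf_id =>
    x fgx; exact.
have [H1 [K1 [mH1 mK1 HK1 [H1N K1H H1i K1i]]]] := hotel_shift mN1 N10.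
have [H2 [K2 [mH2 mK2 HK2 [H2N K2H H2i K2i]]]] := hotel_shift mN2 N20.
have H1g x : g (f (H1 x)) = H1 x by exact: contrapT (H1N x).
have H2f y : f (g (H2 y)) = H2 y by exact: contrapT (H2N y).
have SK : cancel (K2 \o f \o H1) (K1 \o g \o H2).
  move=> x /=; rewrite K2H ?H1g ?HK1//.
  by move=> /=; apply; rewrite /= H1g.
have SVK : cancel (K1 \o g \o H2) (K2 \o f \o H1).
  move=> y /=; rewrite K1H ?H2f ?HK2//.
  by move=> /=; apply; rewrite /= H2f.
have Sf : {ae mu, forall x, (K2 \o f \o H1) x = f x}.
  have fK2 := null_pre _ _ f FG fF _ K2i.
  by apply: filterS2 H1i fK2 => x /= -> ->.
have mS : measurable_fun setT (K2 \o f \o H1).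
  exact: (measurableT_comp (measurableT_comp mK2 mf) mH1).
have mSV : measurable_fun setT (K1 \o g \o H2).
  exact: (measurableT_comp (measurableT_comp mK1 mg) mH2).
have SF A : measurable A -> eq_ae ((K2 \o f \o H1) @^-1` A) (F A).
  move=> mA; have fA := fF _ mA; rewrite /eq_ae in fA *.
  by apply: filterS2 Sf fA => x Sx;
      rewrite [X in X <-> _]/preimage /= in Sx *; rewrite Sx.
suff Snull A : measurable A ->
    pushforward mu (K2 \o f \o H1) A = 0%E <-> mu A = 0%E.
  by exists (NsBij SK SVK mS mSV Snull).
move=> mA; rewrite /pushforward.
rewrite -(ae_nullP mu mA) -ae_nullP; last exact: measurable_pre.
split => [nSA|nA]; last first.
  have h := null_pre _ _ f FG fF _ nA.
  by apply: filterS2 Sf h => x; rewrite /preimage /= => ->.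
have FA : sub_ae (F A) set0.
  have := SF _ mA; rewrite /eq_ae /sub_ae => h.
  by apply: filterS2 nSA h => x nS h /h.
have := iso_subV FG (iso_measurable FG mA) measurable0 FA.
have := isoK FG mA; have := iso_set0 GF; rewrite /eq_ae /sub_ae => h1 h2 h3.
by apply: filterS3 h1 h2 h3 => x h1 h2 h3 /h2 /h3 /h1.
Qed.

End standard_space.

(** * Nonsingular transformations and their supports *)

Section nonsingular_maps.
Context d (X : measurableType d) (R : realType) (mu : probability X R).
Hypothesis standardX : standard_borel R X.
Implicit Types (f g : nsbij mu) (S T : nsAut mu) (A B : set X).

Definition supp f := [set x | f x <> x].

Lemma measurable_supp f : measurable (supp f).
Proof.
rewrite /supp (_ : [set x | _] = ~` [set x | f x = x])//.
apply/measurableC/(measurable_eq standardX); last exact: measurable_id.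
exact: measurable_nsfun.
Qed.

Lemma measurable_nsfun_pre f A : measurable A -> measurable (f @^-1` A).
Proof. exact/measurable_pre/measurable_nsfun. Qed.

Lemma measurable_iterz_pre f n A : measurable A ->
    measurable (iterz f n @^-1` A).
Proof. exact/measurable_pre/measurable_iterz. Qed.

Lemma nsfun_inj f : injective f. Proof. exact: can_inj (@nsfunK _ _ _ _ f). Qed.

Lemma nsAut_mulP S T (U : nsAut mu) : (S * T)%g = U ->
    {ae mu, forall x, S (T x) = U x}.
Proof. by move=> <-; apply: filterS (nsAut_mulE S T). Qed.

Lemma commuteP S T : (S * T = T * S)%g <-> {ae mu, forall x, S (T x) = T (S x)}.
Proof.
split=> [ST|ST].
  by apply: filterS2 (nsAut_mulE T S) (nsAut_mulP ST) => x <- ->.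
apply/nsAut_eqP.
by apply: filterS3 (nsAut_mulE S T) (nsAut_mulE T S) ST => x -> ->.
Qed.

Lemma commute_disjoint S T :
  {ae mu, forall x, S x <> x -> T x = x} -> (S * T = T * S)%g.
Proof.
move=> ST; apply/commuteP; apply: filterS3 ST (ae_nsfun S ST) (ae_nsfun T ST).
move=> x h hS hT; have [Sx|Sx] := pselect (S x = x); last first.
  by rewrite h// hS// => /nsfun_inj.
rewrite Sx; have [Tx|Tx] := pselect (T x = x); first by rewrite Tx.
by apply: contrapT => /hT /nsfun_inj.
Qed.

(** A point moved by f is separated from its image by an atom of a coding,
    and there are countably many atoms. *)
Lemma separation_step A (f : X -> X) : measurable_fun setT f ->
  measurable A -> nonnull mu A -> exists B,
  [/\ measurable B, nonnull mu B, B `<=` A & forall x, B x -> B (f x) ->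
      f x = x].
Proof.
move=> mf mA nA.
have mfix : measurable [set x | f x = x] by apply: (measurable_eq standardX).
have [nfix|nmove] := nonnull_split [set x | f x = x] nA.
  by exists (A `&` [set x | f x = x]); split => //;
      [exact: measurableI|move=> x [_]].
have [BB [RR [cBR BBm BBgen]]] := standard_borel_coding standardX.
have [||B BB_B nB] := nonnull_bigcup (D := BB)
    (B := fun B => [set x | ~ (B x <-> B (f x))]) _ nmove.
- exact: coding_countable cBR.
- apply: aeW => x [_ fx]; apply: contrapT => nB; apply: fx => /=.
  apply: (coding_sep cBR) => B BB_B; apply: contrapT => nb; apply: nB.
  by exists B => // h; apply: nb; split => /h.
have mB := BBm _ BB_B.
have [n1|n2] := nonnull_split B nB.
  exists (A `&` B `&` f @^-1` (~` B)); split.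
  - apply: measurableI; first exact: measurableI.
    by apply: measurable_pre => //; exact: measurableC.
  - apply: nonnullS n1; apply: aeW => x [[[Ax _] nBf] Bx]; split => //=.
    by move=> Bf; apply: nBf.
  - by move=> x [[]].
  - by move=> x [[_ _] nBf] [[_ /nBf]].
exists (A `&` ~` B `&` f @^-1` B); split.
- apply: measurableI; first by apply: measurableI => //; exact: measurableC.
  exact: measurable_pre.
- apply: nonnullS n2; apply: aeW => x [[[Ax _] nBf] nBx]; split => //=.
  by apply: contrapT => nBfx; apply: nBf.
- by move=> x [[]].
- by move=> x [_ Bf] [[_ nBf] _]; have := nBf Bf.
Qed.

Lemma separation A (fs : nat -> X ->
    X) n : (forall i, measurable_fun setT (fs i)) ->
  measurable A -> nonnull mu A -> exists B,
  [/\ measurable B, nonnull mu B, B `<=` A &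
    forall i x, (i < n)%N -> B x -> B (fs i x) -> fs i x = x].
Proof.
move=> mfs; elim: n A => [|n IH] A mA nA; first by exists A; split.
have [B [mB nB BA BP]] := IH A mA nA.
have [C [mC nC CB CP]] := separation_step (mfs n) mB nB.
exists C; split => //; first exact: subset_trans BA.
move=> i x; rewrite ltnS leq_eqVlt => /orP[/eqP -> Cx|ilt Cx Cf];
    first exact: CP.
by apply: BP => //; exact: CB.
Qed.

(** There are countably many pieces on which the bijection is a power of U,
    so it is nonsingular. *)
Lemma full_nsbij (U V : nsbij mu) (c c' : X -> int) :
  (forall n, measurable (c @^-1` [set n])) ->
  (forall n, measurable (c' @^-1` [set n])) ->
  cancel (fun x => iterz U (c x) x) (fun x => iterz V (c' x) x) ->
  cancel (fun x => iterz V (c' x) x) (fun x => iterz U (c x) x) ->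
  exists f, forall x, f x = iterz U (c x) x.
Proof.
move=> mc mc' fK gK.
have mf (W : nsbij mu) (b : X ->
    int) : (forall n, measurable (b @^-1` [set n])) ->
    measurable_fun setT (fun x => iterz W (b x) x).
  move=> mb _ A mA; rewrite setTI.
  rewrite (_ : _ @^-1` A = [set x | exists2 n, setT n &
      (b @^-1` [set n] `&` iterz W n @^-1` A) x]).
    apply: measurable_countableU => [|n _]; first exact: countableP.
    by apply: measurableI => //; exact: measurable_iterz_pre.
  apply/seteqP; split => x /=; first by move=> Ax; exists (b x).
  by move=> [n _ [-> ]].
have nf (W : nsbij mu) (b : X -> int) (P : X ->
    Prop) : {ae mu, forall x, P x} ->
    {ae mu, forall x, P (iterz W (b x) x)}.
  move=> aP; have : {ae mu, forall x, forall n, P (iterz W n x)}.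
    by apply: ae_forallz => n; exact: ae_iterz.
  by apply: filterS.
suff null A : measurable A -> pushforward mu (fun x => iterz U (c x) x) A = 0%E
    <-> mu A = 0%E.
  by exists (NsBij fK gK (mf _ _ mc) (mf _ _ mc') null).
move=> mA; rewrite /pushforward -(ae_nullP mu mA) -ae_nullP; last first.
  exact: (measurable_pre (mf _ _ mc)).
split=> [/(nf V c')|/(nf U c)//]; apply: filterS => x; rewrite /preimage /=.
by rewrite gK.
Qed.

End nonsingular_maps.

Lemma finite_int_ball (k : int) : finite_set [set m : int | - k <= m <= k].
Proof.
have sub : [set m : int | - k <= m <= k] `<=`
    [set (Posz i - k)%R | i in `I_(absz (k + k)%R).+1].
  move=> m /andP[km mk]; exists (absz (m + k)%R); rewrite /=; lia.
by apply: (sub_finite_set sub); exact/finite_image/finite_II.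
Qed.

Lemma in_symZN_bounded (F G : int -> int) (k : int) : cancel F G ->
    cancel G F ->
  (forall m, - k <= F m - m <= k) -> in_symZN F.
Proof.
move=> FK GK Fk.
have fin : finite_set ((F @` natZ) `+` natZ).
  apply: sub_finite_set (finite_int_ball k); rewrite setY_def.
  move=> n [[[m Nm <-] nN]|[Nn nN]] /=; rewrite /natZ /= in nN *.
    have := Fk m; rewrite /natZ /= in Nm; lia.
  have Gn : ~ 0 <= G n by move=> h; apply: nN; exists (G n).
  have := Fk (G n); rewrite GK /natZ /= in Nn *; lia.
by exists (SymZN FK GK fin).
Qed.

(** * Elements of the commensurating full group *)

Section commensurating_group.
Context d (X : measurableType d) (R : realType) (mu : probability X R).
Hypothesis standardX : standard_borel R X.
Implicit Types (S T : nsAut mu) (A B : set X).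

Lemma iterz0 (f : nsbij mu) x : iterz f 0 x = x. Proof. by []. Qed.

Lemma iterzK (f : nsbij mu) n x : iterz f (- n) (iterz f n x) = x.
Proof. by rewrite -iterzD addNr. Qed.

Lemma iterzNK (f : nsbij mu) n x : iterz f n (iterz f (- n) x) = x.
Proof. by rewrite -iterzD addrN. Qed.

Lemma measurable_cst_set (P : Prop) : measurable [set _ : X | P].
Proof.
have [p|p] := pselect P.
  by rewrite (_ : [set _ | _] = setT)//; apply/seteqP; split.
by rewrite (_ : [set _ | _] = set0)//; apply/seteqP; split.
Qed.

Section ergodic.
Variable T : nsAut mu.
Hypothesis atomless_mu : atomless mu.
Hypothesis ergodicT : ergodic T.

Lemma ergodic_conull A : measurable A -> nonnull mu A ->
  {ae mu, forall x, A (T x) <-> A x} -> {ae mu, forall x, A x}.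
Proof.
move=> mA nA invA; have [A0|A0] := ergodicT mA invA.
  by have := (ae_nullP mu mA).2 A0.
have := (ae_nullP mu (measurableC mA)).2 A0; apply: filterS => x.
exact: contrapT.
Qed.

(** The orbit of a nonnull set is conull, so a nonnull set W that meets
    almost every orbit at most once could not be cut into two nonnull pieces. *)
Lemma recurrence W : measurable W -> nonnull mu W ->
  exists n, nonnull mu [set x | [/\ W x, W (iterz T n x) & iterz T n x <> x]].
Proof.
move=> mW nW; apply: contrapT => nex.
have once : {ae mu, forall x, forall n, ~ [/\ W x, W (iterz T n x) & iterz T n
    x <> x]}.
  by apply: ae_forallz => n; apply: contrapT => nn; apply: nex; exists n.
have [V [mV VW /andP[V0 VltW]]] := atomless_mu mW ((nonnullP mu mW).1 nW).
pose O := [set x | exists2 n, setT n & V (iterz T n x)].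
have mO : measurable O.
  apply: measurable_countableU; first exact: countableP.
  by move=> n _; exact: measurable_iterz_pre.
have nV : nonnull mu V by exact/nonnullP.
have nO : nonnull mu O by apply: nonnullS nV; apply: aeW => x Vx; exists 0.
have invO : {ae mu, forall x, O (T x) <-> O x}.
  apply: aeW => x; split=> -[n _ Vn].
    by exists (n + 1) => //; rewrite iterzD.
  by exists (n - 1) => //; rewrite -[T x]/(iterz T 1 x) -iterzD subrK.
have {invO}aeO := ergodic_conull mO nO invO.
have WV : {ae mu, forall x, W x -> V x}.
  apply: filterS2 aeO once => x [n _ Vn] nx Wx.
  by apply: contrapT => nVx; apply: (nx n); split; [|exact: VW|move=> e;
      apply: nVx; rewrite -e].
move: VltW; rewrite ltNge => /negP; apply.
have mD : measurable (W `\` V) by exact: measurableD.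
have D0 : mu (W `\` V) = 0%E.
  by apply/ae_nullP => //; apply: filterS WV => x WVx [/WVx].
rewrite -[leRHS]adde0 -D0 -measureU//; last by rewrite setDIK.
by rewrite setDUK.
Qed.

(** If T had period k + 1 on a nonnull set, hence almost everywhere, a
    nonnull set separated from its first k images would meet almost every
    orbit at most once, against [recurrence]. *)
Lemma ergodic_aperiodic : aperiodic T.
Proof.
suff period (k : nat) : {ae mu, forall x, iterz T k.+1%:Z x <> x}.
  apply: ae_forallz => -[[|k]|k]; first by apply: aeW.
    by apply: filterS (period k) => x kx _; exact: kx.
  apply: filterS (period k) => x kx _ e; apply: kx.
  by rewrite -[in LHS]e -[Negz k]/(- k.+1%:Z) iterzNK.
pose P := [set x | iterz T k.+1%:Z x = x].
have mP : measurable P.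
  by apply: (measurable_eq standardX);
      [exact: measurable_iterz|exact: measurable_id].
apply: contrapT => nP.
have {nP}nP : nonnull mu P by [].
have aeP : {ae mu, forall x, P x}.
  apply: ergodic_conull => //; apply: aeW => x.
  suff : iterz T k.+1%:Z (T x) = T x <-> iterz T k.+1%:Z x = x by [].
  have -> : iterz T k.+1%:Z (T x) = T (iterz T k.+1%:Z x).
    by rewrite -[T x]/(iterz T 1 x) -iterzD -iterzS.
  by split=> [/nsfun_inj|/(congr1 T)].
have [B [mB nB _ BP]] := separation standardX (fs := fun i => iterz T i%:Z) k.+1
  (fun i => measurable_iterz T i%:Z) measurableT (@nonnullT _ _ _ mu).
have [n nn] := recurrence mB nB.
have [x [[Bx Bn nx] Px]] := nonnull_ae nn aeP.
(* T^n depends on n modulo k + 1 only, which reduces recurrence to the powers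
   separated by B. *)
have period (q : int) y : P y -> iterz T (q * k.+1%:Z) y = y.
  have pp (y' : X) (m : nat) : P y' -> iterz T (m%:Z * k.+1%:Z) y' = y'.
    move=> Py; elim: m => [|m IH]; first by rewrite mul0r.
    by rewrite intS mulrDl mul1r iterzD IH.
  move=> Py; case: q => m; first exact: pp.
  rewrite NegzE mulNr -[in LHS](pp y m.+1 Py) iterzK//.
apply: nx.
have nk : n = (n %% k.+1%:Z)%Z + (n %/ k.+1%:Z)%Z * k.+1%:Z.
  by rewrite addrC; exact: divz_eq.
have red : iterz T n x = iterz T (n %% k.+1%:Z)%Z x by rewrite {1}nk iterzD
    period.
have [i iE ik] : exists2 i : nat, (n %% k.+1%:Z)%Z = i%:Z & (i < k.+1)%N.
  have := modz_ge0 n (_ : k.+1%:Z != 0); have := ltz_pmod n (_ : 0 < k.+1%:Z).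
  move=> /(_ isT) h1 /(_ isT) h2; exists `|(n %% k.+1%:Z)%Z|%N; lia.
rewrite red iE; apply: BP => //; by rewrite -iE -red.
Qed.

End ergodic.

Lemma com_full_group_self T : com_full_group T T.
Proof.
split; first by apply: aeW => x; exists 1.
exists (fun=> 1).
  split; last exact: aeW.
  by move=> n; rewrite preimage_cst; case: ifP.
apply: aeW => x; apply: (@in_symZN_bounded _ (fun m => m - 1) 1).
- by move=> m; rewrite /orbit_map addrK.
- by move=> m; rewrite /orbit_map subrK.
- by move=> m; rewrite /orbit_map; lia.
Qed.

(** The involution that exchanges B and T^n B; it moves points by at most |n|
    steps along their orbit. *)
Lemma swap_exists T (n : int) B : measurable B ->
  (forall x, B x -> ~ B (iterz T n x)) ->
  exists S : nsAut mu, [/\ com_full_group T S, (S * S)%g = 1%g,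
    {ae mu, forall x, B x -> S x = iterz T n x} &
    {ae mu, forall x, S x <> x -> B x \/ B (iterz T (- n) x)}].
Proof.
move=> mB Bn.
pose c x : int := if `[< B x >] then n else if `[< B (iterz T (- n) x) >] then
    - n else 0.
have cB x : B x -> c x = n by move=> Bx; rewrite /c asboolT.
have cB' x : B (iterz T (- n) x) -> c x = - n.
  move=> Bx; rewrite /c asboolF ?asboolT// => Bx'.
  by apply: (Bn _ Bx); rewrite iterzNK.
have c0 x : ~ B x -> ~ B (iterz T (- n) x) -> c x = 0.
  by move=> nB nB'; rewrite /c !asboolF.
have cases x : [\/ B x, B (iterz T (- n) x) | ~ B x /\ ~ B (iterz T (- n) x)].
  have [h1|h1] := pselect (B x); first by constructor 1.
  by have [h2|h2] := pselect (B (iterz T (- n) x));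
      [constructor 2|constructor 3].
(* The map x |-> T^(c x) x is an involution: c changes sign along it. *)
have cc x : c (iterz T (c x) x) = - c x.
  case: (cases x) => [Bx|Bx|[n1 n2]].
  - by rewrite (cB x Bx) cB' ?iterzK.
  - by rewrite (cB' x Bx) (cB _ Bx) opprK.
  - by rewrite (c0 x n1 n2) iterz0 (c0 x n1 n2) oppr0.
have mc m : measurable (c @^-1` [set m]).
  have mB' : measurable (iterz T (- n) @^-1` B) by exact: measurable_iterz_pre.
  rewrite (_ : _ @^-1` _ = (B `&` [set _ | n = m]) `|`
    ((iterz T (- n) @^-1` B) `&` [set _ | - n = m]) `|`
    ((~` B `&` ~` (iterz T (- n) @^-1` B)) `&` [set _ | 0 = m])).
    apply: measurableU; first apply: measurableU.
    - by apply: measurableI => //; exact: measurable_cst_set.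
    - by apply: measurableI => //; exact: measurable_cst_set.
    - apply: measurableI; last exact: measurable_cst_set.
      by apply: measurableI; exact: measurableC.
  apply/seteqP; split => x /=.
    move=> <-; case: (cases x) => [Bx|Bx|[n1 n2]].
    - by left; left; rewrite cB.
    - by left; right; rewrite (cB' _ Bx).
    - by right; rewrite c0.
  by move=> [[[Bx <-]|[Bx <-]]|[[n1 n2] <-]]; [exact: cB|exact: cB'|exact: c0].
have fK : cancel (fun x => iterz T (c x) x) (fun x => iterz T (c x) x).
  by move=> x; rewrite cc iterzK.
have [f fE] := full_nsbij mc mc fK fK.
pose S : nsAut mu := \pi_(nsAut mu) f; exists S.
have SE : {ae mu, forall x, S x = iterz T (c x) x}.
  by apply: filterS (nsrep_pi f) => x ->; exact: fE.
split.
- split; first by apply: filterS SE => x ->; exists (c x).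
  exists c => //; apply: aeW => x.
  have oK : cancel (orbit_map T c x) (orbit_map T c x).
    move=> m; rewrite /orbit_map [m + _]addrC iterzD cc; lia.
  apply: (in_symZN_bounded (k := `|n|) oK oK) => m; rewrite /orbit_map.
  by case: (cases (iterz T m x)) => [h|h|[h1 h2]];
      [rewrite cB//|rewrite (cB' _ h)|rewrite c0//]; lia.
- have SSE := ae_nsfun S SE.
  apply/nsAut_eqP; move: (nsAut_mulE S S) => mE.
  apply: filterS2 (filterI SE SSE) (filterI mE (nsAut_oneE mu)) =>
      x [e1 e2] [-> ->].
  by rewrite e2 e1 fK.
- by apply: filterS SE => x -> Bx; rewrite cB.
- apply: filterS SE => x ->; case: (cases x) => [h|h|[h1 h2]];
      [by left|by right|].
  by rewrite c0.
Qed.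

(** By [recurrence] some power of T moves a nonnull subset of A inside A. *)
Lemma many_involutions T A : atomless mu -> ergodic T -> measurable A ->
  nonnull mu A -> exists S : nsAut mu, [/\ com_full_group T S, (S * S)%g = 1%g,
    nonnull mu (supp S) & {ae mu, forall x, S x <> x -> A x}].
Proof.
move=> atomless_mu ergodicT mA nA.
have [n nW] := recurrence atomless_mu ergodicT mA nA.
have mfix : measurable [set x | iterz T n x = x].
  by apply: (measurable_eq standardX);
      [exact: measurable_iterz|exact: measurable_id].
have mW : measurable [set x | [/\ A x, A (iterz T n x) & iterz T n x <> x]].
  rewrite (_ : [set x | _] = A `&` iterz T n @^-1` A `&` ~` [set x | iterz T n
      x = x]).
    apply: measurableI; last exact: measurableC.
    by apply: measurableI => //; exact: measurable_iterz_pre.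
  by apply/seteqP; split => x /=; [case|case=> -[]].
have [B [mB nB BW BP]] := separation_step standardX (measurable_iterz T n) mW
    nW.
have [|S [cS SS SB Ss]] := @swap_exists T n B mB.
  by move=> x Bx /(BP x Bx); have [] := BW _ Bx.
exists S; split => //.
  apply: nonnullS nB; apply: filterS SB => x Sx Bx; rewrite /supp /= Sx//.
  by have [] := BW _ Bx.
apply: filterS Ss => x Ss Sx; have [/BW[]//|/BW[]] := Ss Sx.
by rewrite iterzNK.
Qed.

(** The invariant set A is first made exactly invariant by keeping the points
    whose whole orbit under S lies in A. On each T-orbit the restriction
    carries fewer points across the origin than S. *)
Lemma restriction_exists T S A : com_full_group T S -> measurable A ->
  {ae mu, forall x, A (S x) <-> A x} ->
  exists S' : nsAut mu, com_full_group T S' /\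
    {ae mu, forall x, (A x -> S' x = S x) /\ (~ A x -> S' x = x)}.
Proof.
move=> [_ [c [mc cS] cN]] mA invA.
pose C := [set x | forall n, setT n -> A (iterz S n x)].
have mC : measurable C.
  apply: measurable_countableI; first exact: countableP.
  by move=> n _; exact: measurable_iterz_pre.
have CS x : C (S x) <-> C x.
  split=> Cx n _.
    by have := Cx (n - 1) I; rewrite -[S x]/(iterz S 1 x) -iterzD subrK.
  by have := Cx (n + 1) I; rewrite iterzD.
have CA : {ae mu, forall x, C x <-> A x}.
  have : {ae mu, forall x, forall n, A (iterz S n x) <-> A x}.
    have invN : {ae mu, forall x, forall n, A (S (iterz S n x)) <-> A (iterz S
        n x)}.
      by apply: ae_forallz => n; exact: (ae_iterz S n invA).
    apply: filterS invN => x invx n; elim/int_rect: n => [//|m IH|m IH].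
      by rewrite intS addrC iterzS invx.
    rewrite -IH -(invx (- m.+1%:Z)) -iterzS.
    by rewrite (_ : - m.+1%:Z + 1 = - m%:Z)//; lia.
  by apply: filterS => x Ax; split=> [/(_ 0 I)//|Ax' n _]; apply/Ax.
pose b (s : int) x : int := if `[< C x >] then s else 0.
have mb s n : measurable (b s @^-1` [set n]).
  rewrite (_ : _ @^-1` _ = (C `&` [set _ | s = n]) `|` (~` C `&` [set _ | 0 =
      n])).
    apply: measurableU; apply: measurableI => //; try exact: measurable_cst_set.
    exact: measurableC.
  apply/seteqP; split => x; rewrite /b /=.
    by case: asboolP => Cx <-; [left|right].
  by move=> [[Cx <-]|[Cx <-]]; [rewrite asboolT|rewrite asboolF].
have bK s : cancel (fun x => iterz S (b s x) x) (fun x =>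
    iterz S (b (- s) x) x).
  move=> x; have bT y : C y -> forall s', b s' y = s' by move=> Cy s';
      rewrite /b asboolT.
  have bF y : ~ C y -> forall s', b s' y = 0 by move=> Cy s';
      rewrite /b asboolF.
  have [Cx|Cx] := pselect (C x); last by rewrite (bF x Cx) iterz0 (bF x Cx).
  by rewrite (bT x Cx) bT ?iterzK// => n _; rewrite -iterzD; exact: Cx.
have bK' : cancel (fun x => iterz S (b (- 1) x) x) (fun x => iterz S (b 1 x) x).
  by have := bK (- 1); rewrite opprK.
have [f fE] := full_nsbij (mb 1) (mb (- 1)) (bK 1) bK'.
have fC x : C x -> f x = S x by move=> Cx; rewrite fE /b asboolT.
have fnC x : ~ C x -> f x = x by move=> Cx; rewrite fE /b asboolF.
pose S' : nsAut mu := \pi_(nsAut mu) f; exists S'; split; last first.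
  by apply: filterS2 (nsrep_pi f) CA => x -> CAx; split=> Ax;
      [apply: fC|apply: fnC]; rewrite CAx.
pose c' x : int := if `[< C x >] then c x else 0.
have SE : {ae mu, forall x, S' x = iterz T (c' x) x}.
  apply: filterS2 (nsrep_pi f) cS => x -> Sx; rewrite /c'.
  by case: asboolP => Cx; [rewrite fC|rewrite fnC].
split; first by apply: filterS SE => x ->; exists (c' x).
exists c'.
  split=> // n.
  rewrite (_ : _ @^-1` _ = (C `&` c @^-1` [set n]) `|` (~` C `&` [set _ | 0 =
      n])).
    apply: measurableU; apply: measurableI => //; first exact: measurableC.
    exact: measurable_cst_set.
  apply/seteqP; split => x; rewrite /c' /=.
    by case: asboolP => Cx <-; [left|right].
  by move=> [[Cx cx]|[Cx <-]]; [rewrite asboolT|rewrite asboolF].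
have cT : {ae mu, forall x, forall n, S (iterz T n x) =
    iterz T (c (iterz T n x)) (iterz T n x)}.
  by apply: ae_forallz => n; exact: ae_iterz cS.
apply: filterS2 cT cN => x e [s sE].
have sT m : iterz T (s m) x = S (iterz T m x).
  by rewrite -sE /orbit_map addrC iterzD -e.
pose D m := `[< C (iterz T m x) >].
have Ds m : D (s m) = D m by rewrite /D sT; apply/asboolP/asboolP => /CS.
have Di m : D (symi s m) = D m by rewrite -Ds symiK.
have oE m : orbit_map T c' x m = if D m then s m else m.
  rewrite /orbit_map /c' /D; case: asboolP => _; last by rewrite addr0.
  by rewrite -sE.
have FK : cancel (orbit_map T c' x) (fun m => if D m then symi s m else m).
  by move=> m; rewrite oE; case Dm: (D m) => /=; rewrite ?Ds ?Dm ?symfK.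
have GK : cancel (fun m => if D m then symi s m else m) (orbit_map T c' x).
  by move=> m; rewrite oE; case Dm: (D m) => /=; rewrite ?Di ?Dm ?symiK.
have fin : finite_set ((orbit_map T c' x @` natZ) `+` natZ).
  apply: sub_finite_set (symf_commN s); rewrite !setY_def.
  move=> m [[[k Nk <-] nN]|[Nm nm]].
    rewrite oE in nN *; case: ifP nN => // Dk nN.
    by left; split => //; exists k.
  right; split => // -[k Nk ks]; apply: nm.
  have [Dm|Dm] := boolP (D m); last first.
    by exists m; rewrite // oE (negbTE Dm).
  have Dk : D k by rewrite -Ds ks.
  by exists k; rewrite // oE Dk.
by exists (SymZN FK GK fin).
Qed.

End commensurating_group.

(** * Supports in terms of the group law *)

Section centralisers.
Local Open Scope group_scope.

Definition cent (G : groupType) (A : set G) : set G :=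
  [set f | forall g, A g -> f * g = g * f].

(** For an involution p of a commensurating full group, these elements live
    on the support of p, and the restrictions of p to its invariant sets are
    among them. *)
Definition self_commuting (G : groupType) (p : G) : set G :=
  [set f | f * p = p * f /\
    forall u, u * p = p * u -> f * (u * f * u^-1) = (u * f * u^-1) * f].

(** For an involution p of a commensurating full group, the squares that
    occur here live off the support of p, and the localiser consists of the
    elements supported in the support of p ([localiser_supp]). *)
Definition localiser (G : groupType) (p : G) : set G :=
  cent [set f * f | f in cent (self_commuting p)].

Lemma morph_one (G H : groupType) (q : G -> H) :
  {morph q : x y / x * y} -> q 1 = 1.
Proof. by move=> qM; apply: (@mulgI _ (q 1)); rewrite -qM !mulg1. Qed.

Lemma morph_inv (G H : groupType) (q : G -> H) :
  {morph q : x y / x * y} -> {morph q : x / x^-1}.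
Proof. by move=> qM x; apply/esym/mulg1_eq; rewrite -qM mulgV morph_one. Qed.

Lemma localiser_iso (G H : groupType) (q : G -> H) (r : H -> G) p f :
  {morph q : x y / x * y} -> {morph r : x y / x * y} ->
  cancel q r -> cancel r q -> localiser p f -> localiser (q p) (q f).
Proof.
move=> qM rM qK rK pf; have qV := morph_inv qM; have rV := morph_inv rM.
have self a : self_commuting (q p) a -> self_commuting p (r a).
  move=> [ap aU]; split; first by rewrite -{1}(qK p) -rM ap rM qK.
  move=> u up; have := aU (q u).
  by rewrite -!qM up => /(_ erefl) /(congr1 r); rewrite !rM !rV !qK.
have self' a : self_commuting p a -> self_commuting (q p) (q a).
  move=> [ap aU]; split; first by rewrite -!qM ap.
  move=> u up; have := aU (r u).
  by rewrite -{1 2}(qK p) -!rM up => /(_ erefl) /(congr1 q);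
      rewrite !qM !qV !rK.
move=> _ [g cg <-]; apply: (can_inj rK); rewrite !rM qK; apply: pf.
exists (r g) => // v /self' sv; have := cg _ sv.
by move=> /(congr1 r); rewrite !rM qK.
Qed.

End centralisers.

Section support_of_involutions.
Context d (X : measurableType d) (R : realType) (mu : probability X R).
Hypothesis standardX : standard_borel R X.
Hypothesis atomless_mu : atomless mu.
Variable T : nsAut mu.
Hypothesis ergodicT : ergodic T.

Local Notation G := (comfg T).
Implicit Types (f g u p : G) (A B C : set X).

Definition act g : nsbij mu := nsrep (val g).

Lemma actM g h : {ae mu, forall x, act (g * h)%g x = act g (act h x)}.
Proof. exact: nsAut_mulE. Qed.

Lemma actV g : {ae mu, forall x, act (g^-1)%g x = nsinv (act g) x}.
Proof. exact: nsAut_invE. Qed.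

Lemma act1 : {ae mu, forall x, act (1%g : G) x = x}.
Proof. exact: nsAut_oneE. Qed.

Lemma act_inj f g : {ae mu, forall x, act f x = act g x} -> f = g.
Proof. by move=> fg; apply/val_inj/nsAut_eqP. Qed.

Lemma act_commuteP f g :
  (f * g = g * f)%g <-> {ae mu, forall x, act f (act g x) = act g (act f x)}.
Proof.
split=> [fg|fg]; first by apply/commuteP; have := congr1 val fg.
by apply: val_inj; apply/commuteP.
Qed.

Lemma act_disjoint f g : {ae mu, forall x, act f x <> x -> act g x = x} ->
  (f * g = g * f)%g.
Proof. by move=> fg; apply: val_inj; exact: commute_disjoint. Qed.

Lemma actJ u f : {ae mu, forall x, act (u * f * u^-1)%g x = act u (act f
    (nsinv (act u) x))}.
Proof.
have h1 := actM (u * f)%g (u^-1)%g; have h2 :=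
    ae_nsfun (act (u^-1)%g) (actM u f).
by apply: filterS3 h1 h2 (actV u) => x -> -> ->.
Qed.

Lemma act_involution A : measurable A -> nonnull mu A ->
  exists g, [/\ (g * g = 1)%g, nonnull mu (supp (act g)) &
    {ae mu, forall x, act g x <> x -> A x}].
Proof.
move=> mA nA.
have [S [cS SS nS SA]] := many_involutions standardX atomless_mu ergodicT mA nA.
by exists (Sub S (mem_set cS)); split => //; exact: val_inj.
Qed.

Lemma act_involutionE g : (g * g = 1)%g ->
    {ae mu, forall x, act g (act g x) = x}.
Proof. by move=> gg; apply: filterS2 (actM g g) act1 => x <-; rewrite gg. Qed.

(** If the involution b moves B off itself and the involution c is supported
    in B, then b * c has order four. *)
Lemma act_noninvolutive A : measurable A -> nonnull mu A ->
  exists u, nonnull mu [set x | act u (act u x) <> x] /\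
    {ae mu, forall x, act u x <> x -> A x}.
Proof.
move=> mA nA; have [b [bb nb bA]] := act_involution mA nA.
have mb : measurable (A `&` supp (act b)).
  by apply: measurableI => //; exact: measurable_supp.
have {}nb : nonnull mu (A `&` supp (act b)).
  by apply: nonnullS nb; apply: filterS bA => x bA bx; split => //; exact: bA.
have [B [mB nB BA BP]] := separation_step standardX (measurable_nsfun (act b))
    mb nb.
have [c [cc nc cB]] := act_involution mB nB.
exists (b * c)%g; split.
  apply: nonnullS nc.
  have h1 := actM b c; have h1' := ae_nsfun (act c) (ae_nsfun (act b) h1).
  have h2 := act_involutionE bb; have h2' := ae_nsfun (act c) h2.
  have cB1 := ae_nsfun (act c) cB; have cB2 :=
      ae_nsfun (act c) (ae_nsfun (act b) cB).
  apply: filterS3 (filterI h1 h1') (filterI h2' cB1) cB2 =>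
      x [e1 e2] [e3 c1] c2 cx /=.
  have Bcx : B (act c x) by apply: c1 => /nsfun_inj.
  have nB' : ~ B (act b (act c x)) by move=> /(BP _ Bcx); have [] := BA _ Bcx.
  have e : act c (act b (act c x)) = act b (act c x).
    by apply: contrapT => /c2.
  by rewrite e1 e2 e e3.
apply: filterS3 (actM b c) cB bA => x -> cB' bA'.
have [Bx|nBx] := pselect (B x); first by have [] := BA _ Bx.
have -> : act c x = x by apply: contrapT => /cB'.
exact: bA'.
Qed.

(** If f moved a set B off itself outside the support of p, an element u
    supported in B would commute with p; then f would commute with its
    conjugate by u, which forces u to be an involution. But u can be chosen
    not to be one. *)
Lemma self_commuting_supp p f : self_commuting p f ->
  {ae mu, forall x, act f x <> x -> act p x <> x}.
Proof.
move=> [fp fU]; apply: contrapT => nsub.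
pose A := supp (act f) `&` ~` supp (act p).
have mA : measurable A.
  by apply: measurableI; [|apply: measurableC]; exact: measurable_supp.
have nA : nonnull mu A.
  move=> h; apply: nsub; apply: filterS h => x nAx fx px.
  by apply: nAx; split => //= /(_ px).
pose fs i := if i is 0%N then act f : X -> X else act f \o act f.
have mfs i : measurable_fun setT (fs i).
  case: i => [|i]; first exact: measurable_nsfun.
  by apply: measurableT_comp; exact: measurable_nsfun.
(* f maps the points of B out of B, and f^2 maps them out of B or to
   themselves. *)
have [B [mB nB BA BP]] := separation standardX 2 mfs mA nA.
have Bf x : B x -> ~ B (act f x).
  by move=> Bx /(BP 0%N x isT Bx); have [] := BA _ Bx.
have Bff x : B x -> B (act f (act f x)) ->
    act f (act f x) = x by exact: (BP 1%N x isT).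
have [u [nu uB]] := act_noninvolutive mB nB.
have up : (u * p = p * u)%g.
  apply: act_disjoint; apply: filterS uB => x uB /uB /BA[_ nsp].
  exact: contrapT.
have /act_commuteP := fU u up.
have cJ := actJ u f; have cJ' := ae_nsfun (act f) cJ.
have uB_f := ae_nsfun (act f) uB; have uB_ff := ae_nsfun (act f) uB_f.
have uB_u := ae_nsfun (act u) uB; have uB_z := ae_nsfun (nsbij_inv (act u)) uB.
have uB_fz := ae_nsfun (nsbij_inv (act u)) uB_f => ec.
have [x [uux]] := nonnull_ae nu
  (filterI (filterI (filterI ec cJ) cJ') (filterI (filterI (filterI uB uB_f)
      uB_ff)
   (filterI (filterI uB_u uB_z) uB_fz))).
move=> [[[e e1] e2] [[[b1 b2] b3] [[b4 b5] b6]]].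
have ux : act u x <> x by move=> ux; apply: uux; rewrite !ux.
pose z := nsinv (act u) x.
have uz : act u z = x by exact: nsinvK.
have zx : z <> x by move=> zx; apply: ux; rewrite -{1}zx.
have Bx := b1 ux.
have Bux : B (act u x) by apply: b4 => /nsfun_inj.
have Bz : B z by apply: b5 => /=; rewrite uz => /esym.
have ufz : act u (act f z) = act f z by apply: contrapT => /b6; exact: Bf.
have ufx : act u (act f x) = act f x by apply: contrapT => /b2; exact: Bf.
have ufx' : nsinv (act u) (act f x) = act f x by rewrite -{1}ufx nsfunK.
rewrite e1 e2 ufx' -/z ufz in e.
have [Bffx|Bffx] := pselect (B (act f (act f x))).
  rewrite (Bff _ Bx Bffx) in e; rewrite -e in Bux.
  by apply: uux; rewrite -e (Bff _ Bz Bux).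
have uffx : act u (act f (act f x)) = act f (act f x) by apply: contrapT => /b3.
by rewrite uffx in e; apply: zx; apply: (nsfun_inj (f := act f));
    exact: nsfun_inj e.
Qed.

Lemma restrictions_commute p a b C D :
  {ae mu, forall x, C (act p x) <-> C x} ->
      {ae mu, forall x, D (act p x) <-> D x} ->
  {ae mu, forall x, (C x -> act a x = act p x) /\ (~ C x -> act a x = x)} ->
  {ae mu, forall x, (D x -> act b x = act p x) /\ (~ D x -> act b x = x)} ->
  (a * b = b * a)%g.
Proof.
move=> Cp Dp aC bD; apply/act_commuteP.
have aC' := ae_nsfun (act p) aC; have bD' := ae_nsfun (act p) bD.
apply: filterS3 (filterI Cp Dp) (filterI aC bD) (filterI aC' bD').
move=> x [cp dp] [[a1 a2] [b1 b2]] [[a3 a4] [b3 b4]].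
have [Cx|Cx] := pselect (C x); have [Dx|Dx] := pselect (D x).
- by rewrite a1// b1// a3 ?b3//; [apply/dp|apply/cp].
- by rewrite a1// b2// a1// b4// => /dp.
- by rewrite a2// b1// a4// => /cp.
- by rewrite a2// b2// a2.
Qed.

(** An element that commutes with p conjugates a restriction of p to another
    one, and restrictions of p commute with each other. *)
Lemma restriction_self_commuting p C : measurable C ->
  {ae mu, forall x, C (act p x) <-> C x} ->
  exists a, self_commuting p a /\
    {ae mu, forall x, (C x -> act a x = act p x) /\ (~ C x -> act a x = x)}.
Proof.
move=> mC Cp.
have [S [cS SC]] := restriction_exists (set_mem (valP p)) mC Cp.
pose a : G := Sub S (mem_set cS); exists a; split => //.
split=> [|u up].
  apply: (@restrictions_commute p a p C setT) => //; apply: aeW => x //.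
  by split => // /(_ I).
apply: (@restrictions_commute p a _ C (nsinv (act u) @^-1` C)) => //.
  have /act_commuteP upE := up.
  have upE' := ae_nsfun (nsbij_inv (act u)) upE.
  have Cp' := ae_nsfun (nsbij_inv (act u)) Cp.
  apply: filterS2 upE' Cp' => x; rewrite /preimage /= nsinvK => e <-.
  by rewrite -e nsfunK.
have /act_commuteP upE := up.
have upE' := ae_nsfun (nsbij_inv (act u)) upE.
have aC' := ae_nsfun (nsbij_inv (act u)) (SC : {ae mu, forall x, (C x ->
    act a x = act p x) /\ (~ C x -> act a x = x)}).
apply: filterS3 upE' aC' (actJ u a) => x; rewrite /preimage /= nsinvK =>
    e [a1 a2] ->.
by split=> Cx; [rewrite a1|rewrite a2// nsinvK].
Qed.

(** Commuting with the restriction of p to the union of B and p B, for all B,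
    forces f x to be x or p x at almost every x in the support of p. *)
Lemma cent_self_commuting p f : (p * p = 1)%g -> cent (self_commuting p) f ->
  {ae mu, forall x, act p x <> x -> act f (act f x) = x}.
Proof.
move=> pp fV; apply: contrapT => nff.
have fp : (f * p = p * f)%g.
  have [a [/fV fa aE]] := restriction_self_commuting measurableT
    (aeW mu (fun x => iff_refl True) : {ae mu, forall x, setT (act p x) <->
        setT x}).
  suff <- : a = p by [].
  by apply: act_inj; apply: filterS aE => x [/(_ I)].
have ppE := act_involutionE pp.
have /act_commuteP fpE := fp.
have mp : measurable (supp (act p)) by exact: measurable_supp.
have mfix (h : X -> X) : measurable_fun setT h -> measurable [set x | h x <> x].
  move=> mh; rewrite (_ : [set x | _] = ~` [set x | h x = x])//.
  by apply/measurableC/(measurable_eq standardX) => //; exact: measurable_id.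
have mf := measurable_nsfun (act f).
have mpf : measurable_fun setT (act p \o act f).
  by apply: measurableT_comp; [exact: measurable_nsfun|].
pose A := supp (act p) `&` ([set x | act f x <> x] `&` [set x | (act p \o act
    f) x <> x]).
have mA : measurable A.
  by apply: measurableI => //; apply: measurableI; exact: mfix.
have nA : nonnull mu A.
  move=> h; apply: nff; have fpE' := ae_nsfun (act f) fpE.
  apply: filterS3 h ppE fpE => x nAx ppx fpx px.
  have [fx|fx] := pselect (act f x = x); first by rewrite !fx.
  have [pfx|pfx] := pselect (act p (act f x) = x); last by exfalso; apply: nAx.
  have e : act f x = act p x by apply: (nsfun_inj (f := act p));
      rewrite pfx ppx.
  by rewrite e fpx e ppx.
pose fs i := if i is 0%N then act f : X -> X else act p \o act f.
have mfs i : measurable_fun setT (fs i) by case: i.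
have [B [mB nB BA BP]] := separation standardX 2 mfs mA nA.
have Bf x : B x -> ~ B (act f x).
  by move=> Bx /(BP 0%N x isT Bx); have [_ [+ _]] := BA _ Bx.
have Bpf x : B x -> ~ B (act p (act f x)).
  by move=> Bx /(BP 1%N x isT Bx); have [_ [_ +]] := BA _ Bx.
pose C := B `|` act p @^-1` B.
have mC : measurable C by apply: measurableU => //; exact: measurable_nsfun_pre.
have Cp : {ae mu, forall x, C (act p x) <-> C x}.
  apply: filterS ppE => x ppx; rewrite /C /preimage /setU /= ppx.
  by split=> -[]; [right|left|right|left].
have [a [/fV /act_commuteP fa aE]] := restriction_self_commuting mC Cp.
have aE' := ae_nsfun (act f) aE.
have [x [Bx [[e [a1 _]] [[_ a2] fpx]]]] := nonnull_ae nB
  (filterI (filterI fa aE) (filterI aE' fpE)).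
have [px _] := BA _ Bx.
have nC : ~ C (act f x) by move=> [/(Bf _ Bx)|/(Bpf _ Bx)].
move: e; rewrite a1; last by left.
by rewrite a2// => /nsfun_inj.
Qed.

(** The squares of the elements that commute with self_commuting p fix the
    support of p by [cent_self_commuting], so they commute with everything
    supported there. Conversely they include the squares of all the elements
    supported off supp p, and an element that commutes with these cannot move
    a set off itself outside supp p. *)
Theorem localiser_supp p f : (p * p = 1)%g ->
  localiser p f <-> {ae mu, forall x, act f x <> x -> act p x <> x}.
Proof.
move=> pp; split=> [fW|fp].
  apply: contrapT => nsub.
  pose A := supp (act f) `&` ~` supp (act p).
  have mA : measurable A.
    by apply: measurableI; [|apply: measurableC]; exact: measurable_supp.
  have nA : nonnull mu A.
    move=> h; apply: nsub; apply: filterS h => x nAx fx px.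
    by apply: nAx; split => //= /(_ px).
  have [B [mB nB BA BP]] := separation_step standardX (measurable_nsfun (act
      f)) mA nA.
  have [u [nu uB]] := act_noninvolutive mB nB.
  have uV : cent (self_commuting p) u.
    move=> v /self_commuting_supp vp; apply: act_disjoint.
    apply: filterS2 uB vp => x uB vp /uB /BA[_ /= npx].
    by apply: contrapT => /vp.
  have /act_commuteP fuu := fW _ (imageP (fun f => (f * f)%g) uV).
  have uu := actM u u; have uu' := ae_nsfun (act f) uu.
  have uB' := ae_nsfun (act f) uB.
  have [x [uux [[[e e1] e2] [b1 b2]]]] := nonnull_ae nu
    (filterI (filterI (filterI fuu uu) uu') (filterI uB uB')).
  have Bx : B x by apply: b1 => ux; apply: uux; rewrite /= !ux.
  have ufx : act u (act f x) = act f x.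
    by apply: contrapT => /b2 /(BP _ Bx); have [] := BA _ Bx.
  by apply: uux; rewrite e1 e2 !ufx in e; exact: nsfun_inj e.
move=> _ [g /(cent_self_commuting pp) gp <-].
apply: act_disjoint; apply: filterS3 fp gp (actM g g) => x fp gp -> /fp.
exact: gp.
Qed.

End support_of_involutions.

(** * Group isomorphisms are implemented by point maps *)

Section reconstruction.
Context d (X : measurableType d) (R : realType) (mu : probability X R).
Hypothesis standardX : standard_borel R X.
Hypothesis atomless_mu : atomless mu.
Implicit Types (A B C : set X) (T : nsAut mu).

(** Countable unions of members of FF of almost maximal measure exhaust FF. *)
Lemma ess_union (FF : set (set X)) : FF `<=` measurable ->
  exists M, [/\ measurable M, forall A, FF A -> sub_ae mu A M &
    forall N, (forall A, FF A -> sub_ae mu A N) -> sub_ae mu M N].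
Proof.
move=> FFm.
pose CC := [set C | exists2 A : nat ->
    set X, (forall n, FF (A n) \/ A n = set0) &
  C = \bigcup_n A n].
have CCm C : CC C -> measurable C.
  move=> [A FA ->]; apply: bigcupT_measurable => n.
  by case: (FA n) => [/FFm//|->]; exact: measurable0.
have CCU (C : nat -> set X) : (forall n, CC (C n)) -> CC (\bigcup_n C n).
  move=> CC_C; have /choice[A AP] : forall n, exists A : nat -> set X,
      (forall m, FF (A m) \/ A m = set0) /\ C n = \bigcup_m A m.
    by move=> n; have [A FA CA] := CC_C n; exists A.
  have FA n := (AP n).1; have CA n := (AP n).2.
  exists (fun n => if unpickle n is Some p then A p.1 p.2 else set0).
    by move=> n; case: unpickle => [p|]; [exact: FA|right].
  apply/seteqP; split => x [n _].
    by rewrite CA => -[m _ Ax]; exists (pickle (n, m)) => //; rewrite pickleK.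
  by case: unpickle => [p Ax|//]; exists p.1 => //; rewrite CA; exists p.2.
pose V : set R := [set fine (mu C) | C in CC].
have CC0 : CC set0 by exists (fun=> set0); [right|rewrite bigcup0].
have supV : has_sup V.
  split; first by exists (fine (mu set0)); exists set0.
  exists 1 => _ [C /CCm mC <-].
  by rewrite -lee_fin fineK ?fin_num_measure//; exact: probability_le1.
have /choice[C CP] : forall k : nat, exists C, CC C /\ sup V - k.+1%:R^-1 <
    fine (mu C).
  move=> k; have e0 : 0 < k.+1%:R^-1 :> R by rewrite invr_gt0.
  have [_ [C CC_C <-] h] := sup_adherent e0 supV.
  by exists C.
pose M := \bigcup_k C k.
have CC_M : CC M by apply: CCU => k; have [] := CP k.
have mM := CCm _ CC_M.
have leV D : CC D -> fine (mu D) <= sup V.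
  by move=> CC_D; apply: (sup_upper_bound supV); exists D.
have supM : sup V <= fine (mu M).
  apply/ler_addgt0Pr => e e0.
  pose k := Num.bound e^-1.
  have ke : k.+1%:R^-1 <= e.
    rewrite invf_ple ?posrE//; apply: le_trans (ltW (archi_boundP _)) _.
      by rewrite invr_ge0 ltW.
    by rewrite ler_nat.
  have [CC_Ck h] := CP k.
  have : fine (mu (C k)) <= fine (mu M).
    apply: fine_le; rewrite ?fin_num_measure//; try exact: CCm.
    by apply: le_measure; rewrite ?inE//; [exact: CCm|exact: bigcup_sup].
  by move=> h'; rewrite -lerBlDr (le_trans _ (le_trans (ltW h) h'))// lerB.
exists M; split => //.
  move=> A FF_A; have mA := FFm _ FF_A.
  have CC_A : CC (M `|` A).
    rewrite -bigcup2E; apply: CCU => -[|[|n]] //=.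
    exists (fun n => if n is 0%N then A else set0); first by case=> [|n];
        [left|right].
    apply/seteqP; split => x; first by move=> Ax; exists 0%N.
    by move=> [[|n] _].
  have mD : measurable (A `\` M) by exact: measurableD.
  have D0 : mu (A `\` M) = 0%E.
    have le := le_trans (leV _ CC_A) supM.
    have e : (mu (M `|` A) = mu M + mu (A `\` M))%E.
      rewrite -measureU ?setDIK//; congr (mu _); apply/seteqP; split => x.
        by move=> [Mx|Ax]; [left|have [Mx|Mx] := pselect (M x); [left|right]].
      by move=> [Mx|[Ax _]]; [left|right].
    have fD : mu (A `\` M) \is a fin_num by rewrite fin_num_measure.
    move: le; rewrite e fineD ?fin_num_measure// gerDl => le0.
    apply/eqP; rewrite eq_le measure_ge0 andbT -(fineK fD) lee_fin.
    by [].
  have /(ae_nullP mu mD) := D0; rewrite /sub_ae; apply: filterS => x nD Ax.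
  by apply: contrapT => nM; apply: nD.
move=> N FN; have : {ae mu, forall x, forall k, C k x -> N x}.
  apply/ae_foralln => k; have [[A FA ->] _] := CP k.
  have : {ae mu, forall x, forall n, A n x -> N x}.
    apply/ae_foralln => n; case: (FA n) => [/FN//|->]; exact: aeW.
  by apply: filterS => x xA [n _]; exact: xA.
by rewrite /sub_ae; apply: filterS => x xC [k _]; exact: xC.
Qed.

(** A measurable set is determined up to null sets by the involutions inside
    it ([inside_sub]); this is what turns a group isomorphism into a map of
    sets. *)
Definition inside T A (p : comfg T) :=
    (p * p = 1)%g /\ sub_ae mu (supp (act p)) A.

Lemma sub_ae_supp_one T (p : comfg T) : sub_ae mu (supp (act p)) set0 ->
    p = 1%g.
Proof.
rewrite /sub_ae => p0; apply: act_inj; apply: filterS2 p0 (act1 T) => x p0 ->.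
exact: contrapT.
Qed.

Lemma inside_sub T A B : ergodic T -> measurable A -> measurable B ->
  (forall p : comfg T, inside A p -> inside B p) -> sub_ae mu A B.
Proof.
move=> ergodicT mA mB AB; apply: contrapT => nAB.
have mD : measurable (A `\` B) by exact: measurableD.
have nD : nonnull mu (A `\` B).
  move=> h; apply: nAB; rewrite /sub_ae; apply: filterS h => x nD Ax.
  by apply: contrapT => nB; apply: nD.
have [p [pp np pD]] := act_involution standardX atomless_mu ergodicT mD nD.
have [_ pB] : inside B p by apply: AB; split => //;
    apply: filterS pD => x pD /pD[].
have [x [px [/(_ px)[_ nBx] /(_ px)]]] := nonnull_ae np (filterI pD pB).
by [].
Qed.

Section transport.
Variables (T1 T2 : nsAut mu).
Hypotheses (ergodicT1 : ergodic T1) (ergodicT2 : ergodic T2).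
Variables (q : comfg T1 -> comfg T2) (r : comfg T2 -> comfg T1).
Hypotheses (qM : {morph q : x y / (x * y)%g}) (rM : {morph r : x y / (x *
    y)%g}).
Hypotheses (qK : cancel q r) (rK : cancel r q).

Lemma morph_involution p : (p * p = 1)%g -> (q p * q p = 1)%g.
Proof. by move=> pp; rewrite -qM pp (morph_one qM). Qed.

Lemma transport_supp p f : (p * p = 1)%g ->
  sub_ae mu (supp (act f)) (supp (act p)) ->
  sub_ae mu (supp (act (q f))) (supp (act (q p))).
Proof.
move=> pp /(localiser_supp standardX atomless_mu ergodicT1 f pp).
move=> /(localiser_iso qM rM qK rK).
by move=> /(localiser_supp standardX atomless_mu ergodicT2 _ (morph_involution
    pp)).
Qed.

End transport.

(** F A is the essential union of the supports of the images of the
    involutions inside A. If an involution s inside F A had its preimage r s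
    not inside A, some involution p would be supported in supp (r s) and off
    A. Then q p would be supported in F A, as s is, and also off F A, as p is
    disjoint from every involution inside A. *)
Lemma transport_exists T1 T2 (q : comfg T1 -> comfg T2) (r : comfg T2 ->
    comfg T1) :
  ergodic T1 -> ergodic T2 ->
  {morph q : x y / (x * y)%g} -> {morph r : x y / (x * y)%g} ->
  cancel q r -> cancel r q ->
  exists F : set X -> set X, (forall A, measurable A -> measurable (F A)) /\
    forall A p, measurable A -> inside (F A) p <-> inside A (r p).
Proof.
move=> e1 e2 qM rM qK rK.
have /choice[F FP] : forall A, exists M,
    [/\ measurable M, forall p, inside A p -> sub_ae mu (supp (act (q p))) M &
      forall N, (forall p, inside A p -> sub_ae mu (supp (act (q p))) N) ->
          sub_ae mu M N].
  move=> A; have [|M [mM MA MN]] :=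
      @ess_union [set supp (act (q p)) | p in inside A].
    by move=> _ [p _ <-]; exact: measurable_supp.
  exists M; split => //; first by move=> p Ap; apply: MA; exists p.
  by move=> N NA; apply: MN => _ [p Ap <-]; exact: NA.
exists F; split=> [A _|A s mA]; first by have [] := FP A.
have [mF FA FN] := FP A.
split=> [[ss sF]|[rr rA]]; last first.
  have ss : (s * s = 1)%g by rewrite -(rK s) -qM rr (morph_one qM).
  by split => //; rewrite -(rK s); apply: FA.
have rr : (r s * r s = 1)%g by rewrite -rM ss (morph_one rM).
split => //; apply: contrapT => nsub.
pose D := supp (act (r s)) `\` A.
have mD : measurable D by apply: measurableD => //; exact: measurable_supp.
have nD : nonnull mu D.
  move=> h; apply: nsub; rewrite /sub_ae; apply: filterS h => x nD sx.
  by apply: contrapT => nA; apply: nD.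
have [p [pp np pD]] := act_involution standardX atomless_mu e1 mD nD.
(* q p is disjoint from q p' for every p' inside A, since p is disjoint from
   p'. *)
have qpF : sub_ae mu (F A) (~` supp (act (q p))).
  apply: FN => p' [pp' pA'].
  apply: contrapT => nI.
  have mI : measurable (supp (act (q p')) `&` supp (act (q p))).
    by apply: measurableI; exact: measurable_supp.
  have nI' : nonnull mu (supp (act (q p')) `&` supp (act (q p))).
    move=> h; apply: nI; rewrite /sub_ae; apply: filterS h => x nI x1 x2.
    exact: nI.
  have [t [tt nt tI]] := act_involution standardX atomless_mu e2 mI nI'.
  have tp' : sub_ae mu (supp (act (r t))) (supp (act p')).
    rewrite -(qK p'); apply: (transport_supp e2 e1 rM qM rK qK).
      by rewrite -qM pp' (morph_one qM).
    by apply: filterS tI => x tI /tI[].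
  have tp : sub_ae mu (supp (act (r t))) (supp (act p)).
    rewrite -(qK p); apply: (transport_supp e2 e1 rM qM rK qK).
      by rewrite -qM pp (morph_one qM).
    by apply: filterS tI => x tI /tI[].
  have rt1 : r t = 1%g.
    apply: sub_ae_supp_one; rewrite /sub_ae in tp tp' pA' *.
    apply: filterS3 tp tp' (filterI pA' pD) => x tp tp' [pA2 pD2] rx.
    by have [_ nAx] := pD2 (tp rx); apply: nAx; exact: pA2 (tp' rx).
  have t1 : t = 1%g by rewrite -(rK t) rt1 (morph_one qM).
  apply: nt; rewrite t1; apply: filterS (act1 T2) => x e; exact.
have qps : sub_ae mu (supp (act (q p))) (supp (act s)).
  rewrite -(rK s); apply: (transport_supp e1 e2 qM rM qK rK) => //.
  by apply: filterS pD => x pD /pD[].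
have qp1 : q p = 1%g.
  apply: sub_ae_supp_one; rewrite /sub_ae in qps sF qpF *.
  by apply: filterS3 qps sF qpF => x a b c px; exact: (c (b (a px)) px).
have p1 : p = 1%g by rewrite -(qK p) qp1 (morph_one rM).
by apply: np; rewrite p1; apply: filterS (act1 T1) => x e; exact.
Qed.

Lemma insideJ T A (u p : comfg T) : measurable A ->
  inside A (u * p * u^-1)%g <-> inside (act u @^-1` A) p.
Proof.
move=> mA; split=> [[pp pA]|[pp pA]].
  have pp' : (p * p = 1)%g.
    have e : (u * (p * p) * u^-1 = 1)%g.
      by rewrite -pp !mulgA mulgVK.
    by apply: (@mulgI _ u); rewrite mulg1; exact: divg1_eq.
  split => //; rewrite /sub_ae in pA *.
  have pA' := ae_nsfun (act u) pA; have J' := ae_nsfun (act u) (actJ u p).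
  apply: filterS2 pA' J' => x; rewrite /supp /preimage /= nsfunK => h e px;
      apply: h.
  by rewrite e => /nsfun_inj.
split; first by rewrite !mulgA mulgVK -(mulgA u) pp mulg1 mulgV.
rewrite /sub_ae in pA *.
have pA' := ae_nsfun (nsbij_inv (act u)) pA.
apply: filterS2 pA' (actJ u p) => x; rewrite /supp /preimage /= nsinvK =>
    h e px.
by apply: h => e'; apply: px; rewrite e e' nsinvK.
Qed.

Lemma inside_eq T A B : ergodic T -> measurable A -> measurable B ->
  (forall p : comfg T, inside A p <-> inside B p) -> eq_ae mu A B.
Proof.
move=> eT mA mB AB; apply/eq_aeP; split; apply: (@inside_sub T) => // p.
  by move/AB.
by move/AB.
Qed.

(** The map F of [transport_exists] is an automorphism of the measure
    algebra, with inverse the same map for r. It intertwines g and q g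
    because conjugation by g carries the involutions inside g^-1 A to those
    inside A. *)
Theorem spatial_iso T1 T2 (q : comfg T1 -> comfg T2) (r : comfg T2 ->
    comfg T1) :
  ergodic T1 -> ergodic T2 ->
  {morph q : x y / (x * y)%g} -> {morph r : x y / (x * y)%g} ->
  cancel q r -> cancel r q ->
  exists S : nsAut mu, forall g, (val g * S = S * val (q g))%g.
Proof.
move=> e1 e2 qM rM qK rK.
have [F [mF FP]] := transport_exists e1 e2 qM rM qK rK.
have [G [mG GP]] := transport_exists e2 e1 rM qM rK qK.
have sub_inside T A B (p : comfg T) : sub_ae mu A B -> inside A p -> inside B p.
  by move=> AB [pp pA]; split => //; exact: sub_aeT AB.
have FG : order_iso mu F G.
  split => //.
  - move=> A B mA mB AB; apply: (inside_sub e2); [exact: mF|exact: mF|move=> p].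
    by move=> /(FP A p mA).1 pA; apply/(FP B p mB); exact: sub_inside AB pA.
  - move=> A B mA mB AB; apply: (inside_sub e1); [exact: mG|exact: mG|move=> p].
    by move=> /(GP A p mA).1 pA; apply/(GP B p mB); exact: sub_inside AB pA.
  - move=> A mA; apply: (inside_eq e1) => //; first exact/mG/mF.
    move=> p; rewrite GP; last exact: mF.
    by rewrite FP// qK.
  - move=> A mA; apply: (inside_eq e2) => //; first exact/mF/mG.
    move=> p; rewrite FP; last exact: mG.
    by rewrite GP// rK.
have [f fF] := iso_realization standardX atomless_mu FG.
pose S : nsAut mu := \pi_(nsAut mu) f.
exists S => g.
have Sf : {ae mu, forall x, S x = f x} by exact: nsrep_pi.
suff h : {ae mu, forall x, act g (f x) = f (act (q g) x)}.
  apply/nsAut_eqP.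
  have Sf' := ae_nsfun (act (q g)) Sf.
  apply: filterS3 h (filterI Sf Sf')
    (filterI (nsAut_mulE (val g) S) (nsAut_mulE S (val (q g)))).
  by move=> x h [a b] [-> ->];
      rewrite -[nsrep (val g)]/(act g) -[nsrep (val (q g))]/(act (q g)) a b.
apply: (@ae_eq_points _ _ _ _ standardX (act g \o f) (f \o act (q g))).
- by apply: measurableT_comp; exact: measurable_nsfun.
- by apply: measurableT_comp; exact: measurable_nsfun.
move=> A mA.
have mgA : measurable (act g @^-1` A) by exact: measurable_nsfun_pre.
have FgA : eq_ae mu (F (act g @^-1` A)) (act (q g) @^-1` F A).
  apply: (inside_eq e2); first exact: mF.
    by apply: measurable_nsfun_pre; exact: mF.
  move=> p; rewrite FP// -insideJ// -[(g * r p * g^-1)%g]qK.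
  rewrite !qM (morph_inv qM) rK -FP// insideJ//.
  exact: mF.
have h1 := fF _ mgA; have h2 :=
    ae_nsfun (act (q g)) (fF _ mA : {ae mu, forall x, (f @^-1` A) x <-> F A x}).
rewrite /eq_ae in FgA h1 *.
by apply: filterS3 FgA h1 h2 => x; rewrite /preimage /= => -> -> ->.
Qed.

End reconstruction.

(** * Relative index of commensurate sets of integers *)

Section index.
Implicit Types (A B C : int -> bool) (h : int -> int).

Definition commensurate A B := finite_set [set n | A n != B n].

(** The number of elements of A off B minus the number of elements of B off
    A, for commensurate A and B; as a sum it is additive and can be
    reindexed. *)
Definition rel_index A B : int := \sum_(n \in [set: int]) ((A n)%:Z - (B n)%:Z).

Lemma rel_index_on A B (D : set int) : (forall n, A n != B n -> D n) ->
  rel_index A B = \sum_(n \in D) ((A n)%:Z - (B n)%:Z).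
Proof.
move=> AB; apply/esym/fsbig_widen => // n [_ nD] /=.
by case: (eqVneq (A n) (B n)) => [->|/AB//]; rewrite subrr.
Qed.

Lemma commensurate_trans A B C :
  commensurate A B -> commensurate B C -> commensurate A C.
Proof.
move=> AB BC; have : finite_set ([set n | A n != B n] `|` [set n | B n != C n]).
  by rewrite finite_setU.
apply: sub_finite_set => n /=; case: (eqVneq (A n) (B n)) => [->|];
    first by right.
by left.
Qed.

Lemma commensurate_bij A B h : bijective h ->
  commensurate A B -> commensurate (A \o h) (B \o h).
Proof.
move=> [g hK gK] AB.
apply: (@sub_finite_set _ _ (g @` [set n | A n != B n]));
    last exact: finite_image.
by move=> n /= ABn; exists (h n).
Qed.

Lemma rel_index_trans A B C : commensurate A B -> commensurate B C ->
  rel_index A C = rel_index A B + rel_index B C.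
Proof.
move=> AB BC; pose D := [set n | A n != B n] `|` [set n | B n != C n].
have fD : finite_set D by rewrite finite_setU.
rewrite !(@rel_index_on _ _ D); first last.
- move=> n; rewrite /D /=; case: (eqVneq (A n) (B n)) => [->|]; first by right.
  by left.
- by move=> n h; left.
- by move=> n h; right.
rewrite -fsbig_split//; apply: eq_fsbigr => n _.
rewrite /=; lia.
Qed.

Lemma rel_index_bij A B h : bijective h ->
  rel_index (A \o h) (B \o h) = rel_index A B.
Proof. by move=> bh; apply/esym; apply: reindex_fsbigT. Qed.

Lemma rel_index_list A B (s t : seq int) : uniq s -> uniq t ->
  (forall n, n \in s = A n && ~~ B n) -> (forall n, n \in t = ~~ A n && B n) ->
  rel_index A B = (size s)%:Z - (size t)%:Z.
Proof.
move=> us ut sA tB.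
rewrite (@rel_index_on _ _ [set` s ++ t]); last first.
  by move=> n; rewrite /= mem_cat sA tB; case: (A n); case: (B n).
rewrite -fsbig_seq; last first.
  rewrite cat_uniq us ut andbT; apply/hasPn => n.
  by rewrite tB sA; case: (A n); case: (B n).
rewrite big_cat /=; congr (_ + _).
  rewrite (eq_big_seq (fun=> 1)); last by move=> n;
      rewrite sA => /andP[-> /negbTE ->].
  by rewrite big_const_seq count_predT; elim: (size s) => //= m ->;
      rewrite intS.
rewrite (eq_big_seq (fun=> - 1)); last by move=> n;
    rewrite tB => /andP[/negbTE -> ->].
by rewrite big_const_seq count_predT; elim: (size t) => //= m ->;
    rewrite intS opprD.
Qed.

Definition ray (a n : int) : bool := a <= n.

Lemma commensurate_ray a b : commensurate (ray a) (ray b).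
Proof.
apply: sub_finite_set (finite_int_ball (`|a| + `|b|)) => n /=; rewrite /ray.
case: (leP a n) => ?; case: (leP b n) => ? //= _; lia.
Qed.

Lemma rel_index_ray k : rel_index (ray 0) (ray k) = k.
Proof.
have step a : rel_index (ray a) (ray (a + 1)) = 1.
  rewrite (@rel_index_list _ _ [:: a] [::])// => n; rewrite /ray ?inE; lia.
elim/int_rect: k => [|k IH|k IH].
- by rewrite (@rel_index_list _ _ [::] [::])// => n; rewrite /ray ?inE; lia.
- rewrite (@rel_index_trans _ (ray k%:Z)); try exact: commensurate_ray.
  by rewrite IH (_ : k.+1%:Z = k%:Z + 1) ?step//; lia.
- have := @rel_index_trans (ray 0) (ray (- k.+1%:Z)) (ray (- k%:Z))
    (commensurate_ray _ _) (commensurate_ray _ _).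
  have -> : - k%:Z = - k.+1%:Z + 1 by lia.
  rewrite step (_ : - k.+1%:Z + 1 = - k%:Z) ?IH; lia.
Qed.

(** In the coordinate m = s n the permutation n |-> t (s n + 1) is the shift
    by one. If it commensurates the nonnegative integers, the set of m with 0
    <= t m is almost invariant under the shift, hence eventually constant at
    both ends. The two constants differ because this set and its complement
    are infinite. *)
Lemma eventually_ray (s t : int -> int) : cancel s t -> cancel t s ->
  finite_set (([set t (s n + 1) | n in natZ]) `+` natZ) ->
  (exists K : int, (forall m, K <= m -> 0 <= t m) /\ (forall m, m <= - K ->
      t m < 0)) \/
  (exists K : int, (forall m, K <= m -> t m < 0) /\ (forall m, m <= - K ->
      0 <= t m)).
Proof.
move=> sK tK fin.
(* A change of sign of t at m produces a point that the permutation carries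
   across the origin. *)
have fixs m : (0 <= t m) != (0 <= t (m + 1)) ->
    (([set t (s n + 1) | n in natZ]) `+` natZ) (t (m + 1)).
  rewrite setY_def /natZ /=; case: (leP 0 (t m)) => h1;
      case: (leP 0 (t (m + 1))) => h2 // _.
    by left; split => //; exists (t m); rewrite ?tK.
  right; split => // -[n n0 /(can_inj tK) /addIr snm].
  by move: h1; rewrite -snm sK ltNge n0.
have /finite_seqP[l lE] := fin.
have [K [K0 KP]] : exists K : int, 0 <= K /\
    forall m, (0 <= t m) != (0 <= t (m + 1)) -> - K <= m < K.
  have [K [K0 Kl]] : exists K : int, 0 <= K /\ forall n, n \in l ->
      - K < s n < K.
    elim: (l) => [|a l' [K [K0 Kl]]]; first by exists 0.
    exists (K + `|s a| + 1); split; first lia.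
    move=> n; rewrite in_cons => /orP[/eqP ->|/Kl]; lia.
  exists K; split => // m /fixs; rewrite lE /= => /Kl; rewrite tK; lia.
have up m : K <= m -> (0 <= t m) = (0 <= t K).
  move=> Km; have -> : m = K + `|m - K|%N%:Z by lia.
  elim: `|m - K|%N => [|k IH]; first by rewrite addr0.
  rewrite -IH (_ : K + k.+1%:Z = K + k%:Z + 1); last lia.
  case: (boolP ((0 <= t (K + k%:Z)) == (0 <= t (K + k%:Z + 1)))) =>
      [/eqP <-//|/KP]; lia.
have dn m : m <= - K -> (0 <= t m) = (0 <= t (- K)).
  move=> Km; have -> : m = - K - `|- K - m|%N%:Z by lia.
  elim: `|- K - m|%N => [|k IH]; first by rewrite subr0.
  rewrite -IH (_ : - K - k%:Z = - K - k.+1%:Z + 1); last lia.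
  case: (boolP ((0 <= t (- K - k.+1%:Z)) == (0 <= t (- K - k.+1%:Z + 1)))) =>
      [/eqP <-//|/KP]; lia.
(* Otherwise t m would have a constant sign for all but finitely many m. *)
have inf (b : bool) : (0 <= t K) = b -> (0 <= t (- K)) = b -> False.
  move=> bK bK'.
  have sub : [set n : int | (0 <= n) != b] `<=` t @` [set m : int | - K <= m
      <= K].
    move=> n /= nb; exists (s n) => //; apply/andP; split; rewrite leNgt;
        apply/negP => h.
      by move: nb; rewrite -(sK n) dn ?bK' ?eqxx// ltW.
    by move: nb; rewrite -(sK n) up ?bK ?eqxx// ltW.
  have /finite_seqP[l' l'E] :=
      sub_finite_set sub (finite_image t (finite_int_ball K)).
  have [M MP] : exists M : int, forall n, n \in l' -> - M < n < M.
    elim: (l') => [|a l'' [M Ml]]; first by exists 0.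
    exists (`|M| + `|a| + 1) => n; rewrite in_cons => /orP[/eqP ->|/Ml]; lia.
  have : [set n : int | (0 <= n) != b] (if b then - `|M| - 1 else `|M|).
    by case: (b) => /=; lia.
  rewrite l'E /= => /MP; case: (b); lia.
case: (boolP (0 <= t K)) => h1; case: (boolP (0 <= t (- K))) => h2.
- by exfalso; apply: (inf true).
- left; exists K; split=> m Km; first by rewrite up.
  by rewrite ltNge dn.
- right; exists K; split=> m Km; last by rewrite dn.
  by rewrite ltNge up.
- by exfalso; apply: (inf false); apply/negbTE.
Qed.

End index.

(** * Transformations with commensurate orbits are flip-conjugate *)

Section katznelson.
Context d (X : measurableType d) (R : realType) (mu : probability X R).
Hypothesis standardX : standard_borel R X.
Implicit Types (T U : nsAut mu) (x y : X).

(** The last clause says that U commensurates the forward half of the T-orbit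
    of x. *)
Record same_orbits T U x : Prop := SameOrbits {
  freeT : forall n, iterz T n x = x -> n = 0;
  freeU : forall n, iterz U n x = x -> n = 0;
  orbitTU : forall n, exists m, iterz T n x = iterz U m x;
  orbitUT : forall n, exists m, iterz U n x = iterz T m x;
  orbit_sym : exists s : symZN, forall n, U (iterz T n x) = iterz T (s n) x }.

Lemma full_group_orbit T U : full_group U T ->
  {ae mu, forall x, forall n, exists m, iterz T n x = iterz U m x}.
Proof.
move=> fT; have step : {ae mu, forall x, forall n, exists m,
    T (iterz T n x) = iterz U m (iterz T n x)}.
  by apply: ae_forallz => n; exact: (ae_iterz T n fT).
apply: filterS step => x step n; elim/int_rect: n => [|m [k IH]|m [k IH]].
- by exists 0.
- have [j h] := step m%:Z; exists (j + k).
  by rewrite intS addrC iterzS h IH -iterzD.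
- have [j h] := step (- m.+1%:Z); exists (- j + k).
  rewrite iterzD -IH -[- m%:Z](_ : - m.+1%:Z + 1 = _); last lia.
  by rewrite iterzS h iterzK.
Qed.

Lemma ae_same_orbits T U : aperiodic T -> aperiodic U -> com_full_group T U ->
  full_group U T -> {ae mu, forall x, same_orbits T U x}.
Proof.
move=> aT aU [fU [c [mc cU] cN]] fT.
have cT : {ae mu, forall x, forall n, U (iterz T n x) =
    iterz T (c (iterz T n x)) (iterz T n x)}.
  by apply: ae_forallz => n; exact: ae_iterz cU.
apply: filterS3 (filterI aT aU) (filterI (full_group_orbit fT)
    (full_group_orbit fU))
  (filterI cT cN) => x [hT hU] [TU UT] [xc [s sE]].
split => //.
- by move=> n e; apply: contrapT => /eqP /hT.
- by move=> n e; apply: contrapT => /eqP /hU.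
- by exists s => n; rewrite xc -iterzD -sE /orbit_map addrC.
Qed.

Section coordinates.
Variables T U : nsAut mu.

Lemma iterz_free (S : nsAut mu) x : (forall n, iterz S n x = x -> n = 0) ->
  injective (fun n => iterz S n x).
Proof.
move=> free m n e; apply/eqP; rewrite -subr_eq0; apply/eqP/free.
by rewrite addrC iterzD e iterzK.
Qed.

(** The maps s x and t x convert the position of a point of the orbit of x
    counted in steps of T into its position counted in steps of U, and back. *)
Lemma coordinates_exist : exists s t : X -> int ->
    int, forall x, same_orbits T U x ->
  [/\ cancel (s x) (t x), cancel (t x) (s x),
      forall n, iterz T n x = iterz U (s x n) x &
      forall n, iterz U n x = iterz T (t x n) x].
Proof.
have /choice[s sP] : forall p : X * int, exists m, same_orbits T U p.1 ->
    iterz T p.2 p.1 = iterz U m p.1.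
  move=> [x n]; have [so|nso] := pselect (same_orbits T U x); last by exists 0.
  by have [m e] := orbitTU so n; exists m.
have /choice[t tP] : forall p : X * int, exists m, same_orbits T U p.1 ->
    iterz U p.2 p.1 = iterz T m p.1.
  move=> [x n]; have [so|nso] := pselect (same_orbits T U x); last by exists 0.
  by have [m e] := orbitUT so n; exists m.
exists (fun x n => s (x, n)), (fun x n => t (x, n)) => x so; split.
- move=> n; apply: (iterz_free (freeT so)).
  by rewrite -(tP (x, s (x, n)) so) -(sP (x, n) so).
- move=> n; apply: (iterz_free (freeU so)).
  by rewrite -(sP (x, t (x, n)) so) -(tP (x, n) so).
- by move=> n; exact: sP (x, n) so.
- by move=> n; exact: tP (x, n) so.
Qed.

Variables s t : X -> int -> int.
Hypothesis st : forall x, same_orbits T U x ->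
  [/\ cancel (s x) (t x), cancel (t x) (s x),
      forall n, iterz T n x = iterz U (s x n) x &
      forall n, iterz U n x = iterz T (t x n) x].

(** T and U run in the same direction along the orbit of x. *)
Definition forward x := exists K : nat, forall n : nat, (K <= n)%N ->
  exists m : nat, iterz U n%:Z x = iterz T m%:Z x.

Definition backward x := exists K : nat, forall n : nat, (K <= n)%N ->
  exists m : nat, iterz U (- n%:Z) x = iterz T m%:Z x.

Lemma measurable_forward : measurable forward.
Proof.
rewrite (_ : forward = [set x | exists2 K : nat, setT K & forall n : nat, [set
    n | (K <= n)%N] n ->
    [set x | exists2 m : nat, setT m & iterz U n%:Z x = iterz T m%:Z x] x]).
  apply: (measurable_countableU (F := fun K =>
      [set x | forall n : nat, [set n | (K <= n)%N] n ->
    [set x | exists2 m : nat, setT m & iterz U n%:Z x = iterz T m%:Z x] x]));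
        first exact: countableP.
  move=> K _; apply: measurable_countableI; first exact: countableP.
  move=> n _; apply: (measurable_countableU (F :=
      fun m : nat => [set x | iterz U n%:Z x = iterz T m%:Z x])).
    exact: countableP.
  by move=> m _; apply: (measurable_eq standardX); exact: measurable_iterz.
apply/seteqP; split => x /=.
  by move=> [K KP]; exists K => // n /KP[m e]; exists m.
by move=> [K _ KP]; exists K => n /KP[m _ e]; exists m.
Qed.

Lemma orbit_ray x : same_orbits T U x ->
  (exists K : int, (forall m, K <= m -> 0 <= t x m) /\ (forall m, m <= - K ->
      t x m < 0)) \/
  (exists K : int, (forall m, K <= m -> t x m < 0) /\ (forall m, m <= - K ->
      0 <= t x m)).
Proof.
move=> so; have [sK tK sE tE] := st so.
apply: (eventually_ray sK tK).
have [f fE] := orbit_sym so.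
rewrite (_ : [set _ | n in natZ] = f @` natZ); first exact: symf_commN.
congr image; apply/funext => n; apply: (iterz_free (freeT so)).
by rewrite -fE -tE iterzS -sE.
Qed.

Lemma forward_or_backward x : same_orbits T U x -> forward x \/ backward x.
Proof.
move=> so; have [sK tK sE tE] := st so.
case: (orbit_ray so) => -[K [Kp Km]]; [left|right]; exists `|K|%N => n Kn.
  exists `|t x n%:Z|%N; rewrite tE; congr (iterz T _ x).
  by rewrite gez0_abs// Kp//; lia.
exists `|t x (- n%:Z)|%N; rewrite tE; congr (iterz T _ x).
by rewrite gez0_abs// Km//; lia.
Qed.

(** Of the two cases of [orbit_ray] only the first is compatible with forward
    x. *)
Lemma forward_ray x : same_orbits T U x -> forward x ->
  exists K : int, (forall m, K <= m -> 0 <= t x m) /\ (forall m, m <= - K ->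
      t x m < 0).
Proof.
move=> so [L LP]; have [sK tK sE tE] := st so.
case: (orbit_ray so) => // -[K [Kp _]]; exfalso.
pose n := (L + `|K|)%N.
have [|m e] := LP n; first lia.
have tn : t x n%:Z = m%:Z by apply: (iterz_free (freeT so)); rewrite -tE.
by have := Kp n%:Z; rewrite tn; lia.
Qed.

Lemma forward_commensurate x : same_orbits T U x -> forward x ->
  commensurate (ray 0) (ray 0 \o s x).
Proof.
move=> so fx; have [K [Kp Km]] := forward_ray so fx; have [sK tK _ _] := st so.
apply: sub_finite_set (finite_image (t x) (finite_int_ball `|K|)) => n /= h.
exists (s x n) => //; apply: contraNT h; rewrite negb_and -!ltNge /ray =>
    /orP[h|h].
  by have := Km (s x n); rewrite sK; lia.
by have := Kp (s x n); rewrite sK; lia.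
Qed.

Lemma same_orbits_step x : same_orbits T U x -> same_orbits T U (T x).
Proof.
move=> so; have [sK tK sE tE] := st so.
have Tx n : iterz T n (T x) = iterz T (n + 1) x by rewrite iterzD.
have Ux n : iterz U n (T x) = iterz U (n + s x 1) x.
  by rewrite iterzD -sE.
split.
- move=> n; rewrite Tx -[T x]/(iterz T 1 x) => /(iterz_free (freeT so)); lia.
- move=> n; rewrite Ux -[T x]/(iterz T 1 x) sE => /(iterz_free (freeU so)); lia.
- move=> n; exists (s x (n + 1) - s x 1).
  by rewrite Tx Ux subrK -sE.
- move=> n; exists (t x (n + s x 1) - 1).
  by rewrite Tx Ux subrK -tE.
- have [f fE] := orbit_sym so.
  pose g m := f (m + 1) - 1; pose g' m := symi f (m + 1) - 1.
  have gK : cancel g g' by move=> m; rewrite /g /g' subrK symfK addrK.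
  have g'K : cancel g' g by move=> m; rewrite /g /g' subrK symiK addrK.
  have fin : finite_set ((g @` natZ) `+` natZ).
    have shift1 (M : set int) : commN M -> commN ((fun m => m - 1) @` M).
      apply: commN_image; apply: sub_finite_set (finite_int_ball 1).
      rewrite setY_def /natZ => n [[[m /= m0 <-] nm]|[/= n0 nm]] /=; first lia.
      by exfalso; apply: nm; exists (n + 1); [lia|rewrite addrK].
    have shift2 : commN ((fun m => m + 1) @` natZ).
      apply: sub_finite_set (finite_int_ball 1).
      rewrite setY_def /natZ => n [[[m /= m0 <-] nm]|[/= n0 nm]] /=; first lia.
      have [n1|n1] := leP 1 n; last lia.
      by exfalso; apply: nm; exists (n - 1); [lia|rewrite subrK].
    have -> : g @` natZ = (fun m => m - 1) @` (f @` ((fun m => m + 1) @` natZ)).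
      by rewrite !image_comp.
    apply: shift1; apply: commN_image shift2; exact: symf_commN.
  exists (SymZN gK g'K fin) => n; rewrite Tx fE Tx /= /g subrK //.
Qed.

Lemma coordinates_step x n : same_orbits T U x ->
  s (T x) n = s x (n + 1) - s x 1 /\ t (T x) n = t x (n + s x 1) - 1.
Proof.
move=> so; have so' := same_orbits_step so.
have [sK tK sE tE] := st so; have [sK' tK' sE' tE'] := st so'.
split.
  apply: (iterz_free (freeU so')) => /=; rewrite -sE'.
  rewrite -[T x]/(iterz T 1 x) -iterzD !sE -iterzD.
  by rewrite subrK.
apply: (iterz_free (freeT so')) => /=; rewrite -tE'.
rewrite -[T x]/(iterz T 1 x) -iterzD subrK sE -iterzD.
by rewrite tE.
Qed.

Lemma forward_step x : same_orbits T U x -> forward (T x) <-> forward x.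
Proof.
move=> so; have so' := same_orbits_step so.
have [sK tK sE tE] := st so; have [sK' tK' sE' tE'] := st so'.
split=> [/(forward_ray so')[K [Kp _]]|/(forward_ray so)[K [Kp _]]].
  exists (absz (`|K| + `|s x 1|)%R) => n nK; exists `|t x n%:Z|%N;
      rewrite tE; congr (iterz T _ x).
  have := Kp (n%:Z - s x 1) _.
  by rewrite (coordinates_step _ so).2 subrK; lia.
exists (absz (`|K| + `|s x 1| + `|s x 0|)%R).+1 => n nK.
exists `|t (T x) n%:Z|%N; rewrite tE'; congr (iterz T _ (T x)).
rewrite (coordinates_step _ so).2.
have h : n%:Z + s x 1 <> s x 0 by lia.
have h0 : t x (n%:Z + s x 1) <> 0 by move=> e; apply: h; rewrite -[LHS]tK e.
have := Kp (n%:Z + s x 1) _; lia.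
Qed.

(** Minus the index of the forward T-orbit of x relative to its forward
    U-orbit, both read in the T-coordinate. *)
Definition shift_index x : int := - rel_index (ray 0) (ray 0 \o s x).

(** Moving the base point from x to T x removes one point from the forward
    T-orbit and s x 1 points, counted with sign, from the forward U-orbit. *)
Lemma shift_index_step x : same_orbits T U x -> forward x ->
  shift_index (T x) + s x 1 = shift_index x + 1.
Proof.
move=> so fx; have [sK tK sE tE] := st so.
have cx := forward_commensurate so fx.
have bs : bijective (s x) by exists (t x).
have b1 : bijective (fun n : int => n + 1).
  by exists (fun n => n - 1) => n; rewrite ?addrK ?subrK.
rewrite /shift_index.
have -> : rel_index (ray 0) (ray 0 \o s (T x)) =
    rel_index (ray 1) (ray (s x 1) \o s x).
  rewrite -[RHS](rel_index_bij _ _ b1); congr rel_index; apply/funext => n;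
      rewrite /ray /=; first lia.
  by rewrite (coordinates_step _ so).1 subr_ge0.
have c1 := commensurate_ray 1 0.
have c2 := commensurate_bij bs (commensurate_ray 0 (s x 1)).
rewrite (rel_index_trans c1 (commensurate_trans cx c2)) (rel_index_trans cx c2).
rewrite (rel_index_bij _ _ bs) rel_index_ray.
have := rel_index_trans (commensurate_ray 0 1) c1.
rewrite !rel_index_ray; lia.
Qed.

(** The index is the difference of the sizes of two finite sets of integers,
    so its level sets are countable unions indexed by pairs of lists. *)
Lemma measurable_shift_index (Y : set X) (k : int) : measurable Y ->
  (forall x, Y x -> same_orbits T U x /\ forward x) ->
  measurable (Y `&` [set x | shift_index x = k]).
Proof.
move=> mY YP.
pose h n := [set x | exists2 m : nat, setT m & iterz T n x = iterz U m%:Z x].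
have mh n : measurable (h n).
  apply: (measurable_countableU (F := fun m : nat =>
      [set x | iterz T n x = iterz U m%:Z x])).
    exact: countableP.
  by move=> m _; apply: (measurable_eq standardX); exact: measurable_iterz.
have hE x n : Y x -> h n x <-> ray 0 (s x n).
  move=> /YP[so _]; have [_ _ sE _] := st so; split.
    by move=> [m _]; rewrite sE => /(iterz_free (freeU so)) ->.
  rewrite /ray => sn; exists `|s x n|%N => //; rewrite sE;
      congr (iterz U _ x); lia.
pose P (L : seq int * seq int) x := forall n : int, setT n ->
  [set x | (n \in L.1 <-> ray 0 n /\ (~` h n) x) /\ (n \in L.2 <-> ~ ray 0 n
      /\ h n x)] x.
rewrite (_ : _ `&` _ = Y `&` [set x | exists2 L : seq int * seq int,
    [set L | [/\ uniq L.1, uniq L.2 & (size L.2)%:Z - (size L.1)%:Z = k]] L &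
        P L x]).
  apply: measurableI => //; apply: measurable_countableU;
      first exact: countableP.
  move=> L _; apply: measurable_countableI; first exact: countableP.
  move=> n _; apply: measurableI; apply: measurable_iff;
      try exact: measurable_cst_set.
    by apply: measurableI; [exact: measurable_cst_set|exact: measurableC].
  by apply: measurableI; [exact: measurable_cst_set|].
have idx x L : Y x -> uniq L.1 -> uniq L.2 -> P L x ->
    shift_index x = (size L.2)%:Z - (size L.1)%:Z.
  move=> Yx u1 u2 PL; rewrite /shift_index (rel_index_list u1 u2) ?opprB //.
    move=> n; have [[a b] _] := PL n I; apply/idP/idP.
      by move=> /a[-> /= nh]; apply/negP => /(hE x n Yx).
    by move=> /andP[r0 /negP rs]; apply: b; split => // /(hE x n Yx).
  move=> n; have [_ [a b]] := PL n I; apply/idP/idP.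
    by move=> /a[/negP r0 /(hE x n Yx) rs]; rewrite r0.
  by move=> /andP[/negP r0 rs]; apply: b; split => //; apply/(hE x n Yx).
apply/seteqP; split => x [Yx] /=; last first.
  by move=> [L [u1 u2 <-] PL]; split => //; exact: idx.
move=> <-; split => //; have [so fx] := YP x Yx.
have fin : finite_set [set n | ray 0 n != (ray 0 \o s x) n].
  exact: forward_commensurate.
have [l1 l1E] : exists l : seq int, [set n : int | ray 0 n && ~~ ray 0 (s x
    n)] = [set` l].
  apply/finite_seqP; apply: sub_finite_set fin => n /=.
  by move=> /andP[-> /negbTE ->].
have [l2 l2E] : exists l : seq int, [set n : int | ~~ ray 0 n && ray 0 (s x
    n)] = [set` l].
  apply/finite_seqP; apply: sub_finite_set fin => n /=.
  by move=> /andP[/negbTE -> ->].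
have PL : P (undup l1, undup l2) x.
  move=> n _ /=; rewrite !mem_undup; split.
    have := congr1 (fun M => M n) l1E; rewrite /= => <-; split.
      by move=> /andP[-> /negP rs]; split => // /(hE x n Yx).
    by move=> [-> nh]; apply/negP => /(hE x n Yx).
  have := congr1 (fun M => M n) l2E; rewrite /= => <-; split.
    by move=> /andP[/negP r0 rs]; split => //; apply/(hE x n Yx).
  by move=> [/negP -> /(hE x n Yx)].
exists (undup l1, undup l2) => //; split; rewrite ?undup_uniq//.
by rewrite (idx x _ Yx _ _ PL)// undup_uniq.
Qed.

End coordinates.
End katznelson.

Section katznelson_conjugacy.
Context d (X : measurableType d) (R : realType) (mu : probability X R).
Hypothesis standardX : standard_borel R X.
Implicit Types (T U : nsAut mu) (x y : X).

(** By [shift_index_step] the map S x = U^(shift_index x) x satisfies S (T x)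
    = U (S x). It permutes the points of each orbit, and its inverse is y |->
    T^(- shift_index y) y. *)
Lemma forward_conjugate T U : aperiodic T -> aperiodic U ->
    com_full_group T U ->
  full_group U T -> {ae mu, forall x, forward T U x} ->
  exists S : nsAut mu, (S * T = U * S)%g.
Proof.
move=> aT aU cU fT aeF.
have [s [t st]] := coordinates_exist T U.
have [N [mN N0 NP]] : {ae mu, forall x, same_orbits T U x /\ forward T U x}.
  by apply: filterS2 (ae_same_orbits aT aU cU fT) aeF.
(* Y is a conull set of good points that is exactly invariant under T and U. *)
pose Y := [set x | forall n, setT n -> (~` (iterz T n @^-1` N)) x].
have mY : measurable Y.
  apply: measurable_countableI; first exact: countableP.
  by move=> n _; apply/measurableC/measurable_iterz_pre.
have YP x : Y x -> same_orbits T U x /\ forward T U x.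
  by move=> /(_ 0 I) nN; apply: contrapT => /NP.
have aeY : {ae mu, forall x, Y x}.
  have nN := (ae_nullP mu mN).2 N0.
  have : {ae mu, forall x, forall n, ~ N (iterz T n x)}.
    by apply: ae_forallz => n; exact: (ae_iterz T n nN).
  by apply: filterS => x xN n _; exact: xN.
have YT n x : Y x -> Y (iterz T n x).
  by move=> Yx m _; rewrite /preimage /= -iterzD; exact: Yx.
have YU n x : Y x -> Y (iterz U n x).
  by move=> Yx; have [_ _ _ ->] := st x (YP x Yx).1; exact: YT.
pose i x := shift_index s x.
pose c (e : bool) x : int := if `[< Y x >] then (if e then i x else - i x)
    else 0.
have cY e x : Y x -> c e x = if e then i x else - i x by move=> Yx;
    rewrite /c asboolT.
have cnY e x : ~ Y x -> c e x = 0 by move=> nYx; rewrite /c asboolF.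
have mi k : measurable (Y `&` [set x | i x = k]).
  exact: (measurable_shift_index standardX st).
have mc e n : measurable (c e @^-1` [set n]).
  rewrite (_ : _ @^-1` _ = (Y `&` [set x | i x = if e then n else - n]) `|`
      (~` Y `&` [set _ | 0 = n])).
    apply: measurableU => //; apply: measurableI; first exact: measurableC.
    exact: measurable_cst_set.
  apply/seteqP; split => x /=.
    move=> <-; have [Yx|nYx] := pselect (Y x); last by right; rewrite cnY.
    by left; split; rewrite // cY//; case: e; rewrite ?opprK.
  move=> [[Yx /= ix]|[nYx <-]]; last exact: cnY.
  by rewrite cY// ix; case: e {ix} => //; rewrite opprK.
pose f x := iterz U (c true x) x; pose g x := iterz T (c false x) x.
have fY x : Y x -> f x = iterz U (i x) x by move=> Yx; rewrite /f cY.
have gY x : Y x -> g x = iterz T (- i x) x by move=> Yx; rewrite /g cY.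
have Yf x : Y x -> Y (f x) by move=> Yx; rewrite fY//; exact: YU.
have Yg x : Y x -> Y (g x) by move=> Yx; rewrite gY//; exact: YT.
have fT1 x : Y x -> f (T x) = U (f x).
  move=> Yx; have [so fx] := YP x Yx; have [_ _ sE _] := st x so.
  rewrite fY; last exact: (YT 1 x Yx).
  rewrite fY// -iterzS -[T x]/(iterz T 1 x) [in X in iterz U _ X]sE -iterzD.
  by rewrite -(shift_index_step st so fx).
have fTn n x : Y x -> f (iterz T n x) = iterz U n (f x).
  move=> Yx; elim/int_rect: n => [//|m IH|m IH].
    by rewrite intS addrC !iterzS fT1 ?IH//; exact: YT.
  apply: (@nsfun_inj _ _ _ _ U); rewrite -fT1; last exact: YT.
  by rewrite -!iterzS (_ : - m.+1%:Z + 1 = - m%:Z)//; lia.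
have gK x : f (g x) = x.
  have [Yx|nYx] := pselect (Y x); last by rewrite /g cnY// iterz0 /f cnY.
  by rewrite gY// fTn// fY// iterzK.
have fK x : g (f x) = x.
  have [Yx|nYx] := pselect (Y x); last by rewrite /f cnY// iterz0 /g cnY.
  have [so _] := YP x Yx; have [sK tK sE tE] := st x so.
  have [n nE] : exists n, g (f x) = iterz T n x.
    exists (- i (f x) + t x (i x)).
    by rewrite gY; [rewrite iterzD -tE fY|exact: Yf].
  have e : f (iterz T n x) = f x by rewrite -nE gK.
  rewrite nE; suff -> : n = 0 by [].
  have [so' _] := YP _ (Yf x Yx); apply: (freeU so').
  by rewrite -fTn.
have [h hE] := full_nsbij (mc true) (mc false) fK gK.
pose S : nsAut mu := \pi_(nsAut mu) h; exists S.
have SE : {ae mu, forall x, S x = f x}.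
  by apply: filterS (nsrep_pi h) => x ->; exact: hE.
apply/nsAut_eqP; have SET := ae_nsfun T SE.
apply: filterS3 (filterI SE SET) (filterI (nsAut_mulE S T) (nsAut_mulE U S))
    aeY.
by move=> x [e1 e2] [-> ->] Yx; rewrite e2 e1 fT1.
Qed.

Lemma iterz_invE (U : nsAut mu) :
  {ae mu, forall x, forall n, iterz (nsAut_inv U) n x = iterz U (- n) x}.
Proof.
have h : {ae mu, forall x, forall n, nsAut_inv U (iterz U n x) = nsinv U
    (iterz U n x)}.
  by apply: ae_forallz => n; exact: (ae_iterz U n (nsAut_invE U)).
apply: filterS h => x h n; elim/int_rect: n => [|m IH|m IH].
- by rewrite oppr0.
- rewrite intS addrC iterzS IH h -iterzP; congr (iterz U _ x); lia.
- apply: (@nsfun_inj _ _ _ _ (nsAut_inv U)); rewrite -iterzS h -iterzP.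
  by rewrite (_ : - m.+1%:Z + 1 = - m%:Z) ?IH ?opprK; [congr (iterz U _ x);
      lia|lia].
Qed.

(** The set of points where T and U run in the same direction is T-invariant,
    so by ergodicity it is conull or null. In the second case U is replaced
    by its inverse. *)
Theorem katznelson T U : ergodic T -> aperiodic T -> aperiodic U ->
  com_full_group T U -> full_group U T ->
  exists S : nsAut mu, (S * T = U * S)%g \/ (S * T = U^-1 * S)%g.
Proof.
move=> eT aT aU cU fT.
have so := ae_same_orbits aT aU cU fT.
have [s [t st]] := coordinates_exist T U.
have inv : {ae mu, forall x, forward T U (T x) <-> forward T U x}.
  by apply: filterS so => x; exact: (forward_step st).
have [F0|F1] := eT _ (measurable_forward standardX T U) inv; last first.
  have [|S SE] := forward_conjugate aT aU cU fT; last by exists S; left.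
  have := (ae_nullP mu (measurableC (measurable_forward standardX T U))).2 F1.
  by apply: filterS => x; exact: contrapT.
have nF := (ae_nullP mu (measurable_forward standardX T U)).2 F0.
have iU := iterz_invE U.
have [||||S SE] := @forward_conjugate T (nsAut_inv U) aT; last by exists S;
    right.
- apply: filterS2 iU aU => x iU aU n n0; rewrite iU; apply: aU.
  by rewrite oppr_eq0.
- exact: com_full_groupV.
- rewrite /full_group /=; apply: filterS2 iU (fT : {ae mu, forall x, exists n,
      T x = iterz U n x}).
  by move=> x iU [n ->]; exists (- n); rewrite iU opprK.
- apply: filterS3 iU nF so => x iU nF so; have [//|[K KP]] :=
      forward_or_backward st so.
  by exists K => n /KP[m e]; exists m; rewrite iU.
Qed.

End katznelson_conjugacy.

(** * Conjugate transformations have isomorphic topological groups *)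

Section absolute_continuity.
Context d (X : measurableType d) (R : realType) (mu : probability X R).

(** Absolute continuity in epsilon-delta form: if it failed for sets A n of
    summable measures, their upper limit would be null with a nonnull
    preimage. *)
Lemma nsbij_small (S : nsbij mu) (e : R) : 0 < e ->
    exists2 delta : R, 0 < delta &
  forall A, measurable A -> (mu A < delta%:E)%E -> (mu (S @^-1` A) < e%:E)%E.
Proof.
move=> e0; apply: contrapT => nex.
have /choice[A AP] : forall n : nat, exists A, [/\ measurable A,
    (mu A < (1 / (2 ^ n.+1)%:R)%:E)%E & (e%:E <= mu (S @^-1` A))%E].
  move=> n; apply: contrapT => nA; apply: nex.
  exists (1 / (2 ^ n.+1)%:R); first by rewrite divr_gt0// ltr0n expn_gt0.
  move=> A mA Alt; rewrite ltNge; apply/negP => eA; apply: nA; by exists A.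
have mA n : measurable (A n) by have [] := AP n.
have mSA n : measurable (S @^-1` A n) by exact: measurable_nsfun_pre.
have lim0 : mu (lim_sup_set A) = 0%E.
  apply: lim_sup_set_cvg0 => //.
  apply: (@le_lt_trans _ _ (\sum_(n <oo) (0 + (1 / (2 ^ n.+1)%:R)%:E))%E).
    apply: lee_nneseries => [n *|n *]; first exact: measure_ge0.
    by rewrite add0e; have [_ /ltW] := AP n.
  apply: (le_lt_trans (epsilon_trick xpredT (fun=> lexx 0%E) ler01)).
  by rewrite eseries0// add0e ltry.
have mlim : measurable (lim_sup_set A).
  by apply: bigcapT_measurable => k; apply: bigcup_measurable.
have Slim : mu (lim_sup_set (fun n => S @^-1` A n)) = 0%E.
  exact: (nsfun_null S mlim).2 lim0.
have fin0 : (mu (\bigcup_(k >= 0) (S @^-1` A k)) < +oo)%E.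
  apply: (le_lt_trans (probability_le1 mu _)); last exact: ltry.
  by apply: bigcup_measurable => k _; exact: mSA.
have cvg0 := lim_sup_set_cvg mu _ mSA fin0.
have : (e%:E <= mu (lim_sup_set (fun n => S @^-1` A n)))%E.
  rewrite -(cvg_lim _ cvg0)//; apply: lime_ge; first by apply/cvg_ex;
      eexists; exact: cvg0.
  apply: nearW => n; have [_ _ eA] := AP n; apply: (le_trans eA).
  apply: le_measure; rewrite ?inE//.
    by apply: bigcup_measurable => k _; exact: mSA.
  by move=> x Ax; exists n => /=.
by rewrite Slim leNgt lte_fin e0.
Qed.

End absolute_continuity.

Section signed_conjugation.

(** The permutation n |-> - s (- n) fixes M when s fixes this set, which
    unlike the set of opposites of M is commensurate to the nonnegative
    integers. *)
Definition flip_set (M : set int) : set int := [set n | ~ M (- n)].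

Lemma flip_set_commN M : commN M -> commN (flip_set M).
Proof.
move=> MN; apply: (@sub_finite_set _ _ ((-%R @` (M `+` natZ)) `|` [set 0])).
  rewrite !setY_def /flip_set /natZ => n /= h.
  have [->|n0] := eqVneq n 0; [by right|left; exists (- n); rewrite ?opprK//].
  case: h => -[h1 h2]; [right|left]; split => //; first by lia.
    by apply: contrapT.
  lia.
by rewrite finite_setU; split; [exact: finite_image|exact: finite_set1].
Qed.

Lemma flip_subproof (s : symZN) :
  finite_set (((fun n => - s (- n)) @` natZ) `+` natZ).
Proof.
apply: (@sub_finite_set _ _ (-%R @` ((s @` natZ) `+` natZ) `|` [set - s 0; 0])).
  rewrite !setY_def /natZ => n /=.
  have [->|n0] := eqVneq n 0; first by right; right.
  move=> [[[m m0 <-] h]|[h nex]].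
    have [->|m1] := eqVneq m 0; first by right; left; rewrite oppr0.
    left; exists (s (- m)) => //; right; split; first lia.
    by move=> [k k0 /(can_inj (@symfK s)) km]; lia.
  left; exists (- n); rewrite ?opprK//; left; split; last lia.
  exists (symi s (- n)); last exact: symiK.
  rewrite leNgt; apply/negP => lt0; apply: nex.
  by exists (- symi s (- n)); [lia|rewrite opprK symiK opprK].
rewrite !finite_setU; split; last by split; exact: finite_set1.
exact/finite_image/symf_commN.
Qed.

Definition flip_sym (s : symZN) : symZN.
Proof.
apply: (@SymZN (fun n => - s (- n)) (fun n =>
    - symi s (- n)) _ _ (flip_subproof s)).
- by move=> n; rewrite opprK symfK opprK.
- by move=> n; rewrite opprK symiK opprK.
Defined.

Lemma flip_sym_pstab M (s : symZN) : s @` flip_set M = flip_set M ->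
    flip_sym s @` M = M.
Proof.
move=> sM; have sMP n : ~ M (- s n) <-> ~ M (- n).
  split=> h.
    have : (s @` flip_set M) (s n) by rewrite sM.
    by move=> [m Mm /(can_inj (@symfK s)) <-].
  have : (s @` flip_set M) (s n) by exists n.
  by rewrite sM.
apply/seteqP; split => n /=.
  move=> [m Mm <-]; apply: contrapT => /sMP; rewrite opprK; exact.
move=> Mn; exists (- symi s (- n)); last by rewrite opprK symiK opprK.
by apply: contrapT => /sMP; rewrite symiK opprK.
Qed.

Definition sgnz (b : bool) : int := if b then - 1 else 1.

Lemma sgnzM b n : sgnz b * (sgnz b * n) = n.
Proof. by case: b; rewrite /sgnz ?mul1r// !mulN1r opprK. Qed.

(** The sign treats conjugacy to T2 (false) and to its inverse (true) at the
    same time. *)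
Definition sgn_sym b (s : symZN) : symZN := if b then flip_sym s else s.

Lemma sgn_symE b s n : sgn_sym b s n = sgnz b * s (sgnz b * n).
Proof. by case: b; rewrite /sgnz /= ?mul1r// !mulN1r. Qed.

Lemma sgn_symM b s t : sgn_sym b (s * t)%g = (sgn_sym b s * sgn_sym b t)%g.
Proof.
apply: symZN_eqP => n; rewrite [RHS]/= !sgn_symE sgnzM.
by rewrite -[in LHS]/(symZN_mul s t).
Qed.

Lemma sgn_symV b s : sgn_sym b (s^-1)%g = ((sgn_sym b s)^-1)%g.
Proof. by apply/esym/mulg1_eq; rewrite -sgn_symM mulgV;
    apply: symZN_eqP => n; rewrite sgn_symE sgnzM. Qed.

Lemma sgn_sym_pstab b (E : set (set int)) : finite_set E -> E `<=` commN ->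
  exists E' : set (set int), [/\ finite_set E', E' `<=` commN &
    forall s, pstab E' s -> pstab E (sgn_sym b s)].
Proof.
move=> fE EN; case: b; last by exists E.
exists (flip_set @` E); split; first exact: finite_image.
  by move=> _ [M EM <-]; apply: flip_set_commN; exact: EN.
by move=> s sE M EM; apply: flip_sym_pstab; apply: sE; exists M.
Qed.

End signed_conjugation.

Section conjugation.
Context d (X : measurableType d) (R : realType) (mu : probability X R).
Hypothesis standardX : standard_borel R X.
Implicit Types (T S : nsAut mu).

(** S maps T1-orbits to T2-orbits, preserving (false) or reversing (true)
    their order. *)
Definition carries (b : bool) T1 T2 S :=
  {ae mu, forall x, forall n, iterz T2 n (S x) = S (iterz T1 (sgnz b * n) x)}.

Lemma is_cocycle_conj b T1 T2 S g c : carries b T1 T2 S -> is_cocycle T1 g c ->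
  let c' := fun y => sgnz b * c (nsinv S y) in
  is_cocycle T2 (S * g * S^-1)%g c' /\
  {ae mu, forall x, forall n,
    orbit_map T2 c' x n = sgnz b * orbit_map T1 c (nsinv S x) (sgnz b * n)}.
Proof.
move=> SC [mc gc] c'; split; last first.
  have SC' := ae_nsfun (nsbij_inv S) SC; apply: filterS SC' => x;
      rewrite /= nsinvK => SC' n.
  by rewrite /orbit_map /c' SC' nsfunK mulrDr sgnzM.
split.
  move=> n; rewrite (_ : _ @^-1` _ = nsinv S @^-1` (c @^-1` [set sgnz b * n])).
    by apply: measurable_pre => //; exact: measurable_nsinv.
  by apply/seteqP; split => x; rewrite /c' /preimage /=; [move=> <-;
      rewrite sgnzM|move=> ->; rewrite sgnzM].
have h1 := nsAut_mulE (S * g)%g (S^-1)%g.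
have h2 := ae_nsfun (nsAut_inv S) (nsAut_mulE S g).
have SC' := ae_nsfun (nsbij_inv S) SC.
have gc' := ae_nsfun (nsbij_inv S) gc.
apply: filterS3 (filterI h1 h2) (nsAut_invE S) (filterI SC' gc').
move=> x [e1 e2] e3 [/= SCx gcx]; rewrite nsinvK in SCx.
by rewrite e1 e2 e3 gcx /c' SCx sgnzM.
Qed.

Lemma com_full_group_conj b T1 T2 S g : carries b T1 T2 S ->
  com_full_group T1 g -> com_full_group T2 (S * g * S^-1)%g.
Proof.
move=> SC [_ [c gc cN]]; have [gc' oE] := is_cocycle_conj SC gc.
split; first by apply: filterS gc'.2 => x ->; eexists.
eexists; first exact: gc'.
have cN' := ae_nsfun (nsbij_inv S) cN.
apply: filterS2 oE cN' => x oE [s sE]; exists (sgn_sym b s); apply/funext => n.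
by rewrite oE sgn_symE sE.
Qed.

Definition comfg_conj b T1 T2 S (SC : carries b T1 T2 S) (g : comfg T1) :
    comfg T2 :=
  Sub (S * val g * S^-1)%g (mem_set (com_full_group_conj SC (set_mem (valP
      g)))).

Lemma comfg_conjM b T1 T2 S (SC : carries b T1 T2 S) :
  {morph comfg_conj SC : x y / (x * y)%g}.
Proof.
move=> g h; apply: val_inj.
have valE k : val (comfg_conj SC k) = (S * val k * S^-1)%g by [].
by rewrite [RHS]valM !valE valM -!mulgA mulKg.
Qed.

(** The cocycle transported from g is the cocycle of the conjugate because T2
    is aperiodic. *)
Lemma Phi_comfg_conj b T1 T2 S (SC : carries b T1 T2 S) (g : comfg T1) :
  aperiodic T2 ->
  {ae mu, forall x, L0_val (Phi (comfg_conj SC g)) x = sgn_sym b (L0_val (Phi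
      g) (nsinv S x))}.
Proof.
move=> aT2; have PhiP T (k : comfg T) : is_Phi T (val k) (Phi k) by exact:
    projT2 (cid _).
have [c gc Fc] := PhiP _ g; have [c2 gc2 Fc2] := PhiP _ (comfg_conj SC g).
have [gc' oE] := is_cocycle_conj SC gc.
have c2c : {ae mu, forall x, c2 x = sgnz b * c (nsinv S x)}.
  apply: filterS3 aT2 gc2.2 gc'.2 => x ax -> e.
  apply/eqP; rewrite -subr_eq0; apply/negPn/negP => /ax; apply.
  by rewrite addrC iterzD e iterzK.
have c2cT : {ae mu, forall x, forall n, c2 (iterz T2 n x) = sgnz b * c (nsinv
    S (iterz T2 n x))}.
  by apply: ae_forallz => n; exact: (ae_iterz T2 n c2c).
have Fc' := ae_nsfun (nsbij_inv S) Fc.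
apply: filterS3 (filterI Fc2 Fc') oE c2cT => x [e1 /= e2] oE e3.
apply: symZN_eqP => n; rewrite e1 sgn_symE e2 -oE /orbit_map e3.
by [].
Qed.

(** Composition with the nonsingular map S^-1 preserves convergence in
    measure by [nsbij_small], and sgn_sym is continuous at 1 by
    [sgn_sym_pstab]. *)
Lemma comfg_conj_continuous b T1 T2 S (SC : carries b T1 T2 S) :
  aperiodic T2 -> continuous (comfg_conj SC).
Proof.
move=> aT2; apply: (@continuous_comp_initial _ _ _ (@Phi _ _ _ _ T2)).
move=> g A [U [e [[oU U1] e0 UA]]].
have [E [fE EN] EU] : nbhs (1%g : symZN) U by exact: open_nbhs_nbhs.
have {}EU : pstab E `<=` U.
  by move=> t tE; apply: EU; exists t => //; rewrite mul1g.
have [E' [fE' E'N E'E]] := sgn_sym_pstab b fE EN.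
have [delta delta0 dS] := nsbij_small (nsbij_inv S) e0.
have oE' := open_pstab fE' E'N.
have nB : nbhs (Phi g) (L0_ball (Phi g) (pstab E') delta).
  by exists (pstab E'), delta; split => //; split => //; exact: pstab1.
have nA : nbhs g (@Phi _ _ _ mu T1 @^-1` L0_ball (Phi g) (pstab E') delta).
  exact: initial_continuous nB.
apply: (filterS _ nA) => h; rewrite /L0_ball /= => gh; apply: UA;
    rewrite /L0_ball /=.
have mB := L0_bad_measurable (Phi g) (Phi h) oE'.
apply: le_lt_trans (dS _ mB gh).
have eg := Phi_comfg_conj SC g aT2; have eh := Phi_comfg_conj SC h aT2.
have mSB := measurable_pre (measurable_nsinv S) mB.
have mbad := L0_bad_measurable (Phi (comfg_conj SC g)) (Phi (comfg_conj SC h))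
    oU.
have mD := measurableD mbad mSB.
set P := [set x | ~ U _] in mbad mD *; set Q := _ @^-1` _ in mSB mD *.
have D0 : mu (P `\` Q) = 0%E.
  apply/ae_nullP => //; apply: filterS2 eg eh => x e1 e2 [Px nQx]; apply: Px.
  rewrite e1 e2 -sgn_symV -sgn_symM; apply/EU/E'E.
  by apply: contrapT.
rewrite -[leRHS]adde0 -D0 -measureU//; last by rewrite setDIK.
apply: le_measure; rewrite ?inE//; first exact: measurableU.
by move=> x Px; have [Qx|Qx] := pselect (Q x); [left|right].
Qed.

End conjugation.

(** * The equivalence *)

Section main.
Context d (X : measurableType d) (R : realType) (mu : probability X R).
Hypothesis standardX : standard_borel R X.
Hypothesis atomless_mu : atomless mu.
Implicit Types (T S U : nsAut mu).

Lemma conj_iterz T U S : (S * T = U * S)%g ->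
  {ae mu, forall x, forall n, iterz U n (S x) = S (iterz T n x)}.
Proof.
move=> /nsAut_eqP ST.
have step : {ae mu, forall x, S (T x) = U (S x)}.
  by apply: filterS3 ST (nsAut_mulE S T) (nsAut_mulE U S) => x + <- <-.
have stepT : {ae mu, forall x, forall n, S (T (iterz T n x)) = U (S (iterz T n
    x))}.
  by apply: ae_forallz => n; exact: (ae_iterz T n step).
apply: filterS stepT => x h n; elim/int_rect: n => [//|m IH|m IH].
  by rewrite intS addrC !iterzS h IH.
apply: (@nsfun_inj _ _ _ _ U); rewrite -h -!iterzS.
by rewrite (_ : - m.+1%:Z + 1 = - m%:Z)//; lia.
Qed.

Lemma carries_conj T1 T2 S : (S * T1 = T2 * S)%g -> carries false T1 T2 S.
Proof.
by move=> /conj_iterz; apply: filterS => x h n; rewrite /sgnz mul1r.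
Qed.

Lemma carries_flip T1 T2 S : (S * T1 = T2^-1 * S)%g -> carries true T1 T2 S.
Proof.
move=> /(@conj_iterz _ (nsAut_inv T2)) h.
have iE := ae_nsfun S (iterz_invE T2).
by apply: filterS2 h iE => x h iE n; rewrite /sgnz mulN1r -h iE opprK.
Qed.

Lemma carriesV b T1 T2 S : carries b T1 T2 S -> carries b T2 T1 (nsAut_inv S).
Proof.
move=> SC; have SC' := ae_nsfun (nsbij_inv S) SC.
have iE : {ae mu, forall x, forall n, nsAut_inv S (iterz T2 n x) = nsinv S
    (iterz T2 n x)}.
  by apply: ae_forallz => n; exact: (ae_iterz T2 n (nsAut_invE S)).
apply: filterS2 SC' iE => x /=; rewrite nsinvK => SC1 iE1 n.
by rewrite iE1 SC1 sgnzM nsfunK (iE1 0).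
Qed.

Lemma carries_top_isomorphic b T1 T2 S : aperiodic T1 -> aperiodic T2 ->
  carries b T1 T2 S -> comfg_top_isomorphic T1 T2.
Proof.
move=> aT1 aT2 SC; have SC' := carriesV SC.
pose f : {multiplicative comfg T1 -> comfg T2} :=
  HB.pack (comfg_conj SC) (isMultiplicative.Build _ _ (comfg_conj SC)
      (comfg_conjM SC)).
exists f, (comfg_conj SC'); split.
- move=> g; apply: val_inj; rewrite -[LHS]/(S^-1 * (S * val g * S^-1) *
      S^-1^-1)%g.
  by rewrite invgK -!mulgA mulVg mulg1 mulKg.
- move=> g; apply: val_inj; rewrite -[LHS]/(S * (S^-1 * val g * S^-1^-1) *
      S^-1)%g.
  by rewrite invgK -!mulgA mulgV mulg1 mulVKg.
- exact: comfg_conj_continuous.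
- exact: comfg_conj_continuous.
Qed.

Lemma flip_conjugate_top_isomorphic T1 T2 : aperiodic T1 -> aperiodic T2 ->
  flip_conjugate T1 T2 -> comfg_top_isomorphic T1 T2.
Proof.
move=> aT1 aT2 [S [e|e]].
  by apply: (carries_top_isomorphic aT1 aT2 (carries_conj (S := S) _));
      rewrite -e mulgVK.
by apply: (carries_top_isomorphic aT1 aT2 (carries_flip (S := S) _));
    rewrite -e mulgVK.
Qed.

(** Let U be the preimage of T2 under the isomorphism q. By [spatial_iso] it
    is conjugate to T2. It lies in the group of T1, and T1 lies in the full
    group of U since q T1 lies in that of T2, so [katznelson] applies to T1
    and U. *)
Lemma isomorphic_flip_conjugate T1 T2 : ergodic T1 -> ergodic T2 ->
  group_isomorphic (comfg T1) (comfg T2) -> flip_conjugate T1 T2.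
Proof.
move=> e1 e2 [q [r qK rK]].
have aT1 := ergodic_aperiodic standardX atomless_mu e1.
have aT2 := ergodic_aperiodic standardX atomless_mu e2.
have qM : {morph q : x y / (x * y)%g} by exact: gmulfM.
have rM := can2_gmulfM qK rK.
have [S SE] := spatial_iso standardX atomless_mu e1 e2 qM rM qK rK.
pose t1 : comfg T1 := Sub T1 (mem_set (com_full_group_self T1)).
pose t2 : comfg T2 := Sub T2 (mem_set (com_full_group_self T2)).
pose U : nsAut mu := val (r t2).
have US : (U * S = S * T2)%g by rewrite SE rK.
have conjU := conj_iterz (esym US).
have conjU' : {ae mu, forall x, forall n, iterz U n x = S (iterz T2 n (nsinv S
    x))}.
  have := ae_nsfun (nsbij_inv S) conjU; apply: filterS => x /= h n.
  by rewrite -h nsinvK.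
have aU : aperiodic U.
  have aT2' := ae_nsfun (nsbij_inv S) aT2.
  apply: filterS2 conjU' aT2' => x h a n n0; rewrite h => e;
      apply: (a n n0) => /=.
  by apply: (@nsfun_inj _ _ _ _ S); rewrite e nsinvK.
have cU : com_full_group T1 U by exact: set_mem (valP (r t2)).
have fT : full_group U T1.
  have [fV _] := set_mem (valP (q t1)).
  have TS := nsAut_mulP (SE t1).
  have fV' := ae_nsfun (nsbij_inv S) fV.
  have h1 := ae_nsfun (nsbij_inv S) TS.
  have h2 := ae_nsfun (nsbij_inv S) (nsAut_mulE S (val (q t1))).
  rewrite /full_group /=; apply: filterS3 (filterI h1 h2) fV' conjU'.
  move=> x [/= a b] [n fn] h; exists n; rewrite h -fn -b -a nsinvK.
  by [].
have [S' S'E] := katznelson standardX e1 aT1 aU cU fT.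
have UE : (U = S * T2 * S^-1)%g by rewrite -US mulgK.
exists (S^-1 * S')%g; rewrite invgM invgK -!mulgA.
case: S'E => e; [left|right].
  by rewrite (mulgA S') e -!mulgA mulVKg UE -!mulgA mulKg mulVg mulg1.
rewrite (mulgA S') e -!mulgA mulVKg UE !invgM invgK -!mulgA.
by rewrite mulKg mulVg mulg1.
Qed.

End main.

Theorem theorem1 (R : realType) (d : measure_display) (X : measurableType d)
    (mu : probability X R) (T1 T2 : nsAut mu)
    (standardX : standard_borel R X) (atomless_mu : atomless mu)
    (ergodicT1 : ergodic T1) (ergodicT2 : ergodic T2) :
  (group_isomorphic (comfg T1) (comfg T2) <-> comfg_top_isomorphic T1 T2) /\
  (comfg_top_isomorphic T1 T2 <-> flip_conjugate T1 T2).
Proof.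
have aT1 := ergodic_aperiodic standardX atomless_mu ergodicT1.
have aT2 := ergodic_aperiodic standardX atomless_mu ergodicT2.
have iso : comfg_top_isomorphic T1 T2 -> group_isomorphic (comfg T1) (comfg T2).
  by move=> [f [g [fK gK _ _]]]; exists f; exists g.
have flip := isomorphic_flip_conjugate standardX atomless_mu ergodicT1
    ergodicT2.
have top := flip_conjugate_top_isomorphic aT1 aT2.
by split; split; [move=> /flip/top|exact: iso|move=> /iso/flip|exact: top].
Qed.
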